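(* Let $\Phi$ be a Young function with $\Phi\in\Delta_2$ and $\widetilde\Phi\in\Delta_2$, and let $E$ be a fundamental sequence. Then any bounded sequence $(u_\epsilon)_{\epsilon\in E}$ in $L^{\Phi}(Q\times\Omega)$ admits a subsequence which is weakly stochastically 2-scale convergent in $L^{\Phi}(Q\times\Omega)$ (that is, convergent to some $u_0\in L^{\Phi}(Q\times\Omega\times Y_{per})$ stoch. in $L^{\Phi}(Q\times\Omega)$-weak 2s).
   Context: All spaces are real. $Q$ is a bounded open subset of $\mathbb{R}^N$ ($N>1$), $Y=[0,1]^N$. $(\Omega,\mathscr{M},\mu)$ is a probability space. Young functions: $\Phi:[0,\infty)\to[0,\infty)$ is a Young function if it is continuous, convex, $\Phi(t)>0$ for $t>0$, $\Phi(t)/t\to0$ as $t\to0$ and $\Phi(t)/t\to\infty$ as $t\to\infty$. Its conjugate is $\widetilde\Phi(t)=\sup_{s\ge0}\{st-\Phi(s)\}$, $t\ge 0$. $\Phi\in\Delta_2$ means there are $\alpha>0$, $t_0\ge0$ with $\Phi(2t)\le\alpha\Phi(t)$ for all $t\ge t_0$. Orlicz spaces: for a measure space $(X,m)$, $L^{\Phi}(X)$ is the space of measurable $u:X\to\mathbb{R}$ (mod a.e. equality) with $\int_X\Phi(|u|/\delta)\,dm<\infty$ for some $\delta>0$, with Luxemburg norm $\|u\|_{L^\Phi(X)}=\inf\{\delta>0:\int_X\Phi(|u|/\delta)\,dm\le1\}$. $Q\times\Omega$ carries $dx\otimes\mu$. Standing assumption: $L^{\Phi}(\Omega)$ is separable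 and reflexive. $L^{\Phi}(Q\times\Omega\times Y_{per})$ is the space of $u\in L^{\Phi}_{loc}(Q\times\Omega\times\mathbb{R}^N_y)$ such that $u(x,\omega,\cdot)$ is $Y$-periodic for a.e. $(x,\omega)$, with the norm of $L^{\Phi}(Q\times\Omega\times Y)$. Dynamical system: $\{T(x):\Omega\to\Omega,\ x\in\mathbb{R}^N\}$ is a fixed $N$-dimensional dynamical system on $\Omega$ for which $\mu$ is invariant: $T(0)=\mathrm{Id}$, $T(x+x')=T(x)T(x')$, $\mu(T(x)^{-1}A)=\mu(A)$ for $A\in\mathscr{M}$, and $(x,\omega)\mapsto T(x)\omega$ is measurable. The $i$-th stochastic derivative is $D_{i,\Phi}f=\lim_{t\to0}t^{-1}(f(T(te_i)\cdot)-f)$ (limit in $L^{\Phi}(\Omega)$), defined for those $f\in L^{\Phi}(\Omega)$ for which the limit exists. $\mathcal{C}^\infty(\Omega)$ is the space of $f\in L^{\Phi}(\Omega)$ possessing stochastic derivatives $D_\Phi^{\alpha}f=D_{1,\Phi}^{\alpha_1}\cdots D_{N,\Phi}^{\alpha_N}f$ of every order $\alpha\in\mathbb{N}^N$ (including $\alpha=0$), all of them bounded. A fundamental sequence is a sequence $E=(\epsilon_n)_{n\ge0}$ with $0<\epsilon_n\le1$ and $\epsilon_n\to0$. Convergence: $\mathcal{C}_0^\infty(Q)$ denotes smooth functions with compact support in $Q$; $\mathcal{C}^\infty_{per}(Y)$ smooth $Y$-periodic functions on $\mathbb{R}^N$. A bounded sequence $(u_\epsilon)$ in $L^{\Phi}(Q\times\Omega)$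 weakly stochastically 2-scale converges to $u_0\in L^{\Phi}(Q\times\Omega\times Y_{per})$ (written $u_\epsilon\to u_0$ stoch. in $L^{\Phi}(Q\times\Omega)$-weak 2s) if, as $\epsilon\to0$, $$\iint_{Q\times\Omega}u_\epsilon(x,\omega)f\Big(x,T\big(\tfrac{x}{\epsilon}\big)\omega,\tfrac{x}{\epsilon^2}\Big)dx\,d\mu\to\iiint_{Q\times\Omega\times Y}u_0(x,\omega,y)f(x,\omega,y)\,dx\,d\mu\,dy$$ for every $f\in\mathcal{C}_0^\infty(Q)\otimes\mathcal{C}^\infty(\Omega)\otimes\mathcal{C}^\infty_{per}(Y)$ (finite sums of products). *)

(* Defs.v *)
From HB Require Import structures.
From mathcomp Require Import all_boot all_order all_algebra.
From mathcomp Require Import all_classical all_reals all_analysis.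

Set Implicit Arguments.
Unset Strict Implicit.
Unset Printing Implicit Defensive.
Import Order.TTheory GRing.Theory Num.Theory.
Import numFieldNormedType.Exports.
Local Open Scope classical_set_scope.
Local Open Scope ring_scope.

Section borel_rV.
Context (R : realType) (n : nat).

Let rV_measurable : set (set 'rV[R]_n) := <<s open >>.

Let rV_measurable0 : rV_measurable set0.
Proof. exact: sigma_algebra0. Qed.

Let rV_measurableC A : rV_measurable A -> rV_measurable (~` A).
Proof. exact: sigma_algebraC. Qed.

Let rV_measurable_bigcup (F : (set 'rV[R]_n)^nat) :
  (forall i, rV_measurable (F i)) -> rV_measurable (\bigcup_i F i).
Proof. exact: sigma_algebra_bigcup. Qed.

HB.instance Definition _ := @isMeasurable.Build (sigma_display (@open 'rV[R]_n))
  'rV[R]_n rV_measurable rV_measurable0 rV_measurableC rV_measurable_bigcup.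

Lemma measurable_rVE : @measurable _ 'rV[R]_n = <<s open >>.
Proof. by []. Qed.

Lemma open_measurable_rV (U : set 'rV[R]_n) : open U -> measurable U.
Proof. exact: sub_sigma_algebra. Qed.

Lemma measurable_coord (i : 'I_n) :
  measurable_fun setT (fun x : 'rV[R]_n => x ord0 i).
Proof.
apply: (measurability _ (measurable_realfun.RGenOpens.measurableE R)).
move=> _ [_ [a [b ->] <-]]; rewrite setTI; apply: open_measurable_rV.
have /continuousP := @coord_continuous R 1 n ord0 i; apply.
exact: interval_open.
Qed.

Definition open_box (a b : 'rV[R]_n) : set 'rV[R]_n :=
  [set x | forall i, a ord0 i < x ord0 i < b ord0 i].

Lemma open_bigcup_box (U : set 'rV[R]_n) : open U ->
  U = \bigcup_(ab in [set ab : 'rV[rat]_n * 'rV[rat]_n |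
         open_box (map_mx ratr ab.1) (map_mx ratr ab.2) `<=` U])
      open_box (map_mx ratr ab.1) (map_mx ratr ab.2).
Proof.
move=> oU; apply/seteqP; split=> [x Ux|x [ab /= + abx]]; last exact.
have /nbhs_ballP[e /= e0 xeU] : nbhs x U by exact: open_nbhs_nbhs.
have lo i : {q : rat | x ord0 i - e < ratr q < x ord0 i}.
  by apply: cid; have /rat_in_itvoo[q] : x ord0 i - e < x ord0 i
    by [rewrite gtrBl]; exists q.
have hi i : {q : rat | x ord0 i < ratr q < x ord0 i + e}.
  by apply: cid; have /rat_in_itvoo[q] : x ord0 i < x ord0 i + e
    by [rewrite ltrDl]; exists q.
exists (\row_i sval (lo i), \row_i sval (hi i)) => /=; last first.
  move=> i; rewrite !mxE; case: (lo i) (hi i) => p /= /andP[_ ->].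
  by case=> q /= /andP[->].
move=> y abz; apply: xeU; split => // i j; rewrite ord1 -ball_normE /=.
have := abz j; rewrite !mxE; case: (lo j) (hi j) => p /= /andP[p1 p2].
case=> q /= /andP[q1 q2] /andP[py yq].
rewrite distrC ltr_distl (lt_trans _ py)//=.
exact: lt_trans yq _.
Qed.

Lemma measurable_fun_rVP d (X : measurableType d) (f : X -> 'rV[R]_n) :
  (forall i, measurable_fun setT (fun x => f x ord0 i)) -> measurable_fun setT f.
Proof.
move=> mf; apply: (measurability _ measurable_rVE) => //.
move=> _ [U oU <-]; rewrite setTI (open_bigcup_box oU) preimage_bigcup.
rewrite bigcup_mkcond; apply: countable_bigcupT_measurable => // -[a b].
case: ifP => // _.
rewrite (_ : _ @^-1` _ = \bigcap_(i in [set: 'I_n])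
  ((fun x => f x ord0 i) @^-1` `]ratr (a ord0 i), ratr (b ord0 i)[)); last first.
  apply/seteqP; split=> [x fx i _|x fx i]; rewrite /= ?in_itv/=.
    by have := fx i; rewrite !mxE.
  by have := fx i Logic.I; rewrite !mxE /= in_itv.
apply: fin_bigcap_measurable => // i _.
by rewrite -[X in measurable X]setTI; apply: mf => //; exact: measurable_itv.
Qed.
End borel_rV.

(* The sigma-finiteness instance of mu1 \x mu2 is shadowed in the library by the
   one for subprobabilities, hence is not inferred. *)
Lemma sigma_finite_prod d1 d2 (T1 : measurableType d1) (T2 : measurableType d2)
    (R : realType) (m1 : {sigma_finite_measure set T1 -> \bar R})
    (m2 : {sigma_finite_measure set T2 -> \bar R}) :
  sigma_finite setT (m1 \x m2)%E.
Proof.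
have [F [TF ndF Foo]] := (sigma_finiteP _ _).1 (sigma_finiteT m1).
have [G [TG ndG Goo]] := (sigma_finiteP _ _).1 (sigma_finiteT m2).
exists (fun n => F n `*` G n).
  rewrite -setXTT TF TG; apply/seteqP; split=> [[x y] [/= [n _ Fnx] [k _ Gky]]|].
    exists (maxn n k) => //; split.
    - by move: Fnx; exact/subsetPset/ndF/leq_maxl.
    - by move: Gky; exact/subsetPset/ndG/leq_maxr.
  by move=> [x y] [n _ []/= ? ?]; split; exists n.
move=> k; have [mF Fk] := Foo k; have [mG Gk] := Goo k.
split; first exact: measurableX.
by rewrite product_measure1E// lte_mul_pinfty// ge0_fin_numE.
Qed.

Section lebesgue_rV_step.
Context (R : realType) (n : nat).
Variable m : {sigma_finite_measure set 'rV[R]_n -> \bar R}.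

Definition rV_cons (p : measurableTypeR R * 'rV[R]_n) : 'rV[R]_n.+1 :=
  \row_i oapp (p.2 ord0) p.1 (unlift ord0 i).

Lemma rV_cons0 p : rV_cons p ord0 ord0 = p.1.
Proof. by rewrite mxE unlift_none. Qed.

Lemma rV_consS p i : rV_cons p ord0 (lift ord0 i) = p.2 ord0 i.
Proof. by rewrite mxE liftK. Qed.

Definition rV_uncons (x : 'rV[R]_n.+1) : measurableTypeR R * 'rV[R]_n :=
  (x ord0 ord0, \row_i x ord0 (lift ord0 i)).

Lemma rV_consK : cancel rV_cons rV_uncons.
Proof.
move=> [a v]; rewrite /rV_uncons rV_cons0; congr (_, _).
by apply/rowP => i; rewrite mxE rV_consS.
Qed.

Lemma measurable_rV_cons : measurable_fun setT rV_cons.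
Proof.
apply: measurable_fun_rVP => i; have [j ->|->] := fintype.unliftP ord0 i.
  under eq_fun do rewrite rV_consS.
  exact: (measurableT_comp (@measurable_coord R n j) measurable_snd).
by under eq_fun do rewrite rV_cons0; exact: measurable_fst.
Qed.

Lemma measurable_rV_uncons : measurable_fun setT rV_uncons.
Proof.
apply: measurable_fun_pair; first exact: measurable_coord.
apply: measurable_fun_rVP => i; under eq_fun do rewrite mxE.
exact: measurable_coord.
Qed.

Definition lebesgue_rV_step : set 'rV[R]_n.+1 -> \bar R :=
  pushforward (@lebesgue_measure R \x m)%E rV_cons.

Let preimage_measurable A :
  measurable A -> measurable (rV_cons @^-1` A).
Proof. by rewrite -[X in _ -> measurable X]setTI; exact: measurable_rV_cons. Qed.

Let lebesgue_rV_step0 : lebesgue_rV_step set0 = 0%E.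
Proof. by rewrite /lebesgue_rV_step /pushforward preimage_set0 measure0. Qed.

Let lebesgue_rV_step_ge0 A : (0 <= lebesgue_rV_step A)%E.
Proof. by rewrite /lebesgue_rV_step /pushforward measure_ge0. Qed.

Let lebesgue_rV_step_sigma_additive : semi_sigma_additive lebesgue_rV_step.
Proof.
move=> F mF tF mUF; rewrite /lebesgue_rV_step /pushforward preimage_bigcup.
apply: measure_semi_sigma_additive.
- by move=> k; exact: preimage_measurable.
- apply/trivIsetP => i j _ _ ij; rewrite -preimage_setI.
  by move/trivIsetP : tF => /(_ _ _ _ _ ij) ->//; rewrite preimage_set0.
- by rewrite -preimage_bigcup; exact: preimage_measurable.
Qed.

HB.instance Definition _ := isMeasure.Build _ _ _ lebesgue_rV_step
  lebesgue_rV_step0 lebesgue_rV_step_ge0 lebesgue_rV_step_sigma_additive.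

Let lebesgue_rV_step_sigma_finite : sigma_finite setT lebesgue_rV_step.
Proof.
have [F FT Foo] : sigma_finite setT (@lebesgue_measure R \x m)%E.
  exact: sigma_finite_prod.
exists (fun k => rV_uncons @^-1` F k).
  by rewrite -preimage_bigcup -FT preimage_setT.
move=> k; have [mF Fk] := Foo k; split.
  by rewrite -[X in measurable X]setTI; exact: measurable_rV_uncons.
by rewrite /lebesgue_rV_step /pushforward -comp_preimage (_ : _ \o _ = id)//;
  apply/funext => p; exact: rV_consK.
Qed.

HB.instance Definition _ := Measure_isSigmaFinite.Build _ _ _ lebesgue_rV_step
  lebesgue_rV_step_sigma_finite.

End lebesgue_rV_step.

Fixpoint lebesgue_rV (R : realType) (n : nat) :
    {sigma_finite_measure set 'rV[R]_n -> \bar R} :=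
  match n with
  | 0 => @dirac _ 'rV[R]_0 0 R
  | n'.+1 => lebesgue_rV_step (lebesgue_rV R n')
  end.

Lemma lebesgue_rV_box (R : realType) (n : nat) (A : 'I_n -> set R) :
  (forall i, measurable (A i)) ->
  lebesgue_rV R n [set x : 'rV[R]_n | forall i, A i (x ord0 i)] =
  (\prod_(i < n) @lebesgue_measure R (A i))%E.
Proof.
elim: n A => [|n IH] A mA.
  by rewrite big_ord0 /= diracE mem_set// => -[].
rewrite big_ord_recl/= -IH// -product_measure1E//; last 2 first.
- exact: mA.
- rewrite (_ : [set _ | _] = \bigcap_(i in [set: 'I_n])
    ((fun x : 'rV[R]_n => x ord0 i) @^-1` A (lift ord0 i))); last first.
    by apply/seteqP; split=> [x /= + i _|x /= + i]; exact.
  apply: fin_bigcap_measurable => // i _.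
  by rewrite -[X in measurable X]setTI; exact: measurable_coord.
congr ((@lebesgue_measure R \x lebesgue_rV R n)%E _).
apply/seteqP; split=> -[a v] /= H.
  split=> [|i]; first by have := H ord0; rewrite rV_cons0.
  by have := H (lift ord0 i); rewrite rV_consS.
by move=> i; have [j ->|->] := fintype.unliftP ord0 i;
  rewrite ?rV_consS ?rV_cons0; case: H.
Qed.

Section young.
Context {R : realType}.
Implicit Type Phi : R -> R.

(* Phi : [0, +oo[ -> [0, +oo[ is represented by a function on R, of which only
   the values on [0, +oo[ matter. *)
Record young_function Phi : Prop := {
  young_ge0 : forall t, 0 <= t -> 0 <= Phi t ;
  young_continuous : {within `[0, +oo[, continuous Phi} ;
  young_convex : convex_function (`[0, +oo[%classic : set R) Phi ;
  young_gt0 : forall t, 0 < t -> 0 < Phi t ;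
  young_cvg0 : Phi t / t @[t --> 0^'+] --> (0 : R) ;
  young_cvgy : Phi t / t @[t --> +oo] --> +oo }.

(* the supremum is finite for t >= 0 because Phi t / t tends to +oo *)
Definition conjugate Phi (t : R) : R := sup [set s * t - Phi s | s in `[0, +oo[].

Definition Delta2 Phi : Prop :=
  exists alpha t0 : R,
    [/\ 0 < alpha, 0 <= t0 & forall t, t0 <= t -> Phi (2 * t) <= alpha * Phi t].

End young.

(* Elements of L^Phi are handled through representatives: orlicz is a set of
   functions and luxemburg is a seminorm on it, with kernel the functions that
   vanish a.e.; the usual space is the quotient. *)
Section orlicz.
Context {R : realType} d (X : measurableType d).
Variables (mu : {measure set X -> \bar R}) (D : set X) (Phi : R -> R).

Definition modular (delta : R) (u : X -> R) : \bar R :=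
  \int[mu]_(x in D) (Phi (`|u x| / delta))%:E.

Definition orlicz : set (X -> R) :=
  [set u | measurable_fun D u /\
           exists2 delta, 0 < delta & (modular delta u < +oo)%E].

Definition luxemburg (u : X -> R) : R :=
  inf [set delta | 0 < delta /\ (modular delta u <= 1)%E].

End orlicz.

(* A subspace E of V with a seminorm p on it stands for the normed space
   E / {p = 0}: the notions below depend on nothing else. *)
Section seminormed.
Context {R : realType} {V : lmodType R}.
Variables (E : set V) (p : V -> R).

Definition separable_space : Prop :=
  exists D : set V, [/\ countable D, D `<=` E &
    forall u e, E u -> 0 < e -> exists2 v, D v & p (u - v) < e].

Definition dual_space : set (V -> R) :=
  [set l | (forall (a : R) u v, E u -> E v -> l (a *: u + v) = a * l u + l v) /\
           exists M : R, forall u, E u -> `|l u| <= M * p u].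

Definition dual_norm (l : V -> R) : R :=
  inf [set M | 0 <= M /\ forall u, E u -> `|l u| <= M * p u].

End seminormed.

(* surjectivity of the canonical map into the bidual *)
Definition reflexive_space {R : realType} {V : lmodType R}
    (E : set V) (p : V -> R) : Prop :=
  forall F : (V -> R) -> R, dual_space (dual_space E p) (dual_norm E p) F ->
    exists2 u, E u & forall l, dual_space E p l -> F l = l u.

Section euclidean_functions.
Context {R : realType} {N : nat}.
Implicit Type f : 'rV[R]_N -> R.

Definition unit_cube : set 'rV[R]_N := [set y | forall i, 0 <= y ord0 i <= 1].

Definition Y_periodic f : Prop :=
  forall (k : 'rV[int]_N) y, f (y + map_mx intr k) = f y.

Definition partials (s : seq 'I_N) f : 'rV[R]_N -> R :=
  foldr (fun i g => 'D_(delta_mx ord0 i) g) f s.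

Definition smooth f : Prop :=
  forall s : seq 'I_N, continuous (partials s f) /\
    forall i x, derivable (partials s f) x (delta_mx ord0 i).

(* functions on Q are extended by 0 outside of Q *)
Definition smooth_compact (Q : set 'rV[R]_N) : set ('rV[R]_N -> R) :=
  [set f | [/\ smooth f, compact (closure [set x | f x != 0]) &
               closure [set x | f x != 0] `<=` Q]].

Definition smooth_periodic : set ('rV[R]_N -> R) :=
  [set f | smooth f /\ Y_periodic f].

End euclidean_functions.

Section dynamical_system.
Context {R : realType} {N : nat} d (Omega : measurableType d).
Variables (P : probability Omega R) (T : 'rV[R]_N -> Omega -> Omega).

Record dynamical_system : Prop := {
  dynsys0 : T 0 = id ;
  dynsysD : forall x x', T (x + x') = T x \o T x' ;
  dynsys_invariant : forall x A, measurable A -> P (T x @^-1` A) = P A ;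
  dynsys_measurable :
    measurable_fun setT (fun z : 'rV[R]_N * Omega => T z.1 z.2) }.

Variable Phi : R -> R.
Local Notation L := (orlicz P setT Phi).
Local Notation norm := (luxemburg P setT Phi).

(* g is a version of D_{i,Phi} f *)
Definition stoch_derive (i : 'I_N) (f g : Omega -> R) : Prop :=
  [/\ L f, L g &
    norm (fun w => t^-1 * (f (T (t *: delta_mx ord0 i) w) - f w) - g w)
      @[t --> 0^'] --> (0 : R)].

(* for s = [:: i_1; ...; i_k], g is a version of D_{i_1} ... D_{i_k} f *)
Fixpoint stoch_derives (s : seq 'I_N) (f g : Omega -> R) : Prop :=
  match s with
  | [::] => g = f
  | i :: s' => exists2 h, stoch_derives s' f h & stoch_derive i h g
  end.

Definition multi_index_seq (alpha : 'I_N -> nat) : seq 'I_N :=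
  flatten [seq nseq (alpha i) i | i <- enum 'I_N].

(* boundedness is that of a class modulo a.e. equality *)
Definition smooth_Omega : set (Omega -> R) :=
  [set f | L f /\ forall alpha : 'I_N -> nat, exists2 g,
    stoch_derives (multi_index_seq alpha) f g &
    exists M : R, {ae P, forall w, `|g w| <= M}].

End dynamical_system.

Definition fundamental_sequence {R : realType} (eps : nat -> R) : Prop :=
  (forall n, 0 < eps n <= 1) /\ eps n @[n --> \oo] --> (0 : R).

Section two_scale.
Context {R : realType} {N : nat} d (Omega : measurableType d).
Variables (Q : set 'rV[R]_N) (P : probability Omega R).
Variables (T : 'rV[R]_N -> Omega -> Omega) (Phi : R -> R).
Local Notation lambda := (lebesgue_rV R N).

Definition L_QOmega : set ('rV[R]_N * Omega -> R) :=
  orlicz (lambda \x P)%E (Q `*` setT) Phi.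

Definition norm_QOmega : ('rV[R]_N * Omega -> R) -> R :=
  luxemburg (lambda \x P)%E (Q `*` setT) Phi.

Definition bounded_sequence (u : nat -> 'rV[R]_N * Omega -> R) : Prop :=
  (forall n, L_QOmega (u n)) /\ exists C : R, forall n, norm_QOmega (u n) <= C.

(* Local integrability is in y: the finiteness of the norm of
   L^Phi(Q x Omega x Y) is the case K = Y. *)
Definition L_QOmegaYper : set ('rV[R]_N * Omega * 'rV[R]_N -> R) :=
  [set u | (forall K : set 'rV[R]_N, compact K ->
              orlicz ((lambda \x P) \x lambda)%E (Q `*` setT `*` K) Phi u) /\
           {ae (lambda \x P)%E, forall z, Q z.1 -> Y_periodic (fun y => u (z, y))}].

(* C_0^oo(Q) (x) C^oo(Omega) (x) C^oo_per(Y) *)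
Definition test_function : set ('rV[R]_N * Omega * 'rV[R]_N -> R) :=
  [set f | exists (m : nat) (phi : 'I_m -> 'rV[R]_N -> R)
      (g : 'I_m -> Omega -> R) (psi : 'I_m -> 'rV[R]_N -> R),
    [/\ forall j, smooth_compact Q (phi j),
        forall j, smooth_Omega P T Phi (g j),
        forall j, smooth_periodic (psi j) &
        f = fun z => \sum_(j < m) phi j z.1.1 * g j z.1.2 * psi j z.2]].

Definition weak_2s_cvg (eps : nat -> R) (u : nat -> 'rV[R]_N * Omega -> R)
    (u0 : 'rV[R]_N * Omega * 'rV[R]_N -> R) : Prop :=
  [/\ bounded_sequence u, L_QOmegaYper u0 & forall f, test_function f ->
    \int[(lambda \x P)%E]_(z in Q `*` setT)
       (u n z * f (z.1, T ((eps n)^-1 *: z.1) z.2, (eps n ^+ 2)^-1 *: z.1))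
      @[n --> \oo] -->
    \int[((lambda \x P) \x lambda)%E]_(z in Q `*` setT `*` unit_cube)
       (u0 z * f z)].

End two_scale.

(* Main.v *)
Require Import Defs.
From HB Require Import structures.
From mathcomp Require Import all_boot all_order all_algebra.
From mathcomp Require Import all_classical all_reals all_analysis.
From mathcomp Require Import measurable_realfun interval_inference zify ring lra.
Set Implicit Arguments.
Unset Strict Implicit.
Unset Printing Implicit Defensive.
Import Order.TTheory GRing.Theory Num.Theory.
Import numFieldNormedType.Exports.
Local Open Scope classical_set_scope.
Local Open Scope ring_scope.

(* Let S_n (x, w) = (x, T (x / eps_n) w, frac (x / eps_n ^ 2)). Since T preserves P and
   frac (x / eps_n ^ 2) equidistributes, the preimage under S_n of a finite
   intersection J of sets {x_i < q}, {d_j < q}, {y_i < q}, with (d_j) dense in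
   L^Phi (Omega) and q rational, has a measure tending to that of J. Along a
   subsequence, the integrals of min (u_n^+, M) 1_J (S_n) and min (u_n^-, M) 1_J (S_n)
   converge for all such J and all integers M. For fixed M the limit F is a functional on
   step functions with 0 <= F s <= M int s for s >= 0; it is represented by a density w^M,
   obtained by minimising (int s ^ 2) / 2 - F s over step functions s, so that no duality
   theorem for Orlicz spaces is needed. The w^M increase with M, and the subgradient
   inequality for Phi bounds int Phi (w^M), so that their limit has a finite modular. As
   Phi is superlinear, the modular bound gives uniform integrability, which lets the
   convergence pass from step functions to test functions: the bounded factor in
   C^oo (Omega) is close in L^1 (P) to some truncated d_j. The limit density is
   extended by periodicity in y. *)

(** * Real-valued integrals *)

(** The sets J suit both sides of the argument. In a box times [Omega] times the unit cube each of
    them is a product of intervals and one event, so the measure of a preimage under S_n factors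
    coordinate by coordinate; and they are countably many, so one diagonal extraction serves all of
    them. The map (x, w) |-> (x, T (x / eps_n) w) preserves the product measure exactly: only the
    fractional parts need a limit. As [Q] is not a product, the sequence is extended by 0 to a
    half-open box containing [Q]; test functions vanish outside [Q]. Dividing u_n by a constant
    above all the norms makes every modular at most 1. A density obtained by minimisation is an a.e.
    limit of step functions with values in [0, M]. Comparisons of densities (monotonicity in M,
    modular bound) are tested on functions built from these approximations, which are again step
    functions, so no density theorem for step functions enters. Truncation and the splitting into
    positive and negative parts ensure 0 <= v <= M, which bounds the minimised functional from
    below. *)

Section real_integrals.
Context {R : realType} d (X : measurableType d) (mu : {measure set X -> \bar R}).
Variables (D : set X) (mD : measurable D) (muD : (mu D < +oo)%E).
Implicit Types f g : X -> R.

Definition rintegrable (f : X -> R) :=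
  measurable_fun setT f /\ mu.-integrable D (EFin \o f).

Definition bounded_measurable (f : X -> R) :=
  measurable_fun setT f /\ exists K : R, forall x, D x -> `|f x| <= K.

Lemma bounded_measurable_rintegrable f : bounded_measurable f -> rintegrable f.
Proof.
move=> [mf [K fK]]; split=> //.
apply: (@le_integrable _ _ _ mu D mD _ (cst K%:E)).
- by apply/measurable_EFinP; exact: measurable_funTS.
- by move=> x Dx /=; rewrite lee_fin (le_trans (fK _ Dx))// ler_norm.
- by apply/integrableP; split => //; rewrite integral_cst//= lte_mul_pinfty.
Qed.

Lemma rintegrable_comb a f g : rintegrable f -> rintegrable g ->
  rintegrable (fun x => a * f x + g x).
Proof.
move=> [mf jf] [mg ig]; split.
  by apply: measurable_funD => //; exact: measurable_funM.
have := integrableD mD (integrableZl mD a jf) ig.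
by apply: eq_integrable => // x _ /=; rewrite EFinD EFinM.
Qed.

Lemma Rintegral_comb a f g : rintegrable f -> rintegrable g ->
  \int[mu]_(x in D) (a * f x + g x) =
  a * \int[mu]_(x in D) f x + \int[mu]_(x in D) g x.
Proof.
move=> [mf jf] [mg ig]; rewrite RintegralD ?RintegralZl//.
exact: (integrableZl mD a jf).
Qed.

Lemma rintegrableZ a f : rintegrable f -> rintegrable (fun x => a * f x).
Proof.
move=> [mf jf]; split; first exact: measurable_funM.
exact: (integrableZl mD a jf).
Qed.

Lemma Rintegral_comb2 a b f g : rintegrable f -> rintegrable g ->
  \int[mu]_(x in D) (a * f x + b * g x) =
  a * \int[mu]_(x in D) f x + b * \int[mu]_(x in D) g x.
Proof.
move=> hf hg; rewrite Rintegral_comb ?RintegralZl//; first by case: hg.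
exact: rintegrableZ.
Qed.

Lemma rintegrableB f g : rintegrable f -> rintegrable g ->
  rintegrable (fun x => f x - g x).
Proof.
move=> hf hg; have := rintegrable_comb (-1) hg hf.
by congr rintegrable; apply/funext => x; rewrite mulN1r addrC.
Qed.

Lemma rintegrable_le f g : measurable_fun setT f -> rintegrable g ->
  (forall x, D x -> `|f x| <= g x) -> rintegrable f.
Proof.
move=> mf [mg ig] fg; split=> //; apply: (le_integrable mD _ _ ig).
  by apply/measurable_EFinP; exact: measurable_funTS.
by move=> x Dx /=; rewrite lee_fin (le_trans (fg _ Dx))// ler_norm.
Qed.

Lemma rintegrable_norm f : rintegrable f -> rintegrable (fun x => `|f x|).
Proof.
move=> [mf jf]; split; first exact: measurableT_comp.
exact: integrable_norm.
Qed.

Lemma rintegrableM f g : rintegrable f -> bounded_measurable g ->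
  rintegrable (fun x => f x * g x).
Proof.
move=> hf [mg [K gK]]; have [mf jf] := hf.
apply: (rintegrable_le (g := fun x => K * `|f x| + 0)) => //.
- exact: measurable_funM.
- apply: rintegrable_comb; first exact: rintegrable_norm.
  by apply: bounded_measurable_rintegrable; split => //; exists 0 => x _; rewrite normr0.
- move=> x Dx; rewrite addr0 normrM mulrC ler_wpM2r//; exact: gK.
Qed.

Lemma bounded_measurable_cst c : bounded_measurable (fun=> c).
Proof. by split => //; exists `|c|. Qed.

Lemma bounded_measurableM f g : bounded_measurable f -> bounded_measurable g ->
  bounded_measurable (fun x => f x * g x).
Proof.
move=> [mf [K fK]] [mg [L gL]]; split; first exact: measurable_funM.
by exists (K * L) => x Dx; rewrite normrM ler_pM// ?fK ?gL.
Qed.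

Lemma Rintegral_le f g : rintegrable f -> rintegrable g ->
  (forall x, D x -> f x <= g x) ->
  \int[mu]_(x in D) f x <= \int[mu]_(x in D) g x.
Proof. by move=> [_ ?] [_ ?] fg; exact: le_Rintegral. Qed.

Lemma Rintegral_comb4_ge0 a1 a2 a3 a4 (f1 f2 f3 f4 : X -> R) :
  rintegrable f1 -> rintegrable f2 -> rintegrable f3 -> rintegrable f4 ->
  (forall x, D x -> 0 <= a1 * f1 x + (a2 * f2 x + (a3 * f3 x + a4 * f4 x))) ->
  0 <= a1 * \int[mu]_(x in D) f1 x + (a2 * \int[mu]_(x in D) f2 x +
    (a3 * \int[mu]_(x in D) f3 x + a4 * \int[mu]_(x in D) f4 x)).
Proof.
move=> h1 h2 h3 h4 f0.
have h4' := rintegrableZ a4 h4.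
have h3' := rintegrable_comb a3 h3 h4'; have h2' := rintegrable_comb a2 h2 h3'.
rewrite -(RintegralZl _ mD h4.2) -(Rintegral_comb _ h3 h4') -(Rintegral_comb _ h2 h3').
by rewrite -(Rintegral_comb _ h1 h2'); exact: Rintegral_ge0.
Qed.

Lemma Rintegral_norm_le f : rintegrable f ->
  `|\int[mu]_(x in D) f x| <= \int[mu]_(x in D) `|f x|.
Proof. by move=> [_ ?]; exact: le_normr_Rintegral. Qed.

Lemma Rintegral_dist_le f g : rintegrable f -> rintegrable g ->
  `|\int[mu]_(x in D) f x - \int[mu]_(x in D) g x| <= \int[mu]_(x in D) `|f x - g x|.
Proof.
move=> hf hg; have [_ ?] := hf; have [_ ?] := hg.
by rewrite -RintegralB//; apply: Rintegral_norm_le; exact: rintegrableB.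
Qed.

Lemma Rintegral_EFin f : rintegrable f ->
  (\int[mu]_(x in D) f x)%:E = (\int[mu]_(x in D) (f x)%:E)%E.
Proof. by move=> [_ ?]; rewrite /Rintegral fineK//; exact: integrable_fin_num. Qed.

Lemma Rintegral_dominated_cvg (f : nat -> X -> R) (h g : X -> R) :
  (forall n, measurable_fun setT (f n)) -> measurable_fun setT h -> rintegrable g ->
  {ae mu, forall x, D x -> forall n, `|f n x| <= g x} ->
  {ae mu, forall x, D x -> f n x @[n --> \oo] --> h x} ->
  \int[mu]_(x in D) f n x @[n --> \oo] --> \int[mu]_(x in D) h x.
Proof.
move=> mf mh [mg ig] fg fh.
have [| | | | | jh _ cv] := @dominated_convergence _ _ _ mu D mD
  (fun n => EFin \o f n) (EFin \o h) (EFin \o g).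
- by move=> n; apply/measurable_EFinP; exact: measurable_funTS.
- by apply/measurable_EFinP; exact: measurable_funTS.
- by apply: filterS fh => x xh Dx; apply/fine_cvgP; split; [exact: nearW|exact: xh].
- exact: ig.
- by apply: filterS fg => x fgx n Dx /=; rewrite lee_fin; exact: fgx.
by apply: fine_cvg; rewrite fineK//; exact: integrable_fin_num.
Qed.

Lemma Rintegral_bounded_cvg (f : nat -> X -> R) (h : X -> R) K :
  (forall n, measurable_fun setT (f n)) -> measurable_fun setT h ->
  (forall n x, D x -> `|f n x| <= K) ->
  {ae mu, forall x, D x -> f n x @[n --> \oo] --> h x} ->
  \int[mu]_(x in D) f n x @[n --> \oo] --> \int[mu]_(x in D) h x.
Proof.
move=> mf mh fK; apply: (Rintegral_dominated_cvg (g := cst K)) => //.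
  exact: (bounded_measurable_rintegrable (bounded_measurable_cst K)).
by apply: aeW => x Dx n; exact: fK.
Qed.

Lemma Rintegral_eq0_ae (f : X -> R) : rintegrable f -> (forall x, D x -> 0 <= f x) ->
  \int[mu]_(x in D) f x = 0 -> {ae mu, forall x, D x -> f x = 0}.
Proof.
move=> hf f0 I0; have [mf jf] := hf.
have mfD : measurable_fun D (EFin \o f).
  by apply/measurable_EFinP; exact: measurable_funTS.
have /(ae_eq_integral_abs mu mD mfD) : (\int[mu]_(x in D) `|(EFin \o f) x| = 0)%E.
  rewrite (eq_integral (EFin \o f)); first by rewrite -Rintegral_EFin// I0.
  by move=> x /[!inE] Dx /=; rewrite ger0_norm// f0.
by apply: filterS => x fx Dx; have [] := fx Dx.
Qed.

Lemma Rintegral_ae_eq f g : measurable_fun setT f -> measurable_fun setT g ->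
  {ae mu, forall x, D x -> f x = g x} ->
  \int[mu]_(x in D) f x = \int[mu]_(x in D) g x.
Proof.
move=> mf mg fg; congr fine; apply: ae_eq_integral => //.
- by apply/measurable_EFinP; exact: measurable_funTS.
- by apply/measurable_EFinP; exact: measurable_funTS.
- by apply: filterS fg => x fgx Dx; rewrite fgx.
Qed.

(* Summability of the integrals of the increments gives absolute convergence
   almost everywhere of the telescoping series. *)
Lemma ae_cvg_of_increments (f : nat -> X -> R) (C : R) :
  (forall n, rintegrable (f n)) ->
  (forall n, \sum_(k < n) \int[mu]_(x in D) `|f k.+1 x - f k x| <= C) ->
  exists2 h : X -> R, measurable_fun setT h &
    {ae mu, forall x, D x -> f n x @[n --> \oo] --> h x}.
Proof.
move=> jf sC; pose a k x : R := `|f k.+1 x - f k x|.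
have ja k : rintegrable (a k) by apply: rintegrable_norm; exact: rintegrableB.
have ma k : measurable_fun D (EFin \o a k).
  by apply/measurable_EFinP; apply: measurable_funTS; case: (ja k).
have a0 k x : D x -> (0 <= (EFin \o a k) x)%E by move=> _; rewrite /= lee_fin /a.
pose s : X -> \bar R := fun x => (\sum_(0 <= k <oo) (a k x)%:E)%E.
have ms : measurable_fun D s.
  apply: (@ge0_emeasurable_sum _ _ _ D (fun k => EFin \o a k) xpredT) => //.
  by move=> k x Dx _; exact: a0.
have js : mu.-integrable D s.
  apply/integrableP; split=> //.
  rewrite (eq_integral s); last first.
    move=> x _; rewrite gee0_abs//; apply: nneseries_ge0 => k _ _.
    by rewrite lee_fin /a.
  rewrite integral_nneseries//.
  apply: (@le_lt_trans _ _ C%:E); last exact: ltry.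
  apply: lime_le.
    apply: is_cvg_nneseries => k _ _.
    by apply: integral_ge0 => x Dx; exact: a0 Dx.
  apply: nearW => n; rewrite big_mkord.
  under eq_bigr do rewrite -Rintegral_EFin//.
  by rewrite sumEFin lee_fin; exact: sC.
have sfin := integrable_ae mD js.
(* The upper limit is measurable regardless of convergence, and coincides with the limit wherever
   the series converges. *)
exists (fun x => fine (limn_esup (fun n => (f n x)%:E))).
  apply: measurableT_comp; first exact: fine_measurable.
  by apply: measurable_fun_limn_esup => n; apply/measurable_EFinP; case: (jf n).
apply: filterS sfin => x sx Dx; have {}sx := sx Dx.
have cva : cvgn (series (fun k => a k x)).
  apply: nondecreasing_is_cvgn; first by apply: nondecreasing_series => k _ _; rewrite /a.
  exists (fine (s x)) => _ [n _ <-]; rewrite -lee_fin fineK// /series /= -sumEFin.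
  by apply: nneseries_lim_ge => k _; rewrite lee_fin /a.
have cvf : cvgn (fun n => f n x).
  have /normed_cvg : cvgn [normed series (fun k => f k.+1 x - f k x)] by exact: cva.
  move=> c; suff : cvgn (fun n => series (fun k => f k.+1 x - f k x) n + f 0%N x).
    rewrite (_ : (fun n => _) = (fun n => f n x))//; apply/funext => n.
    by rewrite /series/= telescope_sumr// subrK.
  by apply: is_cvgD => //; exact: is_cvg_cst.
have cvE : (f n x)%:E @[n --> \oo] --> (limn (fun n => f n x))%:E.
  by apply/fine_cvgP; split; [exact: nearW|exact: cvf].
have -> : limn_esup (fun n => (f n x)%:E) = (limn (fun n => f n x))%:E.
  by rewrite is_cvg_limn_esupE; [exact/cvg_lim|apply/cvg_ex; eexists; exact: cvE].
exact: cvf.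
Qed.

End real_integrals.

(** * Step functions along a sequence of sets *)

Lemma natr_indicE {R : realType} T (b : T -> bool) :
  (fun z => (b z)%:R : R) = \1_[set z | b z].
Proof.
apply/funext => z; rewrite indicE; case: (boolP (b z)) => bz.
  by rewrite mem_set.
by rewrite memNset//; exact/negP.
Qed.

Section step_functions.
Context {R : realType} d (Z : measurableType d).
Variables (B : nat -> Z -> bool).
Implicit Types f g : Z -> R.

Definition code (k : nat) (z : Z) : seq bool := [seq B j z | j <- iota 0 k].

Definition meet (J : seq nat) (z : Z) : bool := all (B^~ z) J.

(** Any function of finitely many memberships, rather than a linear combination of indicators:
    closure under pointwise operations is then immediate, and [step_ind] recovers the linear
    form. *)
Definition step f := exists k G, f = G \o code k.

Lemma codeS k z : code k.+1 z = rcons (code k z) (B k z).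
Proof. by rewrite /code -addn1 iotaD map_cat /= add0n cats1. Qed.

Lemma code_take k l z : (k <= l)%N -> code k z = take k (code l z).
Proof.
by move=> kl; rewrite /code -map_take take_iota; congr map; rewrite (minn_idPl kl).
Qed.

Lemma step_cst c : step (fun=> c).
Proof. by exists 0%N, (fun=> c). Qed.

Lemma step_map (h : R -> R) f : step f -> step (fun z => h (f z)).
Proof. by move=> [k [G ->]]; exists k, (h \o G). Qed.

Lemma step_map2 (h : R -> R -> R) f g : step f -> step g ->
  step (fun z => h (f z) (g z)).
Proof.
move=> [k [G ->]] [l [H ->]]; exists (maxn k l).
exists (fun c => h (G (take k c)) (H (take l c))); apply/funext => z /=.
by rewrite -!code_take// ?leq_maxl// leq_maxr.
Qed.

(** Peeling off the last bit: if G0 and G1 are [G] with last bit false and true, then G = G0 + 1_B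
    (G1 - G0), where B is the last set. The induction on the length of the code carries an
    intersection [J], to which B is added. *)
Lemma step_ind (P : (Z -> R) -> Prop) :
  (forall J, P (fun z => (meet J z)%:R)) ->
  (forall a f g, P f -> P g -> P (fun z => a * f z + g z)) ->
  forall f, step f -> P f.
Proof.
move=> PJ Plin f [k [G ->]].
have P0 : P (fun=> 0).
  rewrite (_ : (fun=> 0) = (fun z => (-1) * (meet [::] z)%:R + (meet [::] z)%:R)).
    exact: Plin.
  by apply/funext => z; rewrite mulN1r addNr.
suff H J : P (fun z => (meet J z)%:R * G (code k z)).
  by have := H [::]; congr P; apply/funext => z; rewrite /= mul1r.
elim: k => [|k IH] in J G *.
  have -> : (fun z => (meet J z)%:R * G (code 0 z)) =
      (fun z => G [::] * (meet J z)%:R + 0).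
    by apply/funext => z; rewrite addr0 mulrC.
  exact: Plin.
have := Plin (-1) _ _ (IH (k :: J) (fun c => G (rcons c false)))
  (Plin 1 _ _ (IH J (fun c => G (rcons c false)))
   (IH (k :: J) (fun c => G (rcons c true)))).
congr P; apply/funext => z; rewrite codeS /=.
by case: (B k z) => /=; rewrite ?mul0r ?mulN1r ?addr0 ?oppr0 ?add0r ?mul1r// addKr.
Qed.

Lemma step_meet J : step (fun z => (meet J z)%:R).
Proof.
exists (\max_(j <- J) j.+1)%N.
exists (fun c => (all (fun j => nth false c j) J)%:R); apply/funext => z /=.
congr ((_ : bool)%:R); apply: eq_in_all => j jJ.
have jm : (j < \max_(j <- J) j.+1)%N by apply: (@leq_bigmax_seq _ J xpredT S).
by rewrite (nth_map 0%N) ?nth_iota ?size_iota.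
Qed.

(** On each class of points with equal code, the step function takes the value of [f] at a
    representative chosen in [E]; the default [z0] is used only for codes not realised in [E]. *)
Lemma step_approx (E : set Z) f k (eta : R) :
  (forall z z', E z -> E z' -> code k z = code k z' -> `|f z - f z'| <= eta) ->
  exists2 s, step s & forall z, E z -> `|f z - s z| <= eta.
Proof.
move=> osc; have [[z0 _]|E0] := pselect (exists z, E z); last first.
  by exists (fun=> 0); [exact: step_cst|move=> z Ez; exfalso; apply: E0; exists z].
exists (fun z => f (xget z0 [set z' | E z' /\ code k z' = code k z])).
  by exists k, (fun c => f (xget z0 [set z' | E z' /\ code k z' = c])).
move=> z Ez; case: xgetP => [z' -> [Ez' cz']|/(_ z)/= []//].
exact: osc.
Qed.

Hypothesis mB : forall j, measurable [set z | B j z].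

Lemma measurable_step f : step f -> measurable_fun setT f.
Proof.
apply: step_ind => [J|a g h mg mh]; last first.
  by apply: measurable_funD => //; exact: measurable_funM.
rewrite (_ : (fun z => _) = \1_[set z | meet J z]); last first.
  exact: natr_indicE.
apply: measurable_indic; elim: J => [|j J IH]/=.
  by rewrite (_ : [set _ | _] = setT)//; apply/seteqP; split.
rewrite (_ : [set _ | _] = [set z | B j z] `&` [set z | meet J z]).
  exact: measurableI.
by apply/seteqP; split => z /= /andP.
Qed.

Lemma step_bounded f : step f -> exists K : R, forall z, `|f z| <= K.
Proof.
apply: (step_ind (P := fun f => exists K : R, forall z, `|f z| <= K))
  => [J|a g h [K gK] [L hL]].
  by exists 1 => z; case: (meet J z); rewrite ?normr1 ?normr0.
exists (`|a| * K + L) => z; rewrite (le_trans (ler_normD _ _))// lerD// normrM.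
by rewrite ler_wpM2l.
Qed.

Lemma step_bounded_measurable (E : set Z) f : step f -> bounded_measurable E f.
Proof.
move=> sf; split; first exact: measurable_step.
by have [K fK] := step_bounded sf; exists K => z _; exact: fK.
Qed.

End step_functions.

(** * Weak limits of bounded sequences *)

Section asymptotic_mean.
Context {R : realType} dX (X : measurableType dX) dZ (Z : measurableType dZ).
Variables (nu : {measure set X -> \bar R}) (m : {measure set Z -> \bar R}).
Variables (D : set X) (mD : measurable D) (nuD : (nu D < +oo)%E).
Variables (E : set Z) (mE : measurable E) (mEoo : (m E < +oo)%E).
Variables (S : nat -> X -> Z) (mS : forall n, measurable_fun setT (S n)).
Hypothesis SE : forall n x, D x -> E (S n x).
Variables (B : nat -> Z -> bool) (mB : forall j, measurable [set z | B j z]).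
Hypothesis mean : forall J, \int[nu]_(x in D) (meet B J (S n x))%:R @[n --> \oo] -->
  (\int[m]_(z in E) (meet B J z)%:R : R).
Implicit Types f g : Z -> R.

Lemma bounded_measurable_comp f n : bounded_measurable E f ->
  bounded_measurable D (f \o S n).
Proof.
move=> [mf [K fK]]; split; first exact: measurableT_comp.
by exists K => x Dx; apply/fK/SE.
Qed.

Let step_rint f : step B f -> rintegrable m E f.
Proof.
by move=> sf; apply: bounded_measurable_rintegrable => //; exact: step_bounded_measurable.
Qed.

Lemma step_comp_bounded f n : step B f -> bounded_measurable D (fun x => f (S n x)).
Proof. by move=> sf; apply/(bounded_measurable_comp n)/(step_bounded_measurable mB). Qed.

Lemma step_mean f : step B f ->
  \int[nu]_(x in D) f (S n x) @[n --> \oo] --> \int[m]_(z in E) f z.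
Proof.
pose P f := bounded_measurable E f /\
  \int[nu]_(x in D) f (S n x) @[n --> \oo] --> \int[m]_(z in E) f z.
suff : forall f, step B f -> P f by move=> h /h[].
apply: (step_ind (P := P)) => [J|a g h [bg cg] [bh ch]].
  split=> //; split; last by exists 1 => z _; case: meet; rewrite ?normr1 ?normr0.
  exact/measurable_step/step_meet.
split.
  split; first by apply: measurable_funD; [apply: measurable_funM => //; case: bg|case: bh].
  have [[_ [K gK]] [_ [L hL]]] := (bg, bh); exists (`|a| * K + L) => z Ez.
  rewrite (le_trans (ler_normD _ _))// lerD// ?hL// normrM.
  by rewrite ler_wpM2l// gK.
rewrite Rintegral_comb//; try exact: bounded_measurable_rintegrable.
rewrite [X in X @ _ --> _](_ : _ = (fun n => a * \int[nu]_(x in D) g (S n x) +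
  \int[nu]_(x in D) h (S n x))).
  by apply: cvgD => //; apply: cvgMr.
apply/funext => n; rewrite Rintegral_comb//;
  apply: bounded_measurable_rintegrable => //; exact: bounded_measurable_comp.
Qed.

(** * Representation of the limit functional by a bounded density *)

Section riesz.
Variables (v : nat -> X -> R) (M : R).
Hypothesis mv : forall n, measurable_fun setT (v n).
Hypothesis vM : forall n x, D x -> 0 <= v n x <= M.
Hypothesis cv : forall J, cvgn (fun n => \int[nu]_(x in D) (v n x * (meet B J (S n x))%:R)).

Let F f : R := limn (fun n => \int[nu]_(x in D) (v n x * f (S n x))).
Let I f : R := \int[m]_(z in E) f z.

Let bv n : bounded_measurable D (v n).
Proof.
split=> //; exists M => x Dx; have /andP[v0 v1] := vM n Dx.
by rewrite ger0_norm.
Qed.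

Let rvf n f : step B f -> rintegrable nu D (fun x => v n x * f (S n x)).
Proof.
move=> sf; apply: bounded_measurable_rintegrable => //.
apply: bounded_measurableM => //; exact: step_comp_bounded.
Qed.

Let F_cvg f : step B f ->
  \int[nu]_(x in D) (v n x * f (S n x)) @[n --> \oo] --> F f.
Proof.
pose P f := step B f /\ cvgn (fun n => \int[nu]_(x in D) (v n x * f (S n x))).
suff : forall f, step B f -> P f by move=> h /h[].
apply: (step_ind (P := P)) => [J|a g h [bg cg] [bh ch]].
  by split; [exact: step_meet|exact: cv].
split; first exact: (step_map2 (fun s t => a * s + t)).
rewrite (_ : (fun n => _) = (fun n => a * \int[nu]_(x in D) (v n x * g (S n x)) +
  \int[nu]_(x in D) (v n x * h (S n x)))); last first.
  apply/funext => n; rewrite -Rintegral_comb//; try exact: rvf.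
  by apply: eq_Rintegral => x _; ring.
apply/cvg_ex; eexists; apply: cvgD; last exact: ch.
by apply: cvgMr; exact: cg.
Qed.

Let F_comb a b f g : step B f -> step B g ->
  F (fun z => a * f z + b * g z) = a * F f + b * F g.
Proof.
move=> sf sg; apply: cvg_lim => //.
rewrite [X in X @ _ --> _](_ : _ = (fun n => a * \int[nu]_(x in D) (v n x * f (S n x)) +
  b * \int[nu]_(x in D) (v n x * g (S n x)))); last first.
  apply/funext => n; rewrite -Rintegral_comb2//; try exact: rvf.
  by apply: eq_Rintegral => x _; ring.
by apply: cvgD; apply: cvgMr; exact: F_cvg.
Qed.

(** Pointwise v f <= M f^+, because 0 <= v <= M. This inequality contains both the boundedness of
    [F] and its positivity (apply it to - f with f >= 0). *)
Let F_le f : step B f -> F f <= M * I (fun z => Num.max (f z) 0).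
Proof.
move=> sf; have sp : step B (fun z => Num.max (f z) 0) by exact: (step_map (Num.max^~ 0)).
have c : M * \int[nu]_(x in D) Num.max (f (S n x)) 0 @[n --> \oo] -->
    M * I (fun z => Num.max (f z) 0).
  by apply: cvgMr; exact: step_mean.
apply: (ler_cvg_to (F_cvg sf) c); apply: nearW => n.
have bp : rintegrable nu D (fun x => Num.max (f (S n x)) 0).
  apply: bounded_measurable_rintegrable => //.
  exact: (step_comp_bounded n sp).
rewrite -RintegralZl//; last by case: bp.
apply: Rintegral_le => //; first exact: rvf.
  exact: rintegrableZ.
move=> x Dx; have /andP[v0 v1] := vM n Dx.
have [f0|f0] := leP 0 (f (S n x)); first by rewrite ler_wpM2r.
by rewrite mulr0 nmulr_lle0.
Qed.

(** The quadratic functional whose Euler equation at r is int r f = F f: its minimiser is the L^2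
    representative of [F]. *)
Let Jf f := 2^-1 * I (fun z => f z ^+ 2) - F f.

Let step_sq f : step B f -> step B (fun z => f z ^+ 2).
Proof. exact: (step_map (fun t => t ^+ 2)). Qed.

Let r1 : rintegrable m E (fun=> 1 : R).
Proof. by apply: bounded_measurable_rintegrable => //; exact: bounded_measurable_cst. Qed.

Let I1 := I (fun=> 1 : R).

Let I1_ge0 : 0 <= I1.
Proof. exact: Rintegral_ge0. Qed.

Let Jf_ge f : step B f -> - (2^-1 * M ^+ 2 * I1) <= Jf f.
Proof.
move=> sf; have Ff := F_le sf.
have sp : step B (fun z => Num.max (f z) 0) by exact: (step_map (Num.max^~ 0)).
have := Rintegral_comb4_ge0 mE (a1 := 2^-1) (a2 := - M) (a3 := 2^-1 * M ^+ 2) (a4 := 0)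
  (step_rint (step_sq sf)) (step_rint sp) r1 r1.
move=> H.
suff : 0 <= 2^-1 * I (fun z => f z ^+ 2) + (- M * I (fun z => Num.max (f z) 0) +
   (2^-1 * M ^+ 2 * I1 + 0 * I1)) by rewrite /Jf; lra.
(* For t >= 0 the integrand is (t - M)^2 / 2; for t < 0 it is (t^2 + M^2) / 2. *)
apply: H => z Ez /=; have [f0|f0] := leP 0 (f z); last by nra.
by have := sqr_ge0 (f z - M); nra.
Qed.

Let clamp f z := Num.max 0 (Num.min (f z) M).

Let step_clamp f : step B f -> step B (clamp f).
Proof. exact: (step_map (fun t => Num.max 0 (Num.min t M))). Qed.

Hypothesis M0 : 0 <= M.

(** By [F_le], F f - F (clamp f) <= M int (f - clamp f)^+; where f > M the remaining integrand is (f
    - M)^2 / 2. Minimising sequences may thus be taken with values in [0, M], which later allows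
    bounded convergence. *)
Let Jf_clamp f : step B f -> Jf (clamp f) <= Jf f.
Proof.
move=> sf; have sc := step_clamp sf.
have sd : step B (fun z => 1 * f z + -1 * clamp f z).
  exact: (step_map2 (fun s t => 1 * s + -1 * t)).
have := F_le sd; rewrite F_comb//.
have sp := step_map (Num.max^~ 0) sd.
move=> Fd.
have H := Rintegral_comb4_ge0 mE (a1 := 2^-1) (a2 := - 2^-1) (a3 := - M) (a4 := 0)
  (step_rint (step_sq sf)) (step_rint (step_sq sc)) (step_rint sp) r1.
suff : 0 <= 2^-1 * I (fun z => f z ^+ 2) + (- 2^-1 * I (fun z => clamp f z ^+ 2) +
   (- M * I (fun z => Num.max (1 * f z + -1 * clamp f z) 0) + 0 * I1)) by rewrite /Jf; lra.
apply: H => z Ez; rewrite /clamp mul1r mulN1r.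
have [fM|fM] := leP (f z) M.
  have [f0|f0] := leP 0 (f z); first by rewrite subrr maxxx; lra.
  rewrite subr0 (max_idPr (ltW f0)); nra.
rewrite (max_idPr M0) (max_idPl _); last by lra.
by have := sqr_ge0 (f z - M); nra.
Qed.

Let j := inf [set Jf f | f in step B].

Let j_le f : step B f -> j <= Jf f.
Proof.
move=> sf; apply: ge_inf; last by exists f.
by exists (- (2^-1 * M ^+ 2 * I1)) => _ [g sg <-]; exact: Jf_ge.
Qed.

(** The tolerance (1/4)^k makes the L^1 distances of consecutive terms of order (1/2)^k, hence
    summable. *)
Let minimizing k : {r : Z -> R | [/\ step B r, forall z, 0 <= r z <= M &
  Jf r <= j + (4^-1) ^+ k]}.
Proof.
apply: cid.
have [] := @inf_adherent R [set Jf f | f in step B] ((4^-1) ^+ k).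
- by rewrite exprn_gt0// invr_gt0.
- split; first by exists (Jf (fun=> 0)), (fun=> 0) => //; exact: step_cst.
  by exists (- (2^-1 * M ^+ 2 * I1)) => _ [g sg <-]; exact: Jf_ge.
move=> _ [f sf <-] fj; exists (clamp f); split; first exact: step_clamp.
  by move=> z; rewrite /clamp le_max lexx/= ge_max M0 ge_min lexx orbT.
exact: (le_trans (Jf_clamp sf) (ltW fj)).
Qed.

Let r k := sval (minimizing k).

Let sr k : step B (r k). Proof. by rewrite /r; case: minimizing => ? []. Qed.

Let rM k z : 0 <= r k z <= M. Proof. by rewrite /r; case: minimizing => ? []. Qed.

Let Jr k : Jf (r k) <= j + (4^-1) ^+ k. Proof. by rewrite /r; case: minimizing => ? []. Qed.

(* Parallelogram identity: the midpoint of two near-minimisers cannot beat the infimum. *)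
Let parallelogram k : I (fun z => (r k.+1 z - r k z) ^+ 2) <= 8 * (4^-1) ^+ k.
Proof.
have sm : step B (fun z => 2^-1 * r k.+1 z + 2^-1 * r k z).
  exact: (step_map2 (fun s t => 2^-1 * s + 2^-1 * t)).
have sd : step B (fun z => (r k.+1 z - r k z) ^+ 2).
  exact: (step_map2 (fun s t => (s - t) ^+ 2)).
have := j_le sm; rewrite {1}/Jf F_comb// => jm.
have H := Rintegral_comb4_ge0 mE (a1 := 2^-1) (a2 := 2^-1) (a3 := -1) (a4 := - 4^-1)
  (step_rint (step_sq (sr k.+1))) (step_rint (step_sq (sr k))) (step_rint (step_sq sm)) (step_rint sd).
have {}H : 0 <= 2^-1 * I (fun z => r k.+1 z ^+ 2) + (2^-1 * I (fun z => r k z ^+ 2) +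
   (-1 * I (fun z => (2^-1 * r k.+1 z + 2^-1 * r k z) ^+ 2) +
    - 4^-1 * I (fun z => (r k.+1 z - r k z) ^+ 2))).
  by apply: H => z Ez; lra.
have := Jr k.+1; have := Jr k; rewrite /Jf exprS.
have : 0 <= (4^-1 : R) ^+ k by rewrite exprn_ge0// invr_ge0.
move: H jm; lra.
Qed.

(** The inequality t <= 2^k t^2 + 2^-k, integrated, turns the quadratic bound 8 (1/4)^k of
    [parallelogram] into the L^1 bound (1/2)^k (I1 + 8). *)
Let increments n :
  \sum_(k < n) \int[m]_(z in E) `|r k.+1 z - r k z| <= 2 * (I1 + 8).
Proof.
have H k : \int[m]_(z in E) `|r k.+1 z - r k z| <= (2^-1) ^+ k * (I1 + 8).
  have sa : step B (fun z => `|r k.+1 z - r k z|).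
    exact: (step_map2 (fun s t => `|s - t|)).
  have sd : step B (fun z => (r k.+1 z - r k z) ^+ 2).
    exact: (step_map2 (fun s t => (s - t) ^+ 2)).
  have H := Rintegral_comb4_ge0 mE (a1 := 2 ^+ k) (a2 := (2^-1) ^+ k) (a3 := -1) (a4 := 0)
    (step_rint sd) r1 (step_rint sa) r1.
  have {}H : 0 <= 2 ^+ k * I (fun z => (r k.+1 z - r k z) ^+ 2) + ((2^-1) ^+ k * I1 +
     (-1 * I (fun z => `|r k.+1 z - r k z|) + 0 * I1)).
    apply: H => z Ez; rewrite -[(_ - _) ^+ 2]real_normK ?num_real//.
    move: `|_| => t; have -> : (2^-1 : R) ^+ k = (2 ^+ k)^-1 by rewrite exprVn.
    have : 0 < (2 : R) ^+ k by rewrite exprn_gt0.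
    move: (2 ^+ k) => a a0.
    rewrite (_ : _ + _ = a * (t - 2^-1 * a^-1) ^+ 2 + 3 / 4 * a^-1); last first.
      by field; rewrite gt_eqF.
    by rewrite addr_ge0// mulr_ge0 ?sqr_ge0 ?invr_ge0// ltW.
  have := parallelogram k.
  have e4 : (4^-1 : R) ^+ k = (2^-1) ^+ k * (2^-1) ^+ k.
    by rewrite -exprMn; congr (_ ^+ k); rewrite -invfM; congr (_^-1); lra.
  have e1 : (2 : R) ^+ k * (2^-1) ^+ k = 1 by rewrite -exprMn divff// expr1n.
  have p0 : 0 < (2 : R) ^+ k by rewrite exprn_gt0.
  rewrite e4 => /(ler_wpM2l (ltW p0)).
  have -> : 2 ^+ k * (8 * (2^-1 ^+ k * 2^-1 ^+ k)) = 8 * (2 ^+ k * 2^-1 ^+ k) * 2^-1 ^+ k :> R by ring.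
  rewrite e1; move: H; rewrite /I; lra.
apply: (le_trans (ler_sum _ (fun k _ => H (nat_of_ord k)))).
rewrite -big_distrl/= ler_wpM2r//; first by rewrite addr_ge0.
elim: n => [|n IH]; first by rewrite big_ord0.
suff : \sum_(i < n.+1) (2^-1 : R) ^+ i = 2 - 2 * (2^-1) ^+ n.+1.
  by move=> ->; rewrite gerBl// mulr_ge0// exprn_ge0// invr_ge0.
elim: {IH} n => [|n IH]; first by rewrite big_ord_recl big_ord0 expr0 expr1; lra.
by rewrite big_ord_recr/= IH !exprS; lra.
Qed.

(** [w] is the a.e. limit of the minimising sequence r_k. Comparing [Jf] at r_k + t f with the
    infimum and letting k grow yields t (int w f - F f) + t^2 / 2 int f^2 >= 0 for every t, so the
    linear coefficient vanishes. The sequence [s] belongs to the conclusion because later proofs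
    build their test functions from it. *)
Lemma riesz_bounded : exists (w : Z -> R) (s : nat -> Z -> R),
  [/\ measurable_fun setT w, forall z, 0 <= w z <= M,
      forall k, step B (s k) /\ forall z, 0 <= s k z <= M,
      {ae m, forall z, E z -> s k z @[k --> \oo] --> w z} &
      forall f, step B f -> \int[nu]_(x in D) (v n x * f (S n x)) @[n --> \oo] -->
        \int[m]_(z in E) (w z * f z)].
Proof.
have [w0 mw0 cw0] := ae_cvg_of_increments mE (fun k => step_rint (sr k)) increments.
(* Clamping gives the bounds at every point, and keeps the a.e. convergence since the r_k already
   lie in [0, M]. *)
pose w := clamp w0; exists w, r.
have mw : measurable_fun setT w.
  apply: measurable_maxr => //; exact: measurable_minr.
have cw : {ae m, forall z, E z -> r k z @[k --> \oo] --> w z}.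
  apply: filterS cw0 => z rz Ez; have {}rz := rz Ez.
  have -> : (fun k => r k z) = (fun k => Num.max 0 (Num.min (r k z) M)).
    apply/funext => k; have /andP[r0 rM'] := rM k z.
    by rewrite (min_idPl rM') (max_idPr r0).
  apply: (@continuous_cvg _ _ _ _ _ _ (fun t : R => Num.max 0 (Num.min t M)) _ _ rz).
  apply: (@continuous_max _ _ (fun=> 0) (fun t : R => Num.min t M)).
    exact: cst_continuous.
  by apply: (@continuous_min _ _ id (fun=> M)); [exact: cvg_id|exact: cst_continuous].
have wM z : 0 <= w z <= M by rewrite /w/clamp le_max lexx/= ge_max M0 ge_min lexx orbT.
split => // f sf.
suff <- : F f = \int[m]_(z in E) (w z * f z) by exact: F_cvg.
have bf := step_bounded_measurable mB E sf.
have cI : I (fun z => r k z * f z) @[k --> \oo] --> I (fun z => w z * f z).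
  have [_ [K fK]] := bf.
  apply: (@Rintegral_bounded_cvg _ _ _ _ _ mE mEoo _ _ (M * K)).
  - move=> k; apply: measurable_funM; first exact: measurable_step (sr k).
    by case: bf.
  - by apply: measurable_funM => //; case: bf.
  - move=> k z Ez; rewrite normrM ler_pM//; last exact: fK.
    by have /andP[r0 ?] := rM k z; rewrite ger0_norm.
  - by apply: filterS cw => z rz Ez; apply: cvgMl; exact: rz.
have key t : 0 <= t * (I (fun z => w z * f z) - F f) + 2^-1 * t ^+ 2 * I (fun z => f z ^+ 2).
  have c4 : (4^-1 : R) ^+ k @[k --> \oo] --> (0 : R).
    by apply: cvg_expr; rewrite ger0_norm ?invr_ge0// invf_lt1 ?ltr1n.
  have cl : t * (I (fun z => r k z * f z) - F f) + 2^-1 * t ^+ 2 * I (fun z => f z ^+ 2) +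
     (4^-1) ^+ k @[k --> \oo] -->
     t * (I (fun z => w z * f z) - F f) + 2^-1 * t ^+ 2 * I (fun z => f z ^+ 2) + 0.
    apply: cvgD => //; apply: cvgD; last exact: cvg_cst.
    by apply: cvgMr; apply: cvgB => //; exact: cvg_cst.
  rewrite addr0 in cl; apply: (ler_cvg_to (cvg_cst 0) cl); apply: nearW => k.
  have sm : step B (fun z => 1 * r k z + t * f z).
    exact: (step_map2 (fun p q => 1 * p + t * q)).
  have sp : step B (fun z => r k z * f z) by exact: (step_map2 *%R).
  have := j_le sm; rewrite {1}/Jf F_comb// => jm.
  have H := Rintegral_comb4_ge0 mE (a1 := 1) (a2 := 2 * t) (a3 := t ^+ 2) (a4 := -1)
    (step_rint (step_sq (sr k))) (step_rint sp) (step_rint (step_sq sf)) (step_rint (step_sq sm)).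
  have {}H : 0 <= 1 * I (fun z => r k z ^+ 2) + (2 * t * I (fun z => r k z * f z) +
     (t ^+ 2 * I (fun z => f z ^+ 2) + -1 * I (fun z => (1 * r k z + t * f z) ^+ 2))).
    by apply: H => z Ez; lra.
  by have := Jr k; rewrite /Jf; move: H jm; lra.
have b0 : 0 <= I (fun z => f z ^+ 2) by apply: Rintegral_ge0 => z _; exact: sqr_ge0.
move: (I (fun z => f z ^+ 2)) b0 key => b b0 key.
apply/esym/eqP; rewrite -subr_eq0 -sqrf_eq0 eq_le sqr_ge0 andbT.
(* With A the discrepancy and b = int f^2, the choice t = - A / (b + 1) makes the quadratic
   expression a negative multiple of A^2; the 1 guards against b = 0. *)
rewrite -/(I _); move: (I _ - F f) key => A /(_ (- A / (b + 1))).
have b1 : 0 < b + 1 by lra.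
rewrite (_ : _ + _ = - (A ^+ 2) * (2^-1 * (b + 2) / (b + 1) ^+ 2)); last by field; lra.
rewrite mulNr oppr_ge0 pmulr_lle0// divr_gt0 ?exprn_gt0//; lra.
Qed.

End riesz.

End asymptotic_mean.

(** * Young functions *)

Section young_theory.
Context {R : realType} (Phi : R -> R).
Hypothesis young : young_function Phi.

Lemma young_cvg T (F : set_system T) {FF : ProperFilter F} (r : T -> R) (w : R) :
  (\forall k \near F, 0 <= r k) -> 0 <= w -> r k @[k --> F] --> w ->
  Phi (r k) @[k --> F] --> Phi w.
Proof.
move=> r0 w0 rw.
have /subspace_continuousP /(_ w) := young_continuous young.
have w0' : [set` `[0, +oo[] w by rewrite /= in_itv/= w0.
move=> /(_ w0') cw P /cw /= wP.
have := rw _ wP; apply: filterS2 r0 => k rk; apply.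
by rewrite /= in_itv/= rk.
Qed.

(** Phi t = (Phi t / t) t, and both factors tend to 0 at 0+. *)
Lemma young0 : Phi 0 = 0.
Proof.
have c1 : Phi t @[t --> 0^'+] --> Phi 0.
  apply: (@young_cvg _ _ _ id) => //.
    near=> t; apply: ltW; near: t; exact: nbhs_right_gt.
  exact: cvg_within.
have c2 : Phi t @[t --> (0 : R)^'+] --> (0 : R) * 0.
  have : (Phi t / t) * t @[t --> (0 : R)^'+] --> (0 : R) * 0.
    by apply: cvgM; [exact: young_cvg0|exact: cvg_within].
  apply: cvg_trans; apply: near_eq_cvg; near=> t.
  by rewrite divfK// gt_eqF//; near: t; exact: nbhs_right_gt.
by rewrite mulr0 in c2; exact: (cvg_unique (@Rhausdorff R) c1 c2).
Unshelve. all: by end_near. Qed.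

Lemma young_conv a s t : 0 <= a -> a <= 1 -> 0 <= s -> 0 <= t ->
  Phi (a * s + (1 - a) * t) <= a * Phi s + (1 - a) * Phi t.
Proof.
move=> a0 a1 s0 t0.
by apply: (young_convex young (Itv01 a0 a1)); rewrite inE /= in_itv/= ?s0 ?t0.
Qed.

Lemma young_scale a t : 0 <= a -> a <= 1 -> 0 <= t -> Phi (a * t) <= a * Phi t.
Proof.
move=> a0 a1 t0; have := young_conv a0 a1 t0 (lexx 0).
by rewrite young0 !mulr0 !addr0.
Qed.

Lemma young_le s t : 0 <= s -> s <= t -> Phi s <= Phi t.
Proof.
move=> s0; rewrite le_eqVlt => /predU1P[->//|st].
have t0 : 0 < t by exact: le_lt_trans st.
have a0 : 0 <= s / t by rewrite divr_ge0// ltW.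
have a1 : s / t <= 1 by rewrite ler_pdivrMr// mul1r ltW.
have := young_scale a0 a1 (ltW t0); rewrite divfK ?gt_eqF// => /le_trans; apply.
by rewrite ler_piMl// (young_ge0 young)// ltW.
Qed.

Lemma young_superlinear eta : 0 < eta -> exists2 M, 0 < M &
  forall t, M <= t -> t <= eta * Phi t.
Proof.
move=> eta0; have /cvgryPge /(_ eta^-1) [M [Mr MP]] := young_cvgy young.
exists (Num.max 1 (M + 1)); first by rewrite lt_max ltr01.
move=> t; rewrite ge_max => /andP[t1 tM].
have t0 : 0 < t by lra.
have /MP : M < t by lra.
by rewrite ler_pdivlMr// ler_pdivrMl// mulrC.
Qed.

Lemma young_bound eta : 0 < eta -> exists2 M, 0 < M &
  forall t, 0 <= t -> t <= M + eta * Phi t.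
Proof.
move=> eta0; have [M M0 MP] := young_superlinear eta0; exists M => // t t0.
have P0 : 0 <= eta * Phi t by rewrite mulr_ge0 ?(young_ge0 young)// ltW.
have [/MP|] := leP M t; lra.
Qed.

Lemma young_slopes s t u : 0 <= s -> s < t -> t < u ->
  (Phi t - Phi s) / (t - s) <= (Phi u - Phi t) / (u - t).
Proof.
move=> s0 st tu; pose a := (u - t) / (u - s).
have us : 0 < u - s by lra.
have a0 : 0 <= a by rewrite divr_ge0; lra.
have a1 : a <= 1 by rewrite ler_pdivrMr//; lra.
have u0 : 0 <= u by lra.
have := young_conv a0 a1 s0 u0.
have e1 : 1 - a = (t - s) / (u - s) by rewrite /a; field; lra.
have -> : a * s + (1 - a) * u = t by rewrite e1 /a; field; lra.
rewrite e1 /a => H.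
rewrite ler_pdivrMr; last by lra.
rewrite mulrAC ler_pdivlMr; last by lra.
have {}H := ler_wpM2r (ltW us) H.
have e2 : ((u - t) / (u - s) * Phi s + (t - s) / (u - s) * Phi u) * (u - s) =
   (u - t) * Phi s + (t - s) * Phi u by field; lra.
by rewrite e2 in H; lra.
Qed.

(** The right derivative of [Phi]: by convexity the slopes decrease as s decreases to t, so their
    infimum is their limit. *)
Definition subgradient (t : R) : R :=
  inf [set (Phi s - Phi t) / (s - t) | s in [set s | t < s]].

Let slopes_inf t : 0 <= t ->
  has_inf [set (Phi s - Phi t) / (s - t) | s in [set s | t < s]].
Proof.
move=> t0; split; first by exists ((Phi (t + 1) - Phi t) / (t + 1 - t)), (t + 1) => //=; lra.
exists 0 => _ [s /= ts <-]; rewrite divr_ge0//; last by lra.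
by rewrite subr_ge0 young_le// ltW.
Qed.

Lemma subgradient_ge0 t : 0 <= t -> 0 <= subgradient t.
Proof.
move=> t0; apply: lb_le_inf; first by case: (slopes_inf t0).
move=> _ [s /= ts <-]; rewrite divr_ge0//; last by lra.
by rewrite subr_ge0 young_le// ltW.
Qed.

(** The slope between t and t + 1 is one of those in the infimum. The bound makes the subgradient
    bounded on bounded intervals. *)
Lemma subgradient_le t : 0 <= t -> subgradient t <= Phi (t + 1).
Proof.
move=> t0; apply: (@le_trans _ _ ((Phi (t + 1) - Phi t) / (t + 1 - t))).
  by apply: ge_inf; [case: (slopes_inf t0)|exists (t + 1) => //=; lra].
have -> : t + 1 - t = 1 by ring.
by rewrite divr1 gerBl (young_ge0 young).
Qed.

Lemma subgradientP t s : 0 <= t -> 0 <= s ->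
  Phi t + subgradient t * (s - t) <= Phi s.
Proof.
move=> t0 s0; have [ts|st|->] := ltgtP t s; last by rewrite subrr mulr0 addr0.
  have : subgradient t <= (Phi s - Phi t) / (s - t).
    by apply: ge_inf; [case: (slopes_inf t0)|exists s].
  by rewrite ler_pdivlMr; lra.
have : (Phi t - Phi s) / (t - s) <= subgradient t.
  apply: lb_le_inf; first by case: (slopes_inf t0).
  by move=> _ [u /= tu <-]; exact: young_slopes.
by rewrite ler_pdivrMr; lra.
Qed.

(** Composing [Phi] with t |-> max 0 t gives a nondecreasing, hence measurable, function on the
    whole line, whatever the values of [Phi] at negative points. *)
Lemma measurable_young d (X : measurableType d) (u : X -> R) D :
  measurable_fun D u -> (forall x, 0 <= u x) -> measurable_fun D (fun x => Phi (u x)).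
Proof.
move=> mu u0.
rewrite (_ : (fun x => _) = (fun t => Phi (Num.max 0 t)) \o u); last first.
  by apply/funext => x /=; rewrite (max_idPr (u0 x)).
apply: measurableT_comp => //; apply: nondecreasing_measurable => // s t st.
by apply: young_le; [rewrite le_max lexx|rewrite ge_max !le_max lexx st orbT].
Qed.

End young_theory.

(** * Weak limits under a modular bound *)

(** A three-epsilon argument, applied below to remove the truncation and then to pass from step
    functions to approximable ones. *)
Lemma cvg_uniform_approx {R : realType} (a : nat -> R) (b : R) :
  (forall eta, 0 < eta -> exists a' b', [/\ a' n @[n --> \oo] --> b',
     forall n : nat, `|a n - a' n| <= eta & `|b' - b| <= eta :> R]) ->
  a n @[n --> \oo] --> b.
Proof.
move=> H; apply/cvgrPdist_le => e e0.
have [|a' [b' [ab' aa' bb']]] := H (e / 3); first by rewrite divr_gt0.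
have /cvgrPdist_le /(_ (e / 3)) := ab'; rewrite divr_gt0// => /(_ isT).
apply: filterS => n bn; have := aa' n.
move: bb' bn; rewrite !ler_norml; lra.
Qed.

Section bounded_limits.
Context {R : realType} d (Z : measurableType d) (m : {measure set Z -> \bar R}).
Variables (E : set Z) (mE : measurable E) (mEoo : (m E < +oo)%E).
Variables (B : nat -> Z -> bool) (mB : forall j, measurable [set z | B j z]).

(** The natural test function (w - w')^+ is only a limit of step functions, namely of (s_k -
    s'_k)^+. Bounded convergence extends the hypothesis to it, and int (w - w') (w - w')^+ is the
    integral of ((w - w')^+)^2, which must therefore vanish. *)
Lemma ae_le_of_step (w w' : Z -> R) (s s' : nat -> Z -> R) (K : R) :
  measurable_fun setT w -> measurable_fun setT w' ->
  (forall z, 0 <= w z <= K) -> (forall z, 0 <= w' z <= K) ->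
  (forall k, step B (s k) /\ forall z, 0 <= s k z <= K) ->
  (forall k, step B (s' k) /\ forall z, 0 <= s' k z <= K) ->
  {ae m, forall z, E z -> s k z @[k --> \oo] --> w z} ->
  {ae m, forall z, E z -> s' k z @[k --> \oo] --> w' z} ->
  (forall f, step B f -> (forall z, 0 <= f z) ->
    \int[m]_(z in E) (w z * f z) <= \int[m]_(z in E) (w' z * f z)) ->
  {ae m, forall z, E z -> w z <= w' z}.
Proof.
move=> mw mw' wK w'K sK s'K sw s'w' ww'.
have rK (g : Z -> R) : measurable_fun setT g -> (exists L : R, forall z, `|g z| <= L) -> rintegrable m E g.
  move=> mg [L gL]; apply: bounded_measurable_rintegrable => //.
  by split => //; exists L => z _; exact: gL.
pose h k z := Num.max (s k z - s' k z) 0; pose g z := Num.max (w z - w' z) 0.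
have sh k : step B (h k).
  by apply: (step_map2 (fun a b => Num.max (a - b) 0)); [exact: (sK k).1|exact: (s'K k).1].
have mh k : measurable_fun setT (h k) by exact: measurable_step (sh k).
have mg : measurable_fun setT g.
  by apply: measurable_maxr => //; exact: measurable_funB.
have hK k z : `|h k z| <= K.
  have [/andP[a b] /andP[c e]] := ((sK k).2 z, (s'K k).2 z).
  rewrite ger0_norm /h; first by rewrite ge_max; lra.
  by rewrite le_max lexx orbT.
have gK z : `|g z| <= K.
  have [/andP[a b] /andP[c e]] := (wK z, w'K z).
  rewrite ger0_norm /g; first by rewrite ge_max; lra.
  by rewrite le_max lexx orbT.
have hg : {ae m, forall z, E z -> h k z @[k --> \oo] --> g z}.
  apply: filterS2 sw s'w' => z sz s'z Ez.
  apply: (@continuous_cvg _ _ _ _ _ _ (fun t : R => Num.max t 0) _ _ (cvgB (sz Ez) (s'z Ez))).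
  by apply: (@continuous_max _ _ id (fun=> 0)); [exact: cvg_id|exact: cst_continuous].
have lim (u : Z -> R) : measurable_fun setT u -> (forall z, 0 <= u z <= K) ->
    \int[m]_(z in E) (u z * h k z) @[k --> \oo] --> \int[m]_(z in E) (u z * g z).
  move=> mu uK; apply: (@Rintegral_bounded_cvg _ _ _ _ _ mE mEoo _ _ (K * K)).
  - by move=> k; exact: measurable_funM.
  - exact: measurable_funM.
  - move=> k z Ez; rewrite normrM ler_pM//.
    by have /andP[r0 ?] := uK z; rewrite ger0_norm.
  - by apply: filterS hg => z rz Ez; apply: cvgMr; exact: rz.
have le : \int[m]_(z in E) (w z * g z) <= \int[m]_(z in E) (w' z * g z).
  apply: (ler_cvg_to (lim _ mw wK) (lim _ mw' w'K)); apply: nearW => k.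
  by apply: ww' => // z; rewrite /h le_max lexx orbT.
have ruK (u : Z -> R) : measurable_fun setT u -> (forall z, 0 <= u z <= K) ->
    rintegrable m E (fun z => u z * g z).
  move=> mu uK; apply: rK; first exact: measurable_funM.
  exists (K * K) => z; rewrite normrM ler_pM//.
  by have /andP[r0 ?] := uK z; rewrite ger0_norm.
have g2 z : g z ^+ 2 = w z * g z - w' z * g z.
  by rewrite /g; case: (leP (w z - w' z) 0) => ?; ring.
have I0 : \int[m]_(z in E) (g z ^+ 2) = 0.
  apply/eqP; rewrite eq_le; apply/andP; split; last first.
    by apply: Rintegral_ge0 => z _; exact: sqr_ge0.
  under eq_Rintegral do rewrite g2.
  have [_ ?] := ruK _ mw wK; have [_ ?] := ruK _ mw' w'K.
  by rewrite RintegralB// subr_le0.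
have rg2 : rintegrable m E (fun z => g z ^+ 2).
  by under eq_fun do rewrite g2; apply: rintegrableB => //; exact: ruK.
apply: filterS (Rintegral_eq0_ae mE rg2 (fun z _ => sqr_ge0 _) I0) => z g0 Ez.
have /eqP := g0 Ez; rewrite sqrf_eq0 /g => /eqP gz.
by rewrite -subr_le0 -gz le_max lexx.
Qed.

End bounded_limits.

(** * Uniform integrability from a modular bound *)

Section young_modular.
Context {R : realType} (Phi : R -> R) (young : young_function Phi).
Context d (Y : measurableType d) (mu : {measure set Y -> \bar R}) (G : set Y).
Hypotheses (mG : measurable G) (muG : (mu G < +oo)%E).
Section one_function.
Variable u : Y -> R.
Hypotheses (mu_u : measurable_fun setT u) (u0 : forall x, 0 <= u x).
Hypothesis u1 : (\int[mu]_(x in G) (Phi (u x))%:E <= 1)%E.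

Lemma rintegrable_modular : rintegrable mu G (fun x => Phi (u x)).
Proof.
have mP : measurable_fun setT (fun x => Phi (u x)) by exact: measurable_young.
split=> //; apply/integrableP; split; first by apply/measurable_EFinP; exact: measurable_funTS.
rewrite (eq_integral (fun x => (Phi (u x))%:E)); first exact: (le_lt_trans u1 (ltry _)).
by move=> x _ /=; rewrite ger0_norm// (young_ge0 young).
Qed.

Lemma Rintegral_modular_le1 : \int[mu]_(x in G) Phi (u x) <= 1.
Proof. by rewrite -lee_fin Rintegral_EFin//; exact: rintegrable_modular. Qed.

Lemma rintegrable_of_modular : rintegrable mu G u.
Proof.
have [M M0 MP] := young_bound young ltr01.
apply: (@rintegrable_le _ _ _ _ _ mG _ (fun x => 1 * Phi (u x) + M)) => //.
  apply: rintegrable_comb => //; first exact: rintegrable_modular.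
  by apply: bounded_measurable_rintegrable => //; exact: bounded_measurable_cst.
by move=> x _; rewrite ger0_norm// addrC MP.
Qed.

End one_function.

(* Uniform integrability of the modular ball. *)
Lemma modular_small (K : R) : 0 < K -> forall eta, 0 < eta -> exists2 delta, 0 < delta &
  forall u h : Y -> R, measurable_fun setT u -> (forall x, 0 <= u x) ->
  (\int[mu]_(x in G) (Phi (u x))%:E <= 1)%E ->
  bounded_measurable G h -> (forall x, G x -> `|h x| <= K) ->
  \int[mu]_(x in G) `|h x| <= delta -> \int[mu]_(x in G) `|u x * h x| <= eta.
Proof.
move=> K0 eta eta0; have e2 : 0 < eta / (2 * K) by rewrite divr_gt0// mulr_gt0.
have [M M0 MP] := young_bound young e2.
(* From u <= M + eta / (2 K) Phi u: the first term contributes at most M delta = eta / 2, and so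
   does the second, because |h| <= K and the modular is at most 1. *)
exists (eta / (2 * M)); first by rewrite divr_gt0// mulr_gt0.
move=> u h mu_u u0 u1 bh hK hd; have rh := bounded_measurable_rintegrable mG muG bh.
have rn := rintegrable_norm rh; have rP := rintegrable_modular mu_u u0 u1.
have ruh := rintegrable_norm (rintegrableM mG muG (rintegrable_of_modular mu_u u0 u1) bh).
apply: (@le_trans _ _ (M * \int[mu]_(x in G) `|h x| + eta / 2 * \int[mu]_(x in G) Phi (u x))).
  rewrite -Rintegral_comb2//; apply: Rintegral_le => //.
    by apply: rintegrable_comb => //; exact: rintegrableZ.
  move=> x Gx; rewrite normrM (ger0_norm (u0 x)).
  apply: (le_trans (ler_wpM2r (normr_ge0 _) (MP _ (u0 x)))).
  rewrite mulrDl lerD2l; have P0 : 0 <= Phi (u x) by exact: young_ge0.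
  rewrite mulrAC ler_wpM2r//.
  rewrite (_ : eta / 2 = eta / (2 * K) * K); last by field; rewrite gt_eqF.
  by rewrite ler_wpM2l ?hK// ltW.
have := Rintegral_modular_le1 mu_u u0 u1; have e20 : 0 < eta / 2 by rewrite divr_gt0.
move=> /(ler_wpM2l (ltW e20)); move: hd => /(ler_wpM2l (ltW M0)).
rewrite (_ : M * (eta / (2 * M)) = eta / 2); last by field; rewrite gt_eqF.
lra.
Qed.

End young_modular.

Section orlicz_limits.
Context {R : realType} dX (X : measurableType dX) dZ (Z : measurableType dZ).
Variables (nu : {measure set X -> \bar R}) (m : {measure set Z -> \bar R}).
Variables (D : set X) (mD : measurable D) (nuD : (nu D < +oo)%E).
Variables (E : set Z) (mE : measurable E) (mEoo : (m E < +oo)%E).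
Variables (S : nat -> X -> Z) (mS : forall n, measurable_fun setT (S n)).
Hypothesis SE : forall n x, D x -> E (S n x).
Variables (B : nat -> Z -> bool) (mB : forall j, measurable [set z | B j z]).
Hypothesis mean : forall J, \int[nu]_(x in D) (meet B J (S n x))%:R @[n --> \oo] -->
  (\int[m]_(z in E) (meet B J z)%:R : R).
Variables (Phi : R -> R) (young : young_function Phi).

(** L^1 approximation by step functions, uniform along all the S_n, with a sup bound [K] that does
    not depend on eta: these are the inputs of [modular_small], which then controls products with
    the unbounded v_n. *)
Definition approximable (f : Z -> R) := bounded_measurable E f /\
  exists K : R, forall eta, 0 < eta -> exists s, [/\ step B s,
    forall z, E z -> `|f z - s z| <= K,
    forall n, \int[nu]_(x in D) `|f (S n x) - s (S n x)| <= eta &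
    \int[m]_(z in E) `|f z - s z| <= eta].

Variables (v : nat -> X -> R).
Hypothesis mv : forall n, measurable_fun setT (v n).
Hypothesis v0 : forall n x, 0 <= v n x.
Hypothesis v1 : forall n, (\int[nu]_(x in D) (Phi (v n x))%:E <= 1)%E.
Hypothesis cv : forall (M : nat) J,
  cvgn (fun n => \int[nu]_(x in D) (Num.min (v n x) M%:R * (meet B J (S n x))%:R)).

Let vm (M : nat) n x : R := Num.min (v n x) M%:R.

Let vmM M n x : 0 <= vm M n x <= M%:R.
Proof. by rewrite /vm le_min v0 ler0n ge_min lexx orbT. Qed.

Let mvm M n : measurable_fun setT (vm M n).
Proof. exact: measurable_minr. Qed.

Lemma truncated_limits : exists (w : nat -> Z -> R) (s : nat -> nat -> Z -> R),
  forall M, [/\ measurable_fun setT (w M), forall z, 0 <= w M z <= M%:R,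
      forall k, step B (s M k) /\ forall z, 0 <= s M k z <= M%:R,
      {ae m, forall z, E z -> s M k z @[k --> \oo] --> w M z} &
      forall f, step B f -> \int[nu]_(x in D) (vm M n x * f (S n x)) @[n --> \oo] -->
        \int[m]_(z in E) (w M z * f z)].
Proof.
have H M := riesz_bounded mD nuD mE mEoo mS SE mB mean (mvm M) (fun n x _ => vmM M n x) (@cv M)
  (ler0n R M).
have [p pP] := choice H; have [q qP] := choice pP.
by exists p, q.
Qed.

Let rb (g : Z -> R) : measurable_fun setT g -> (exists L : R, forall z, `|g z| <= L) ->
  rintegrable m E g.
Proof.
move=> mg [L gL]; apply: bounded_measurable_rintegrable => //.
by split => //; exists L => z _; exact: gL.
Qed.

Let rvmf M n f : step B f -> rintegrable nu D (fun x => vm M n x * f (S n x)).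
Proof.
move=> sf; apply: bounded_measurable_rintegrable => //; apply: bounded_measurableM.
  by split => //; exists M%:R => x _; have /andP[? ?] := vmM M n x; rewrite ger0_norm.
exact: (step_comp_bounded mS SE mB).
Qed.

Section truncated.
Variables (w : nat -> Z -> R) (s : nat -> nat -> Z -> R).
Hypothesis ws : forall M, [/\ measurable_fun setT (w M), forall z, 0 <= w M z <= M%:R,
      forall k, step B (s M k) /\ forall z, 0 <= s M k z <= M%:R,
      {ae m, forall z, E z -> s M k z @[k --> \oo] --> w M z} &
      forall f, step B f -> \int[nu]_(x in D) (vm M n x * f (S n x)) @[n --> \oo] -->
        \int[m]_(z in E) (w M z * f z)].

Let mw M : measurable_fun setT (w M). Proof. by case: (ws M). Qed.
Let wM M z : 0 <= w M z <= M%:R. Proof. by case: (ws M). Qed.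
Let rw M : rintegrable m E (w M).
Proof. by apply: rb => //; exists M%:R => z; have /andP[? ?] := wM M z; rewrite ger0_norm. Qed.

(** The inequality min (v, M) <= min (v, M + 1) is inherited by the limits against nonnegative step
    functions. *)
Lemma truncated_mono M : {ae m, forall z, E z -> w M z <= w M.+1 z}.
Proof.
have [_ _ sK sw lw] := ws M; have [_ _ s'K s'w lw'] := ws M.+1.
apply: (ae_le_of_step mE mEoo mB (K := M.+1%:R) _ _ _ _ _ _ sw s'w) => //.
- move=> z; have /andP[-> /le_trans->]// := wM M z; by rewrite ler_nat.
- move=> k; split; first exact: (sK k).1.
  by move=> z; have /andP[-> /le_trans->]// := (sK k).2 z; rewrite ler_nat.
move=> f sf f0; apply: (ler_cvg_to (lw f sf) (lw' f sf)); apply: nearW => n.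
apply: Rintegral_le => //; try exact: rvmf.
move=> x _; apply: ler_wpM2r; first exact: f0.
rewrite /vm le_min ge_min lexx/= ge_min; apply/orP; right.
by rewrite ler_nat.
Qed.

(** Lower semicontinuity of the modular. The tangents to [Phi] are taken at the step functions s_k
    and not at the limit density, so that slope and intercept are step functions and the limit in n
    is known: int (Phi (s_k) + p (s_k) (w - s_k)) <= 1. Then k grows, the slopes being bounded by
    [C]. *)
Lemma truncated_modular M : \int[m]_(z in E) Phi (w M z) <= 1.
Proof.
have [_ _ sK sw lw] := ws M.
pose p t := subgradient Phi (Num.max 0 t).
have spl k : step B (fun z => p (s M k z)) by exact: step_map (sK k).1.
pose C : R := Phi (M%:R + 1).
have pC k z : 0 <= p (s M k z) <= C.
  have /andP[r0 rM] := (sK k).2 z.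
  rewrite /p (max_idPr r0) subgradient_ge0//= (le_trans (subgradient_le young r0))//.
  by apply: young_le => //; [lra|rewrite lerD2r].
have Pb (g : Z -> R) : measurable_fun setT g -> (forall z, 0 <= g z <= M%:R) ->
    rintegrable m E (fun z => Phi (g z)).
  move=> mg gM; apply: rb.
    by apply: measurable_young => // z; case/andP: (gM z).
  exists (Phi M%:R) => z; have /andP[g0 gM'] := gM z.
  by rewrite ger0_norm ?(young_ge0 young)// young_le.
have ms k : measurable_fun setT (s M k) by exact: measurable_step (sK k).1.
have key k : \int[m]_(z in E) Phi (s M k z) <=
    1 + C * \int[m]_(z in E) `|s M k z - w M z|.
  have sG : step B (fun z => Phi (s M k z) - p (s M k z) * s M k z).
    by apply: (step_map (fun t => Phi t - p t * t)); exact: (sK k).1.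
  have cG := step_mean mD nuD mE mEoo mS SE mB mean sG.
  have cp := lw _ (spl k).
  have le1 : \int[m]_(z in E) (Phi (s M k z) - p (s M k z) * s M k z) +
      \int[m]_(z in E) (w M z * p (s M k z)) <= 1.
    have cGp := cvgD cG cp; have c11 : 1 @[n --> \oo] --> (1 : R) by exact: cvg_cst.
    apply: (ler_cvg_to (cGp _) c11); apply: nearW => n /=.
    have rG : rintegrable nu D (fun x => Phi (s M k (S n x)) - p (s M k (S n x)) * s M k (S n x)).
      apply: bounded_measurable_rintegrable => //.
      exact: (step_comp_bounded mS SE mB n sG).
    have [_ ?] := rG; have [_ ?] := rvmf M n (spl k).
    rewrite [leLHS](_ : _ = \int[nu]_(x in D) (Phi (s M k (S n x)) - p (s M k (S n x)) * s M k (S n x)) +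
      \int[nu]_(x in D) (vm M n x * p (s M k (S n x))))//.
    rewrite -RintegralD//.
    apply: (le_trans _ (Rintegral_modular_le1 young mD (mv n) (v0 n) (v1 n))).
    apply: Rintegral_le => //.
    - have := rintegrable_comb mD 1 rG (rvmf M n (spl k)).
      by congr rintegrable; apply/funext => x; rewrite mul1r.
    - exact: rintegrable_modular.
    move=> x Dx; have /andP[vm0 _] := vmM M n x.
    have vv : vm M n x <= v n x by rewrite /vm ge_min lexx.
    apply: (@le_trans _ _ (Phi (vm M n x))); last exact: young_le.
    have /andP[r0 rM] := (sK k).2 (S n x).
    apply: le_trans (subgradientP young r0 vm0).
    by rewrite /p (max_idPr r0); lra.
  have rwp : rintegrable m E (fun z => w M z * p (s M k z)).
    apply: rintegrableM => //; exact: step_bounded_measurable (spl k).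
  have rabs : rintegrable m E (fun z => `|s M k z - w M z|).
    apply: rintegrable_norm; apply: rintegrableB => //.
    by apply: bounded_measurable_rintegrable => //; exact: step_bounded_measurable (sK k).1.
  have rG : rintegrable m E (fun z => Phi (s M k z) - p (s M k z) * s M k z).
    by apply: bounded_measurable_rintegrable => //; exact: step_bounded_measurable sG.
  have := Rintegral_comb4_ge0 mE (a1 := 1) (a2 := 1) (a3 := C) (a4 := -1) rG rwp rabs
    (Pb _ (ms k) (sK k).2).
  have H : forall z, E z -> 0 <= 1 * (Phi (s M k z) - p (s M k z) * s M k z) +
    (1 * (w M z * p (s M k z)) + (C * `|s M k z - w M z| + -1 * Phi (s M k z))).
    move=> z Ez; have /andP[p0 pCz] := pC k z.
    have : p (s M k z) * (s M k z - w M z) <= C * `|s M k z - w M z|.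
      apply: (le_trans (ler_wpM2l p0 (ler_norm _))).
      by rewrite ler_wpM2r.
    lra.
  by move=> /(_ H); move: le1; lra.
have c1 : \int[m]_(z in E) Phi (s M k z) @[k --> \oo] --> \int[m]_(z in E) Phi (w M z).
  apply: (@Rintegral_bounded_cvg _ _ _ _ _ mE mEoo _ _ (Phi M%:R)).
  - by move=> k; apply: measurable_young => // z; case/andP: ((sK k).2 z).
  - by apply: measurable_young => // z; case/andP: (wM M z).
  - move=> k z _; have /andP[g0 gM'] := (sK k).2 z.
    by rewrite ger0_norm ?(young_ge0 young)// young_le.
  - apply: filterS sw => z sz Ez; apply: (young_cvg young) (sz Ez) => //.
      by apply: nearW => k; case/andP: ((sK k).2 z).
    by case/andP: (wM M z).
have c2 : \int[m]_(z in E) `|s M k z - w M z| @[k --> \oo] --> \int[m]_(z in E) (0 : R).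
  apply: (@Rintegral_bounded_cvg _ _ _ _ _ mE mEoo _ _ M%:R) => //.
  - by move=> k; apply: measurableT_comp => //; exact: measurable_funB.
  - move=> k z _; rewrite normr_id ler_norml.
    by have /andP[? ?] := (sK k).2 z; have /andP[? ?] := wM M z; lra.
  - apply: filterS sw => z sz Ez; apply/norm_cvg0P.
    by rewrite -(subrr (w M z)); apply: cvgB; [exact: sz|exact: cvg_cst].
have -> : 1 = 1 + C * \int[m]_(z in E) (0 : R).
  by rewrite (Rintegral_cst _ mE) mul0r mulr0 addr0.
have c11 : 1 @[n --> \oo] --> (1 : R) by exact: cvg_cst.
have c3 : 1 + C * \int[m]_(z in E) `|s M k z - w M z| @[k --> \oo] -->
    1 + C * \int[m]_(z in E) (0 : R) by apply: cvgD => //; apply: cvgMr.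
apply: (ler_cvg_to c1 c3); apply: nearW => k /=.
exact: key.
Qed.

End truncated.

Lemma fatou_le1 (g : nat -> Z -> R) (h : Z -> R) :
  (forall k, measurable_fun setT (g k)) -> measurable_fun setT h ->
  (forall k z, 0 <= g k z) -> (forall z, 0 <= h z) ->
  (forall k, \int[m]_(z in E) (g k z)%:E <= 1)%E ->
  {ae m, forall z, E z -> g k z @[k --> \oo] --> h z} ->
  (\int[m]_(z in E) (h z)%:E <= 1)%E.
Proof.
move=> mg mh g0 h0 g1 gh.
have mgE k : measurable_fun E (fun z => (g k z)%:E).
  by apply/measurable_EFinP; exact: measurable_funTS.
have e0 z : (0 <= limn_einf (fun k => (g k z)%:E))%E.
  rewrite limn_einf_lim; apply: lime_ge; first exact: is_cvg_einfs.
  by apply: nearW => n; apply: le_ereal_inf_tmp => _ [k /= _ <-]; rewrite lee_fin.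
rewrite (@ge0_ae_eq_integral _ _ _ m E _ (fun z => limn_einf (fun k => (g k z)%:E)))//.
- apply: (le_trans (fatou m mE mgE _)); first by move=> n z _; rewrite lee_fin.
  rewrite limn_einf_lim; apply: lime_le; first exact: is_cvg_einfs.
  apply: nearW => n; apply: le_trans (g1 n); apply: ereal_inf_lbound.
  by exists n => //=.
- by apply/measurable_EFinP; exact: measurable_funTS.
- rewrite /limn_einf; apply: measurableT_comp => //.
  by apply: measurable_fun_limn_esup => k; exact: measurableT_comp.
- by move=> z _; rewrite lee_fin.
- apply: filterS gh => z gz Ez; have {}gz := gz Ez.
  have cvE : (g k z)%:E @[k --> \oo] --> (h z)%:E.
    by apply/fine_cvgP; split; [exact: nearW|exact: gz].
  rewrite is_cvg_limn_einfE; first by apply/esym/cvg_lim.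
  by apply/cvg_ex; eexists; exact: cvE.
Qed.

(** [W] is the monotone limit of the truncated densities. Superlinearity removes the truncation
    against step functions ([stepW]); [modular_small] then passes to approximable functions, for the
    v_n and for [W] alike. *)
Lemma orlicz_weak_limit : exists w : Z -> R,
  [/\ measurable_fun setT w, forall z, 0 <= w z,
    (\int[m]_(z in E) (Phi (w z))%:E <= 1)%E &
    forall f, approximable f -> \int[nu]_(x in D) (v n x * f (S n x)) @[n --> \oo] -->
      \int[m]_(z in E) (w z * f z)].
Proof.
have [w [s ws]] := truncated_limits.
have mono M := truncated_mono ws M; have mod M := truncated_modular ws M.
have mw M : measurable_fun setT (w M) by case: (ws M).
have wM M z : 0 <= w M z <= M%:R by case: (ws M).
have w0 M z : 0 <= w M z by case/andP: (wM M z).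
have rw M : rintegrable m E (w M).
  by apply: rb => //; exists M%:R => z; have /andP[? ?] := wM M z; rewrite ger0_norm.
have mPw M : measurable_fun setT (fun z => Phi (w M z)) by exact: measurable_young.
have rPw M : rintegrable m E (fun z => Phi (w M z)).
  apply: rb => //; exists (Phi M%:R) => z; have /andP[g0 gM'] := wM M z.
  by rewrite ger0_norm ?(young_ge0 young)// young_le.
have [K K0 KP] := young_bound young ltr01.
have r1 := bounded_measurable_rintegrable mE mEoo (bounded_measurable_cst E (1 : R)).
pose C := K * \int[m]_(z in E) (1 : R) + 1.
have wC M : \int[m]_(z in E) w M z <= C.
  apply: (@le_trans _ _ (K * \int[m]_(z in E) (1 : R) + \int[m]_(z in E) Phi (w M z))).
    rewrite -Rintegral_comb//; apply: Rintegral_le => //; first exact: rintegrable_comb.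
    by move=> z _; have := KP _ (w0 M z); lra.
  by rewrite lerD2l.
(* By monotonicity in M the L^1 norms of the increments telescope, and [wC] bounds the total through
   the modular. *)
have inc n : \sum_(k < n) \int[m]_(z in E) `|w k.+1 z - w k z| <= C.
  have -> : \sum_(k < n) \int[m]_(z in E) `|w k.+1 z - w k z| =
      \sum_(k < n) (\int[m]_(z in E) w k.+1 z - \int[m]_(z in E) w k z).
    apply: eq_bigr => k _; have [_ ?] := rw k; have [_ ?] := rw k.+1.
    rewrite -RintegralB//; apply: Rintegral_ae_eq => //.
    - by apply: measurableT_comp => //; exact: measurable_funB.
    - exact: measurable_funB.
    - by apply: filterS (mono k) => z wz Ez; rewrite ger0_norm// subr_ge0 wz.
  rewrite -(big_mkord xpredT (fun k => \int[m]_(z in E) w k.+1 z - \int[m]_(z in E) w k z)).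
  rewrite telescope_sumr//; have := wC n.
  have : 0 <= \int[m]_(z in E) w 0%N z by exact: Rintegral_ge0.
  lra.
have [u mu cu] := ae_cvg_of_increments mE rw inc.
pose W z := Num.max (u z) 0.
have mW : measurable_fun setT W by exact: measurable_maxr.
have W0 z : 0 <= W z by rewrite /W le_max lexx orbT.
have cW : {ae m, forall z, E z -> (forall M, w M z <= W z) /\ w M z @[M --> \oo] --> W z}.
  apply: filterS2 cu (ae_foralln mono) => z uz wz Ez; have {}uz := uz Ez.
  have u0 : 0 <= u z.
    have c0 : 0 @[n --> \oo] --> (0 : R) by exact: cvg_cst.
    by apply: (ler_cvg_to c0 uz); apply: nearW => k.
  rewrite /W (max_idPl u0); split => // M.
  have cM : w M z @[n --> \oo] --> w M z by exact: cvg_cst.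
  apply: (ler_cvg_to cM uz); exists M => // n /= Mn.
  have nd : nondecreasing_seq (fun k => w k z) by apply/nondecreasing_seqP => k; exact: wz.
  exact: nd.
have W1 : (\int[m]_(z in E) (Phi (W z))%:E <= 1)%E.
  apply: (fatou_le1 mPw).
  - exact: measurable_young.
  - by move=> k z; exact: young_ge0.
  - by move=> z; exact: young_ge0.
  - by move=> k; rewrite -Rintegral_EFin// lee_fin.
  - apply: filterS cW => z /[apply] -[_ wz].
    by apply: (young_cvg young) wz => //; apply: nearW => k.
have rW := rintegrable_of_modular young mE mEoo mW W0 W1.
have rv n := rintegrable_of_modular young mD nuD (mv n) (v0 n) (v1 n).
have stepW f : step B f -> \int[nu]_(x in D) (v n x * f (S n x)) @[n --> \oo] -->
    \int[m]_(z in E) (W z * f z).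
  move=> sf; apply: cvg_uniform_approx => eta eta0.
  have [L fL] := step_bounded sf; pose L' := `|L| + 1.
  have L0 : 0 < L' by rewrite /L' ltr_pwDr.
  have fL' z : `|f z| <= L' by rewrite (le_trans (fL z))// /L' (le_trans (ler_norm _))// lerDl.
  have e1 : 0 < eta / L' by rewrite divr_gt0.
  (* Where v > M >= M0 one has v <= (eta / L') Phi v, so cutting v at M costs at most eta int Phi
     (v) <= eta against |f| <= L', uniformly in n. *)
  have [M0 M00 M0P] := young_superlinear young e1.
  have cI : \int[m]_(z in E) (w M z * f z) @[M --> \oo] --> \int[m]_(z in E) (W z * f z).
    have mf := measurable_step mB sf.
    apply: (@Rintegral_dominated_cvg _ _ _ _ _ mE _ _ (fun z => L' * W z)) => //.
    - by move=> M; exact: measurable_funM.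
    - exact: measurable_funM.
    - exact: rintegrableZ.
    - apply: filterS cW => z /[apply] -[wW _] n.
      by rewrite normrM mulrC ler_pM// ger0_norm.
    - by apply: filterS cW => z /[apply] -[_ wz]; apply: cvgMl.
  have /cvgrPdist_le /(_ _ eta0) [M1 _ M1P] := cI.
  (* Large enough for the truncation error ([M0]) and for the convergence of the truncated densities
     to [W] ([M1]). *)
  pose M := maxn M1 (Num.truncn M0).+1.
  have MM0 : M0 <= M%:R.
    apply: ltW; apply: (lt_le_trans (truncnS_gt M0)).
    by rewrite ler_nat leq_maxr.
  exists (fun n => \int[nu]_(x in D) (vm M n x * f (S n x))), (\int[m]_(z in E) (w M z * f z)).
  split; first by case: (ws M) => _ _ _ _; apply.
    move=> n; have bfS := step_comp_bounded mS SE mB n sf.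
    have rvf : rintegrable nu D (fun x => v n x * f (S n x)) by exact: rintegrableM.
    have rvmf' := rvmf M n sf.
    have rP := rintegrable_modular young (mv n) (v0 n) (v1 n).
    apply: (le_trans (Rintegral_dist_le mD rvf rvmf')).
    apply: (@le_trans _ _ (eta * \int[nu]_(x in D) Phi (v n x))).
      have [_ ?] := rP; rewrite -RintegralZl//; apply: Rintegral_le => //.
      - by apply: rintegrable_norm; exact: rintegrableB.
      - exact: rintegrableZ.
      move=> x Dx; rewrite -mulrBl normrM.
      have P0 : 0 <= Phi (v n x) by exact: young_ge0.
      rewrite /vm; have [vM|Mv] := leP (v n x) M%:R.
        by rewrite subrr normr0 mul0r mulr_ge0// ltW.
      have vM0 : 0 <= v n x - M%:R by rewrite subr_ge0 ltW.
      rewrite ger0_norm//; apply: (le_trans (ler_pM vM0 (normr_ge0 _) (lexx _) (fL' _))).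
      rewrite -ler_pdivlMr//.
      have := M0P _ (le_trans MM0 (ltW Mv)).
      rewrite mulrAC; have := ler0n R M; lra.
    rewrite ler_piMr ?(ltW eta0)//.
    exact: Rintegral_modular_le1.
  rewrite distrC; apply: M1P; exact: leq_maxl.
exists W; split => // f [bf [K1 fK1]].
apply: cvg_uniform_approx => eta eta0.
pose K2 := `|K1| + 1; have K20 : 0 < K2 by rewrite /K2 ltr_pwDr.
have [dl1 dl10 dl1P] := modular_small young mD nuD K20 eta0.
have [dl2 dl20 dl2P] := modular_small young mE mEoo K20 eta0.
have [|t [st ftK ftn ft]] := fK1 (Num.min dl1 dl2); first by rewrite lt_min dl10.
exists (fun n => \int[nu]_(x in D) (v n x * t (S n x))), (\int[m]_(z in E) (W z * t z)).
have bt := step_bounded_measurable mB E st.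
have bft : bounded_measurable E (fun z => f z - t z).
  have [[mf _] [mt _]] := (bf, bt); split; first exact: measurable_funB.
  by exists K1.
have ftK2 z : E z -> `|f z - t z| <= K2.
  by move=> Ez; rewrite (le_trans (ftK _ Ez))// /K2 (le_trans (ler_norm _))// lerDl.
split; first exact: stepW.
  move=> n; have bfn := bounded_measurable_comp mS SE n bf.
  have btn := bounded_measurable_comp mS SE n bt.
  have rf := rintegrableM mD nuD (rv n) bfn; have rt := rintegrableM mD nuD (rv n) btn.
  apply: (le_trans (Rintegral_dist_le mD rf rt)).
  under eq_Rintegral do rewrite -mulrBr.
  apply: (dl1P (v n) (fun x => f (S n x) - t (S n x))) => //.
  - exact: (bounded_measurable_comp mS SE n bft).
  - by move=> x Dx; apply/ftK2/SE.
  - by apply: (le_trans (ftn n)); rewrite ge_min lexx.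
rewrite distrC; have rf := rintegrableM mE mEoo rW bf; have rt := rintegrableM mE mEoo rW bt.
apply: (le_trans (Rintegral_dist_le mE rf rt)).
under eq_Rintegral do rewrite -mulrBr.
by apply: (dl2P W (fun z => f z - t z)) => //; apply: (le_trans ft); rewrite ge_min lexx orbT.
Qed.

End orlicz_limits.

(** * Extraction of a convergent subsequence *)

(* Limits along an ultrafilter finer than the eventual filter serve as common cluster values. *)
Lemma common_subsequence {R : realType} (I : countType) (a : I -> nat -> R) :
  (forall i, exists K : R, forall n, `|a i n| <= K) ->
  exists2 sigma : nat -> nat, {homo sigma : m n / (m < n)%N >-> (m < n)%N} &
    forall i, cvgn (fun n => a i (sigma n)).
Proof.
move=> aK.
have [U [UU ooU]] := @ultraFilterLemma nat \oo _.
have UF : ProperFilter U by exact: ultra_proper.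
have lim i : exists l : R, forall e, 0 < e -> U [set n | `|a i n - l| < e].
  have [K aiK] := aK i.
  have [|l [_ al]] := @segment_compact R (- K) K (a i @ U) _.
    by apply: (@filterE nat U) => n /=; rewrite in_itv/= -ler_norml.
  exists l => e e0; have [//|UC] := in_ultra_setVsetC [set n | `|a i n - l| < e] UU.
  have UaC : (a i @ U) (~` ball l e).
    by apply: (@filterS _ U _ _ _ _ UC) => n /=; rewrite -ball_normE /= distrC.
  by have [x [] ] := al _ _ UaC (nbhsx_ballx l e e0).
have [l lP] := choice lim.
(* At rank k only the finitely many indices of code at most k are controlled, within 1 / (k + 1):
   the diagonal argument. *)
pose good k n := forall i, (pickle i <= k)%N -> `|a i n - l i| < k.+1%:R^-1.
have Ugood e k : 0 < e -> U [set n | forall i, (pickle i < k)%N -> `|a i n - l i| < e].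
  move=> e0; elim: k => [|k IH]; first exact: filterE.
  have U1 : U [set n | forall i, pickle i = k -> `|a i n - l i| < e].
    have [[i0 i0k]|nk] := pselect (exists i : I, pickle i = k); last first.
      by apply: filterE => n i ik; exfalso; apply: nk; exists i.
    apply: filterS (lP i0 e e0) => n /= H i ik.
    by have -> : i = i0 by apply: (pcan_inj pickleK); rewrite ik i0k.
  apply: filterS2 IH U1 => n h1 h2 i; rewrite ltnS leq_eqVlt => /predU1P[/h2//|/h1//].
have next (p : nat * nat) : exists n, (p.2 < n)%N /\ good p.1 n.
  have Up : U [set n | (p.2 < n)%N] by apply: ooU; exists p.2.+1.
  have e0 : 0 < (p.1.+1%:R : R)^-1 by rewrite invr_gt0.
  have [n [n1 n2]] := filter_ex (filterI Up (Ugood _ p.1.+1 e0)).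
  by exists n; split.
have [g gP] := choice next.
(* [g] receives the rank and the previous value and returns an index beyond the latter, so that
   sigma is strictly increasing. *)
pose sigma := fix sigma k := match k with 0%N => g (0, 0)%N | k'.+1 => g (k, sigma k') end.
have sigmaS k : (sigma k < sigma k.+1)%N by exact: (gP (k.+1, sigma k)).1.
have sgood k : good k (sigma k) by case: k => [|k]; [exact: (gP (0, 0)%N).2|exact: (gP (k.+1, sigma k)).2].
exists sigma; first by apply: homo_ltn => //; exact: ltn_trans.
move=> i; apply/cvg_ex; exists (l i); apply/cvgrPdist_le => e e0.
exists (maxn (pickle i) (Num.truncn e^-1)) => // k /=; rewrite geq_max => /andP[ik ek].
rewrite distrC ltW//; apply: (lt_le_trans (sgood k i ik)).
rewrite invf_ple ?posrE//; apply: ltW; apply: (lt_le_trans (truncnS_gt _)).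
by rewrite ler_nat ltnS.
Qed.

Lemma extraction_cvg {R : realType} (sigma : nat -> nat) (a : nat -> R) (l : R) :
  {homo sigma : m n / (m < n)%N >-> (m < n)%N} ->
  a n @[n --> \oo] --> l -> a (sigma n) @[n --> \oo] --> l.
Proof.
move=> hs al P /al [N _ NP]; have le n : (n <= sigma n)%N.
  by elim: n => // n /leq_ltn_trans; apply; exact: hs.
by exists N => // n /= Nn; apply: NP => /=; exact: leq_trans (le n).
Qed.

Section subsequence.
Context {R : realType} dX (X : measurableType dX) dZ (Z : measurableType dZ).
Variables (nu : {measure set X -> \bar R}) (m : {measure set Z -> \bar R}).
Variables (D : set X) (mD : measurable D) (nuD : (nu D < +oo)%E).
Variables (E : set Z) (mE : measurable E) (mEoo : (m E < +oo)%E).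
Variables (S : nat -> X -> Z) (mS : forall n, measurable_fun setT (S n)).
Hypothesis SE : forall n x, D x -> E (S n x).
Variables (B : nat -> Z -> bool) (mB : forall j, measurable [set z | B j z]).
Hypothesis mean : forall J, \int[nu]_(x in D) (meet B J (S n x))%:R @[n --> \oo] -->
  (\int[m]_(z in E) (meet B J z)%:R : R).
Variables (Phi : R -> R) (young : young_function Phi).
Variables (u : nat -> X -> R).
Hypothesis mu : forall n, measurable_fun setT (u n).
Hypothesis u1 : forall n, (\int[nu]_(x in D) (Phi `|u n x|)%:E <= 1)%E.

(** Positive part for [true], negative part for [false]. The Boolean is one more index in the
    extraction, so a single subsequence serves both. *)
Let part (b : bool) n x : R := Num.max (if b then u n x else - u n x) 0.

Let mpart b n : measurable_fun setT (part b n).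
Proof. by apply: measurable_maxr => //; case: b => //; exact: measurableT_comp. Qed.

Let part0 b n x : 0 <= part b n x.
Proof. by rewrite /part le_max lexx orbT. Qed.

Let part1 b n : (\int[nu]_(x in D) (Phi (part b n x))%:E <= 1)%E.
Proof.
apply: le_trans (u1 n); apply: ge0_le_integral => //.
- by move=> x _; rewrite lee_fin (young_ge0 young).
- by apply/measurable_EFinP/measurable_funTS; exact: measurable_young.
- by apply/measurable_EFinP/measurable_funTS; apply: measurable_young => //; exact: measurableT_comp.
move=> x _; rewrite lee_fin young_le// /part ge_max normr_ge0 andbT.
by case: b; rewrite ?ler_norm// -normrN ler_norm.
Qed.

Let partE n x : u n x = part true n x - part false n x.
Proof. by rewrite /part; case: (leP (u n x) 0) => ?; case: (leP (- u n x) 0) => ?; lra. Qed.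

Lemma weak_compactness : exists2 sigma : nat -> nat,
  {homo sigma : m n / (m < n)%N >-> (m < n)%N} &
  exists u0 : Z -> R, [/\ measurable_fun setT u0,
    (\int[m]_(z in E) (Phi `|u0 z|)%:E < +oo)%E &
    forall f, approximable nu m D E S B f ->
      \int[nu]_(x in D) (u (sigma n) x * f (S (sigma n) x)) @[n --> \oo] -->
      \int[m]_(z in E) (u0 z * f z)].
Proof.
have [|sigma hsigma cs] := @common_subsequence R (bool * nat * seq nat)%type
  (fun i n => \int[nu]_(x in D) (Num.min (part i.1.1 n x) i.1.2%:R * (meet B i.2 (S n x))%:R)).
  move=> [[b M] J] /=; exists (\int[nu]_(x in D) M%:R) => n.
  have r1 : rintegrable nu D (fun x => Num.min (part b n x) M%:R * (meet B J (S n x))%:R).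
    apply: bounded_measurable_rintegrable => //; apply: bounded_measurableM.
      split; first exact: measurable_minr.
      by exists M%:R => x _; rewrite ger0_norm ?le_min ?part0//= ge_min lexx orbT.
    exact: (step_comp_bounded mS SE mB n (step_meet B J)).
  apply: (le_trans (Rintegral_norm_le mD r1)); apply: Rintegral_le => //.
  - exact: rintegrable_norm.
  - by apply: bounded_measurable_rintegrable => //; exact: bounded_measurable_cst.
  move=> x _; rewrite normrM ger0_norm ?le_min ?part0//=.
  case: meet; rewrite ?normr1 ?normr0 ?mulr1 ?mulr0//.
  by rewrite ge_min lexx orbT.
have mean' J : \int[nu]_(x in D) (meet B J (S (sigma n) x))%:R @[n --> \oo] -->
    (\int[m]_(z in E) (meet B J z)%:R : R).
  exact: (extraction_cvg hsigma (@mean J)).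
have W b := orlicz_weak_limit mD nuD mE mEoo (fun n => mS (sigma n)) (fun n => @SE (sigma n))
  mB mean' young (fun n => mpart b (sigma n)) (fun n => part0 b (sigma n))
  (fun n => part1 b (sigma n)) (fun M J => cs (b, M, J)).
have [wp [mp p0 p1 cp]] := W true; have [wn [mn n0 n1 cn]] := W false.
exists sigma => //; exists (fun z => wp z - wn z); split.
- exact: measurable_funB.
(* For nonnegative a and b, |a - b| <= max a b, hence Phi |a - b| <= Phi a + Phi b: the modular is
   at most 2. *)
- apply: (@le_lt_trans _ _ (\int[m]_(z in E) ((Phi (wp z))%:E + (Phi (wn z))%:E))%E).
    apply: ge0_le_integral => //.
    + by move=> x _; rewrite lee_fin (young_ge0 young).
    + apply/measurable_EFinP/measurable_funTS; apply: measurable_young => //.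
      by apply: measurableT_comp => //; exact: measurable_funB.
    + by apply: emeasurable_funD; apply/measurable_EFinP/measurable_funTS; exact: measurable_young.
    + move=> z _; rewrite -EFinD lee_fin; have := p0 z; have := n0 z => nz pz.
      have Pp : 0 <= Phi (wp z) by exact: young_ge0.
      have Pn : 0 <= Phi (wn z) by exact: young_ge0.
      have [h|h] := leP (wp z) (wn z).
        apply: (@le_trans _ _ (Phi (wn z))); last by rewrite lerDr.
        by apply: young_le => //; rewrite ler0_norm; lra.
      apply: (@le_trans _ _ (Phi (wp z))); last by rewrite lerDl.
      by apply: young_le => //; rewrite gtr0_norm; lra.
  rewrite ge0_integralD//.
  + apply: (@le_lt_trans _ _ (1 + 1)%E); first exact: leeD.
    by rewrite -EFinD ltry.
  + by move=> z _; rewrite lee_fin (young_ge0 young).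
  + by apply/measurable_EFinP/measurable_funTS; exact: measurable_young.
  + by move=> z _; rewrite lee_fin (young_ge0 young).
  + by apply/measurable_EFinP/measurable_funTS; exact: measurable_young.
move=> f [bf af].
have af' : approximable nu m D E (S \o sigma) B f.
  split => //; have [K H] := af; exists K => eta /H[s [? ? hs ?]]; exists s; split => // n.
  exact: hs.
have rb b n : rintegrable nu D (fun x => part b (sigma n) x * f (S (sigma n) x)).
  apply: rintegrableM => //; last exact: (bounded_measurable_comp mS SE _ bf).
  exact: (rintegrable_of_modular young mD nuD (mpart b _) (part0 b _) (part1 b _)).
have [rp rn] : rintegrable m E (fun z => wp z * f z) /\ rintegrable m E (fun z => wn z * f z).
  by split; apply: rintegrableM => //;
    [exact: (rintegrable_of_modular young mE mEoo mp)|exact: (rintegrable_of_modular young mE mEoo mn)].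
have [_ ?] := rp; have [_ ?] := rn.
have -> : \int[m]_(z in E) ((wp z - wn z) * f z) =
    \int[m]_(z in E) (wp z * f z) - \int[m]_(z in E) (wn z * f z).
  by rewrite -RintegralB//; apply: eq_Rintegral => z _; rewrite mulrBl.
have c := cvgB (cp f af') (cn f af').
apply: cvg_trans (c _); apply: near_eq_cvg; apply: nearW => n.
have [_ ?] := rb true n; have [_ ?] := rb false n.
rewrite [LHS](_ : _ = \int[nu]_(x in D) (part true (sigma n) x * f (S (sigma n) x)) -
  \int[nu]_(x in D) (part false (sigma n) x * f (S (sigma n) x)))//.
by rewrite -RintegralB//; apply: eq_Rintegral => x _; rewrite -mulrBl -partE.
Qed.

End subsequence.

(** * Fractional parts *)

Section fractional_part.
Context {R : realType}.
Implicit Types t a b c r e : R.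

Definition frac t : R := t - (Num.floor t)%:~R.

Lemma frac_ge0 t : 0 <= frac t.
Proof. by rewrite subr_ge0 floor_le. Qed.

Lemma frac_lt1 t : frac t < 1.
Proof. by have := floorD1_gt t; rewrite /frac intrD; lra. Qed.

Lemma frac_id t : 0 <= t < 1 -> frac t = t.
Proof.
move=> t01; rewrite /frac (_ : Num.floor t = 0) ?subr0//.
by apply: floor_def; rewrite add0r.
Qed.

Lemma fracDz t (k : int) : frac (t + k%:~R) = frac t.
Proof. by rewrite /frac floorDrz ?intr_int// intrD; rewrite intrKfloor; ring. Qed.

Lemma measurable_frac : measurable_fun setT frac.
Proof.
apply: measurable_funB => //; apply: nondecreasing_measurable => // s t st.
by rewrite ler_int le_floor.
Qed.

Let slab a b c r e := [set t | (a <= t < b) && (c <= frac (t / e) < r)].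

Let measurable_slab a b c r e : measurable (slab a b c r e).
Proof.
rewrite (_ : slab a b c r e = [set` `[a, b[] `&`
    ((fun t => frac (t / e)) @^-1` [set` `[c, r[])).
  apply: measurableI; first exact: measurable_itv.
  have mf : measurable_fun setT (fun t => frac (t / e)).
    by apply: (measurableT_comp measurable_frac); exact: measurable_funM.
  by rewrite -[X in measurable X]setTI; apply: mf => //; exact: measurable_itv.
by apply/seteqP; split => t; rewrite /slab /= !in_itv/=; [case/andP|case=> -> ->].
Qed.

(** The slab is covered by floor (b / e) - floor (a / e) + 1 intervals of length e (r - c), one per
    period of length e; their number times e is at most b - a + 2 e. *)
Let lebesgue_slab a b c r e : 0 < e -> a <= b -> 0 <= c -> c <= r ->
  (@lebesgue_measure R (slab a b c r e) <= ((r - c) * (b - a + 2 * e))%:E)%E.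
Proof.
move=> e0 ab c0 cr.
pose k0 := Num.floor (a / e); pose k1 := Num.floor (b / e).
pose K := absz (k1 - k0 + 1).
have k01 : k0 <= k1 by rewrite le_floor// ler_pM2r// invr_gt0.
have KE : K%:Z = k1 - k0 + 1 by rewrite gez0_abs// addr_ge0// subr_ge0.
pose F i : set R := [set` `[e * (k0%:~R + i%:R + c), e * (k0%:~R + i%:R + r)[].
apply: (@le_trans _ _ (\sum_(i < K) @lebesgue_measure R (F i))%E).
  apply: (@content_subadditive _ _ _ (@lebesgue_measure R) _ F K).
  - by move=> i _; exact: measurable_itv.
  - exact: measurable_slab.
  move=> t /= /andP[/andP[at_ tb] /andP[cf fr]].
  pose k := Num.floor (t / e).
  have kk0 : k0 <= k by rewrite le_floor// ler_pM2r// invr_gt0.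
  have kk1 : k <= k1 by rewrite le_floor// ler_pM2r ?invr_gt0// ltW.
  have kE : (absz (k - k0))%:Z = k - k0 by rewrite gez0_abs// subr_ge0.
  rewrite -bigcup_mkord; exists (absz (k - k0)) => /=.
    by rewrite -ltz_nat kE KE; lia.
  have kR : (absz (k - k0))%:R = k%:~R - k0%:~R :> R by rewrite -intrB -kE.
  rewrite /F /= in_itv/= kR (_ : k0%:~R + (k%:~R - k0%:~R) = k%:~R); last by ring.
  move: cf fr; rewrite /frac -/k => cf fr.
  by rewrite mulrC -ler_pdivlMr// [X in _ && (_ < X)]mulrC -ltr_pdivrMr//; apply/andP; split; lra.
rewrite (eq_bigr (fun=> (e * (r - c))%:E)); last first.
  move=> i _; rewrite /F lebesgue_measure_itv/= lte_fin.
  case: ifPn => [_|]; first by rewrite -EFinD; congr (_%:E); ring.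
  rewrite -leNgt ler_pM2l// lerD2l => rc.
  by rewrite (_ : r = c) ?subrr ?mulr0//; apply/eqP; rewrite eq_le rc cr.
rewrite sumEFin lee_fin sumr_const card_ord -[leLHS]mulr_natr.
have KR : K%:R = k1%:~R - k0%:~R + 1 :> R by rewrite -[K%:R]/(K%:Z%:~R) KE intrD intrB.
have h1 : e * k1%:~R <= b by rewrite mulrC -ler_pdivlMr// floor_le.
have h0 : a < e * (k0%:~R + 1) by rewrite mulrC -ltr_pdivrMr// -[1]/(1%:~R) -intrD floorD1_gt.
rewrite KR (mulrC e) -mulrA; apply: ler_wpM2l; first by lra.
lra.
Qed.

(** The covering yields only upper bounds. The lower bound comes from the upper bound for the
    complementary slab r <= frac < 1, as the two measures add up to b - a. *)
Lemma lebesgue_frac_lt a b r e : 0 < e -> a <= b -> 0 <= r <= 1 ->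
  `|fine (@lebesgue_measure R [set t | (a <= t < b) && (frac (t / e) < r)]) - (b - a) * r|
    <= 2 * e.
Proof.
move=> e0 ab /andP[r0 r1].
have H1 := lebesgue_slab e0 ab (lexx 0) r0.
have H2 := lebesgue_slab e0 ab r0 r1.
pose A := [set t | (a <= t < b) && (frac (t / e) < r)].
have eA : slab a b 0 r e = A.
  by apply/seteqP; split=> t; rewrite /slab /A /= frac_ge0.
pose A' := [set t | (a <= t < b) && (r <= frac (t / e) < 1)].
have mA1 : measurable A by rewrite -eA; exact: measurable_slab.
have mA' : measurable A' by exact: measurable_slab.
have eAA : [set` `[a, b[] = A `|` A'.
  apply/seteqP; split => t /=; rewrite in_itv/=; rewrite /A /A' /= frac_lt1 andbT.
    by move=> -> /=; case: (ltP (frac (t / e)) r) => _; [left|right].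
  by case=> /andP[].
have HU : @lebesgue_measure R (A `|` A') = (@lebesgue_measure R A + @lebesgue_measure R A')%E.
  apply: measureU => //; apply/seteqP; split => // t [] /= /andP[_ h] /andP[_ /andP[h' _]].
  by move: h'; rewrite leNgt h.
have : @lebesgue_measure R [set` `[a, b[] = (b - a)%:E.
  rewrite lebesgue_measure_itv/= lte_fin; case: ifPn => [_|]; first by rewrite -EFinD.
  by rewrite -leNgt => ba; congr (_%:E); have := le_anti; lra.
rewrite eAA HU; rewrite eA -/A in H1; rewrite -/A' in H2 *.
have a0 := measure_ge0 (@lebesgue_measure R) A; have a0' := measure_ge0 (@lebesgue_measure R) A'.
move: (@lebesgue_measure R A) (@lebesgue_measure R A') a0 a0' H1 H2 => [x||] [y||]//=.
rewrite !lee_fin -EFinD => x0 y0 H1 H2 [xy].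
rewrite ler_norml; nra.
Qed.

End fractional_part.

(** * Fibrewise measure-preserving maps *)

Section lebesgue_rV_theory.
Context {R : realType} {N : nat}.
Local Notation V := 'rV[R]_N.
Local Notation lambda := (lebesgue_rV R N).

Lemma measurable_pi (A : 'I_N -> set R) : (forall i, measurable (A i)) ->
  measurable [set x : V | forall i, A i (x ord0 i)].
Proof.
move=> mA; rewrite (_ : [set _ | _] = \bigcap_(i in [set: 'I_N])
    ((fun x : V => x ord0 i) @^-1` A i)); last first.
  by apply/seteqP; split=> [x /= + i _|x /= + i]; exact.
apply: fin_bigcap_measurable => // i _.
by rewrite -[X in measurable X]setTI; exact: measurable_coord.
Qed.

Lemma open_boxE (a b : V) :
  open_box a b = [set x : V | forall i, [set` `]a ord0 i, b ord0 i[] (x ord0 i)].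
Proof. by apply/seteqP; split => x /= H i; have := H i; rewrite /= in_itv/=. Qed.

Lemma measurable_open_box (a b : V) : measurable (open_box a b).
Proof. rewrite open_boxE; apply: (@measurable_pi (fun i => [set` `]a ord0 i, b ord0 i[])) => i.
exact: measurable_itv. Qed.

Lemma open_boxI (a b c d : V) : open_box a b `&` open_box c d =
  open_box (\row_i Num.max (a ord0 i) (c ord0 i)) (\row_i Num.min (b ord0 i) (d ord0 i)).
Proof.
apply/seteqP; split => x /=.
  by move=> [H1 H2] i; rewrite !mxE gt_max lt_min; have /andP[-> ->] := H1 i; exact: H2.
by move=> H; split => i; have := H i; rewrite !mxE gt_max lt_min => /andP[/andP[h1 h2] /andP[h3 h4]]; apply/andP.
Qed.

Lemma lebesgue_open_box (a b : V) : lambda (open_box a b) =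
  (\prod_(i < N) (if (a ord0 i < b ord0 i)%R then (b ord0 i - a ord0 i)%R else 0%R)%:E)%E.
Proof.
rewrite open_boxE (@lebesgue_rV_box _ _ (fun i => [set` `]a ord0 i, b ord0 i[])); last first.
  by move=> i; exact: measurable_itv.
apply: eq_bigr => i _; rewrite lebesgue_measure_itv/= lte_fin.
by case: ifPn => //; rewrite EFinB.
Qed.

(** Uniqueness of measures on the pi-system of open boxes, where both measures are the same product
    of side lengths; the boxes ]-n, n[^N exhaust the space. *)
Lemma lebesgue_rV_translate (k : V) A : measurable A ->
  lambda ((fun y => y + k) @^-1` A) = lambda A.
Proof.
have mt : measurable_fun setT (fun y : V => y + k).
  apply: measurable_fun_rVP => i; under eq_fun do rewrite mxE.
  by apply: measurable_funD => //; exact: measurable_coord.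
move=> mA.
pose G : set (set V) := [set C | exists a b, C = open_box a b].
pose g (n : nat) : set V := open_box (const_mx (- n%:R)) (const_mx n%:R).
have boxE (a b : V) : pushforward lambda (fun y => y + k) (open_box a b) = lambda (open_box a b).
  rewrite /pushforward (_ : _ @^-1` _ = open_box (a - k) (b - k)); last first.
    apply/seteqP; split => y /= H i; have := H i; rewrite !mxE => /andP[? ?].
      by apply/andP; split; lra.
    by apply/andP; split; lra.
  rewrite !lebesgue_open_box; apply: eq_bigr => i _; rewrite !mxE ltrD2r.
  by case: ifPn => // _; congr (_%:E); ring.
have boxlty (a b : V) : (lambda (open_box a b) < +oo)%E.
  by rewrite lebesgue_open_box prodEFin ltry.
apply: (@measure_unique _ R V G g _ _ _ _ (pushforward lambda (fun y => y + k)) lambda) => //.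
- apply/seteqP; split; last first.
    apply: smallest_sub; first exact: sigma_algebra_measurable.
    by move=> _ [a [b ->]]; exact: measurable_open_box.
  apply: smallest_sub; first exact: smallest_sigma_algebra.
  move=> U oU; rewrite (open_bigcup_box oU) bigcup_mkcond.
  apply: (@countable_bigcupT_measurable _ (g_sigma_algebraType G)) => // i.
  by case: ifPn => // _; apply: sub_sigma_algebra; eexists; eexists.
- by move=> _ _ [a [b ->]] [c [e ->]]; rewrite open_boxI; eexists; eexists.
- by move=> n; eexists; eexists.
- apply/seteqP; split => // x _.
  exists (Num.truncn (\sum_i `|x ord0 i|)).+1 => // i; rewrite !mxE -ltr_norml.
  apply: le_lt_trans (truncnS_gt _); rewrite (bigD1 i)//= lerDl.
  by apply: sumr_ge0 => j _.
- by move=> _ [a [b ->]]; exact: boxE.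
- by move=> n; apply: le_lt_trans (boxlty (const_mx (- n%:R)) (const_mx n%:R)); rewrite -boxE.
Qed.

End lebesgue_rV_theory.

Section fibrewise_invariance.
Context {R : realType} d1 d2 (T1 : measurableType d1) (T2 : measurableType d2).
Variables (m1 : {measure set T1 -> \bar R}) (m2 : {sigma_finite_measure set T2 -> \bar R}).
Variable phi : T1 -> T2 -> T2.
Hypothesis mphi : measurable_fun setT (fun z : T1 * T2 => phi z.1 z.2).
Hypothesis phi_inv : forall x A, measurable A -> m2 (phi x @^-1` A) = m2 A.

Let S (z : T1 * T2) := (z.1, phi z.1 z.2).

Lemma measurable_fibre_map : measurable_fun setT S.
Proof. exact: measurable_fun_pair. Qed.

(** The section at x of the preimage is the preimage under [phi x] of the section at x, and the
    product measure integrates the measures of sections. *)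
Lemma product_measure_fibre_map C : measurable C ->
  (m1 \x m2)%E (S @^-1` C) = (m1 \x m2)%E C.
Proof.
move=> mC; apply: eq_integral => x _ /=.
by rewrite -(phi_inv x (measurable_xsection x mC)).
Qed.

Lemma ge0_integral_fibre_map D F : measurable D -> measurable_fun D F ->
  (forall z, D z -> (0 <= F z)%E) ->
  (\int[(m1 \x m2)%E]_(z in S @^-1` D) F (S z) = \int[(m1 \x m2)%E]_(z in D) F z)%E.
Proof.
move=> mD mF F0; rewrite -(ge0_integral_pushforward measurable_fibre_map (m1 \x m2)%E mD mF).
  apply: eq_measure_integral; first exact: measurable_fibre_map.
  by move=> ? A mA _; exact: product_measure_fibre_map.
by move=> z /[!inE]; exact: F0.
Qed.

End fibrewise_invariance.

(** * Integrals over a rectangle of functions of one factor *)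

Section product_integrals.
Context {R : realType} d1 d2 (T1 : measurableType d1) (T2 : measurableType d2).
Variables (m1 : {sigma_finite_measure set T1 -> \bar R}).
Variables (m2 : {sigma_finite_measure set T2 -> \bar R}).
Variables (A : set T1) (B : set T2).
Hypotheses (mA : measurable A) (mB : measurable B).

Lemma ge0_integral_prod_fst (h : T1 -> R) : measurable_fun setT h -> (forall x, 0 <= h x) ->
  (\int[(m1 \x m2)%E]_(z in A `*` B) (h z.1)%:E = m2 B * \int[m1]_(x in A) (h x)%:E)%E.
Proof.
move=> mh h0; rewrite integral_mkcond fubini_tonelli1; last 2 first.
- apply/(measurable_restrictT _ _).1; first exact: measurableX.
  by apply/measurable_EFinP/measurable_funTS; exact: measurableT_comp.
- by move=> z; rewrite erestrict_ge0// => ? _; rewrite lee_fin.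
rewrite [in RHS]integral_mkcond -ge0_integralZl//; last 2 first.
- apply/(measurable_restrictT _ _).1 => //.
  by apply/measurable_EFinP/measurable_funTS.
- by move=> x _; rewrite erestrict_ge0// => ? _; rewrite lee_fin.
apply: eq_integral => x _; rewrite /fubini_F [RHS]muleC.
rewrite (eq_integral (fun y => ((fun x => (h x)%:E) \_ A) x * (\1_B y)%:E)%E).
  rewrite ge0_integralZl//.
  - by rewrite integral_indic// setIT.
  - by apply/measurable_EFinP; exact: measurable_indic.
  - by rewrite erestrict_ge0// => ? _; rewrite lee_fin.
move=> y _; rewrite !patchE indicE in_setX /=.
by case: (x \in A) => /=; [case: (y \in B); rewrite ?mule1 ?mule0|rewrite mul0e].
Qed.

Lemma ge0_integral_prod_snd (h : T2 -> R) : measurable_fun setT h -> (forall x, 0 <= h x) ->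
  (\int[(m1 \x m2)%E]_(z in A `*` B) (h z.2)%:E = m1 A * \int[m2]_(y in B) (h y)%:E)%E.
Proof.
move=> mh h0; rewrite integral_mkcond fubini_tonelli1; last 2 first.
- apply/(measurable_restrictT _ _).1; first exact: measurableX.
  by apply/measurable_EFinP/measurable_funTS; exact: measurableT_comp.
- by move=> z; rewrite erestrict_ge0// => ? _; rewrite lee_fin.
have I0 : (0 <= \int[m2]_(y in B) (h y)%:E)%E.
  by apply: integral_ge0 => y _; rewrite lee_fin.
rewrite (eq_integral (fun x => (\1_A x)%:E * \int[m2]_(y in B) (h y)%:E)%E).
  rewrite ge0_integralZr ?integral_indic ?setIT//.
  by apply/measurable_EFinP; exact: measurable_indic.
move=> x _; rewrite /fubini_F indicE [in RHS]integral_mkcond.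
case: (boolP (x \in A)) => xA.
  by rewrite mul1e; apply: eq_integral => y _; rewrite !patchE in_setX /= xA.
by rewrite mul0e integral0_eq// => y _; rewrite patchE in_setX /= (negbTE xA).
Qed.

End product_integrals.

(** * Equidistribution on an interval *)

Section averaging.
Context {R : realType}.

Lemma lebesgue_itvco (a b : R) :
  @lebesgue_measure R [set t | a <= t < b] = (Num.max (b - a) 0)%:E.
Proof.
rewrite (_ : [set _ | _] = [set` `[a, b[]); last by apply/seteqP; split => t; rewrite /= in_itv.
rewrite lebesgue_measure_itv/= lte_fin; case: ifPn => ab; first by rewrite -EFinD (max_idPl _)//; lra.
by rewrite (max_idPr _)//; move: ab; rewrite -leNgt; lra.
Qed.

Lemma lebesgue_unit_lt (r : R) :
  @lebesgue_measure R [set t | (0 <= t <= 1) && (t < r)] = (Num.max (Num.min r 1) 0)%:E.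
Proof.
have [r1|r1] := leP r 1.
  rewrite -[in RHS](subr0 r) -lebesgue_itvco.
  by congr lebesgue_measure; apply/seteqP; split => t /=;
    [case/andP => /andP[? ?] ?; apply/andP|case/andP => ? ?; apply/andP; split => //; lra].
rewrite (_ : [set _ | _] = [set` `[0, 1]]).
  by rewrite lebesgue_measure_itv/= lte_fin ltr01 -EFinD subr0 (max_idPl _).
apply/seteqP; split => t /=; rewrite in_itv/=; first by case/andP.
by move=> /andP[? ?]; apply/andP; split; [apply/andP|lra].
Qed.

(** [lebesgue_frac_lt] covers the thresholds in [0, 1]. Outside this range the sequence is constant;
    such values of r do occur, since thresholds are arbitrary rationals. *)
Lemma cvg_lebesgue_frac (e : nat -> R) (a b r : R) : (forall n, 0 < e n) ->
  e n @[n --> \oo] --> 0 ->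
  fine (@lebesgue_measure R [set t | (a <= t < b) && (frac (t / e n) < r)]) @[n --> \oo] -->
  fine (@lebesgue_measure R [set t | a <= t < b]) *
  fine (@lebesgue_measure R [set t | (0 <= t <= 1) && (t < r)]).
Proof.
move=> e0 ec; rewrite lebesgue_itvco lebesgue_unit_lt /=.
have [ba|ab] := leP b a.
  rewrite (max_idPr _) ?mul0r; last by lra.
  apply: cvg_near_cst; apply: nearW => n.
  rewrite (_ : [set _ | _] = set0) ?measure0//; apply/seteqP; split => t //=.
  by case/andP => /andP[? ?] _; lra.
have [r0|r0] := leP r 0.
  rewrite [Num.max (Num.min _ _) _](max_idPr _) ?mulr0; last by rewrite ge_min r0.
  apply: cvg_near_cst; apply: nearW => n.
  rewrite (_ : [set _ | _] = set0) ?measure0//; apply/seteqP; split => t //=.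
  by case/andP => _; have := frac_ge0 (t / e n); lra.
have [r1|r1] := leP r 1; last first.
  rewrite [Num.max 1 0](max_idPl _) ?mulr1//.
  apply: cvg_near_cst; apply: nearW => n.
  rewrite (_ : [set _ | _] = [set t | a <= t < b]) ?lebesgue_itvco//.
  apply/seteqP; split => t /=; first by case/andP.
  by move=> ->; have := frac_lt1 (t / e n); lra.
rewrite !(max_idPl _); [|lra..].
apply/cvgrPdist_le => eta eta0; move/cvgrPdist_le : ec => /(_ (eta / 2)).
rewrite divr_gt0// => /(_ isT); apply: filterS => n; rewrite sub0r normrN gtr0_norm// => en.
rewrite distrC; apply: (le_trans (lebesgue_frac_lt (e0 n) (ltW ab) _)); last by lra.
by rewrite r1 ltW.
Qed.

End averaging.

(** * The microscopic map *)

Lemma cvg_prod_ord {R : realType} (N : nat) (f : 'I_N -> nat -> R) (l : 'I_N -> R) :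
  (forall i, f i n @[n --> \oo] --> l i) ->
  \prod_(i < N) f i n @[n --> \oo] --> \prod_(i < N) l i.
Proof.
move=> fl; elim: (index_enum _) => [|i s IH].
  rewrite big_nil (_ : (fun n => _) = fun=> 1); first exact: cvg_cst.
  by apply/funext => n; rewrite big_nil.
rewrite big_cons (_ : (fun n => _) = (fun n => f i n * \prod_(j <- s) f j n)).
  exact: cvgM.
by apply/funext => n; rewrite big_cons.
Qed.

Lemma Rintegral_natr {R : realType} d (X : measurableType d) (mu : {measure set X -> \bar R})
    (D : set X) (b : X -> bool) : measurable D -> measurable [set x | b x] ->
  \int[mu]_(x in D) (b x)%:R = fine (mu (D `&` [set x | b x])).
Proof.
move=> mD mb; rewrite /Rintegral setIC -integral_indic//; congr fine.
by apply: eq_integral => x _; rewrite -natr_indicE.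
Qed.

Section microscopic.
Context {R : realType} {N : nat} d (Omega : measurableType d).
Variables (P : probability Omega R) (T : 'rV[R]_N -> Omega -> Omega).
Hypothesis T_dyn : dynamical_system P T.
Local Notation V := 'rV[R]_N.
Local Notation lambda := (lebesgue_rV R N).
Local Notation W := (V * Omega * V)%type.

Definition frac_rV (y : V) : V := \row_i frac (y ord0 i).

Lemma measurable_frac_rV : measurable_fun setT frac_rV.
Proof.
apply: measurable_fun_rVP => i; under eq_fun do rewrite mxE.
by apply: (measurableT_comp measurable_frac); exact: measurable_coord.
Qed.

Lemma measurable_scale (c : R) : measurable_fun setT (fun x : V => c *: x).
Proof.
apply: measurable_fun_rVP => i; under eq_fun do rewrite mxE.
by apply: measurable_funM => //; exact: measurable_coord.
Qed.

(** The third component is reduced modulo 1 so that the image stays in a set of finite measure;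
    periodic functions do not see the difference. *)
Definition micro (eps : R) (z : V * Omega) : W :=
  (z.1, T (eps^-1 *: z.1) z.2, frac_rV ((eps ^+ 2)^-1 *: z.1)).

Lemma measurable_flow (c : R) : measurable_fun setT (fun z : V * Omega => T (c *: z.1) z.2).
Proof.
apply: (@measurableT_comp _ _ _ _ _ _ (fun z : V * Omega => T z.1 z.2) _
  (fun z : V * Omega => (c *: z.1, z.2))); first exact: dynsys_measurable T_dyn.
apply: measurable_fun_pair => //.
by apply: (measurableT_comp (measurable_scale c)).
Qed.

Let Pinv (c : R) (x : V) A : measurable A -> P (T (c *: x) @^-1` A) = P A.
Proof. exact: (dynsys_invariant T_dyn). Qed.

Lemma measurable_micro eps : measurable_fun setT (micro eps).
Proof.
apply: measurable_fun_pair.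
  by apply: measurable_fun_pair => //; exact: measurable_flow.
apply: (measurableT_comp measurable_frac_rV).
by apply: (measurableT_comp (measurable_scale _)).
Qed.

Lemma micro_invariant (c : R) A : measurable A ->
  (lambda \x P)%E ((fun z => (z.1, T (c *: z.1) z.2)) @^-1` A) = (lambda \x P)%E A.
Proof.
exact: (product_measure_fibre_map lambda (Pinv c)).
Qed.

Lemma ge0_integral_micro (c : R) D F : measurable D -> measurable_fun D F ->
  (forall z, D z -> (0 <= F z)%E) ->
  (\int[(lambda \x P)%E]_(z in (fun z => (z.1, T (c *: z.1) z.2)) @^-1` D)
     F (z.1, T (c *: z.1) z.2) = \int[(lambda \x P)%E]_(z in D) F z)%E.
Proof.
exact: (ge0_integral_fibre_map lambda (measurable_flow c) (Pinv c)).
Qed.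

Variable L : R.

(** Replaces [Q], an arbitrary bounded open set, by a set whose coordinates can be treated
    separately. *)
Definition qbox : set V := [set x | forall i, -L <= x ord0 i < L].

Lemma measurable_qbox : measurable qbox.
Proof.
rewrite (_ : qbox = [set x : V | forall i, [set` `[-L, L[] (x ord0 i)]).
  by apply: (@measurable_pi _ _ (fun=> [set` `[-L, L[])) => i; exact: measurable_itv.
by apply/seteqP; split => x /= H i; have := H i; rewrite /= in_itv.
Qed.

Lemma measurable_unit_cube : measurable (@unit_cube R N).
Proof.
rewrite (_ : unit_cube = [set x : V | forall i, [set` `[0, 1]] (x ord0 i)]).
  by apply: (@measurable_pi _ _ (fun=> [set` `[0, 1]])) => i; exact: measurable_itv.
by apply/seteqP; split => x /= H i; have := H i; rewrite /= in_itv.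
Qed.

Definition macro_dom : set (V * Omega) := qbox `*` setT.
Definition cell_dom : set W := macro_dom `*` unit_cube.

Lemma measurable_macro_dom : measurable macro_dom.
Proof. by apply: measurableX => //; exact: measurable_qbox. Qed.

Lemma measurable_cell_dom : measurable cell_dom.
Proof. by apply: measurableX; [exact: measurable_macro_dom|exact: measurable_unit_cube]. Qed.

Lemma micro_dom eps z : macro_dom z -> cell_dom (micro eps z).
Proof.
move=> [Qz _]; split => //= i; rewrite mxE frac_ge0/= ltW//; exact: frac_lt1.
Qed.

Lemma lebesgue_rV_lty (A : 'I_N -> set R) : (forall i, measurable (A i)) ->
  (forall i, (@lebesgue_measure R (A i) < +oo)%E) ->
  lambda [set x | forall i, A i (x ord0 i)] = (\prod_(i < N) fine (@lebesgue_measure R (A i)))%:E.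
Proof.
move=> mA Aoo; rewrite lebesgue_rV_box// -prodEFin; apply: eq_bigr => i _.
by rewrite fineK// ge0_fin_numE.
Qed.

Variable coord_Omega : nat -> Omega -> R.
Hypothesis mcoord : forall j, measurable_fun setT (coord_Omega j).

Definition coordinate (h : 'I_N + 'I_N + nat) (z : W) : R :=
  match h with
  | inl (inl i) => z.1.1 ord0 i
  | inl (inr i) => z.2 ord0 i
  | inr j => coord_Omega j z.1.2
  end.

Lemma measurable_coordinate h : measurable_fun setT (coordinate h).
Proof.
case: h => [[i|i]|j] /=.
- apply: (@measurableT_comp _ _ _ _ _ _ (fun x : V => x ord0 i)); first exact: measurable_coord.
  exact: measurableT_comp.
- apply: (@measurableT_comp _ _ _ _ _ _ (fun x : V => x ord0 i)) => //; exact: measurable_coord.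
- by apply: measurableT_comp => //; exact: measurableT_comp.
Qed.

(** Pairs of a coordinate and a rational are numbered by [pickle]; a number that codes no pair gives
    the whole space, neutral in [meet]. *)
Definition threshold (k : nat) (z : W) : bool :=
  oapp (fun p : ('I_N + 'I_N + nat) * rat => coordinate p.1 z < ratr p.2) true (unpickle k).

Lemma measurable_threshold k : measurable [set z | threshold k z].
Proof.
rewrite /threshold; case: unpickle => [[h q]|]/=; last first.
  by rewrite (_ : [set _ | _] = setT)//; apply/seteqP; split.
rewrite (_ : [set _ | _] = (coordinate h) @^-1` [set` `]-oo, ratr q[]); last first.
  by apply/seteqP; split => z; rewrite /= in_itv.
rewrite -[X in measurable X]setTI; apply: measurable_coordinate => //; exact: measurable_itv.
Qed.

Lemma meet_shape J : exists (a b : 'I_N -> R) (A : set Omega), measurable A /\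
  forall z, cell_dom z -> (meet threshold J z <->
    [/\ forall i, z.1.1 ord0 i < a i, A z.1.2 & forall i, z.2 ord0 i < b i]).
Proof.
elim: J => [|k J [a [b [A [mA IH]]]]].
  (* These bounds are no restriction: x_i < L in the half-open box, and y_i <= 1 < 2 in the closed
     unit cube. *)
  exists (fun=> L), (fun=> 2), setT; split => // z [[Qz _] Yz]; split => // _; split => // i.
    by have /andP[] := Qz i.
  by have /andP[_ /le_lt_trans->//] := Yz i; rewrite ltr1n.
rewrite /= /threshold; case: unpickle => [[[[i|i]|j] q]|]/=; last by exists a, b, A; split.
- exists (fun j => if j == i then Num.min (a j) (ratr q) else a j), b, A; split => // z Ez.
  split=> [/andP[zq /(IH z Ez)[h1 h2 h3]]|[h1 h2 h3]].
    by split => // j; case: eqP => // ->; rewrite lt_min h1.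
  apply/andP; split; first by have := h1 i; rewrite eqxx lt_min => /andP[].
  by apply/(IH z Ez); split => // j; have := h1 j; case: eqP => // _; rewrite lt_min => /andP[].
- exists a, (fun j => if j == i then Num.min (b j) (ratr q) else b j), A; split => // z Ez.
  split=> [/andP[zq /(IH z Ez)[h1 h2 h3]]|[h1 h2 h3]].
    by split => // j; case: eqP => // ->; rewrite lt_min h3.
  apply/andP; split; first by have := h3 i; rewrite eqxx lt_min => /andP[].
  by apply/(IH z Ez); split => // j; have := h3 j; case: eqP => // _; rewrite lt_min => /andP[].
- exists a, b, (A `&` coord_Omega j @^-1` [set` `]-oo, ratr q[]); split.
    apply: measurableI => //; rewrite -[X in measurable X]setTI; exact: mcoord.
  move=> z Ez; rewrite /= in_itv/=.
  split=> [/andP[zq /(IH z Ez)[h1 h2 h3]]|[h1 [h2 h2'] h3]]; first by split.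
  by apply/andP; split => //; apply/(IH z Ez); split.
Qed.

(** By [meet_shape] the preimage under [micro] is that of a rectangle under the measure-preserving
    map (x, w) |-> (x, T (x / eps) w), so P A factors out exactly for every n. What remains is a
    product over i of one-dimensional measures, each handled by [cvg_lebesgue_frac] at scale
    eps^2. *)
Lemma micro_mean (eps : nat -> R) : fundamental_sequence eps -> forall J,
  \int[(lambda \x P)%E]_(z in macro_dom) (meet threshold J (micro (eps n) z))%:R @[n --> \oo] -->
  (\int[((lambda \x P) \x lambda)%E]_(z in cell_dom) (meet threshold J z)%:R : R).
Proof.
move=> [eps01 eps0] J; have [a [b [A [mA shape]]]] := meet_shape J.
have mmeet : measurable [set z | meet threshold J z].
  elim: J {shape} => [|j J IH]/=.
    by rewrite (_ : [set _ | _] = setT)//; apply/seteqP; split.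
  rewrite (_ : [set _ | _] = [set z | threshold j z] `&` [set z | meet threshold J z]).
    by apply: measurableI => //; exact: measurable_threshold.
  by apply/seteqP; split => z /= /andP.
pose c i := Num.min L (a i).
pose G i := [set t : R | -L <= t < c i].
pose Gn n i := [set t : R | (-L <= t < c i) && (frac (t / eps n ^+ 2) < b i)].
pose C i := [set t : R | (0 <= t <= 1) && (t < b i)].
have mG i : measurable (G i).
  by rewrite (_ : G i = [set` `[-L, c i[]) //; apply/seteqP; split => t; rewrite /G /= in_itv.
have mC i : measurable (C i).
  rewrite (_ : C i = [set` `[0, 1]] `&` [set` `]-oo, b i[]).
    by apply: measurableI; exact: measurable_itv.
  by apply/seteqP; split => t; rewrite /C /= !in_itv/=; [case/andP|case=> -> ->].
have mGn n i : measurable (Gn n i).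
  rewrite (_ : Gn n i = G i `&` (fun t => frac (t / eps n ^+ 2)) @^-1` [set` `]-oo, b i[]).
    apply: measurableI => //; rewrite -[X in measurable X]setTI.
    have mf : measurable_fun setT (fun t : R => frac (t / eps n ^+ 2)).
      by apply: (measurableT_comp measurable_frac); exact: measurable_funM.
    by apply: mf => //; exact: measurable_itv.
  by apply/seteqP; split => t; rewrite /Gn /G /= in_itv/=; [case/andP|case=> -> ->].
have Goo i : (@lebesgue_measure R (G i) < +oo)%E by rewrite lebesgue_itvco ltry.
have Coo i : (@lebesgue_measure R (C i) < +oo)%E by rewrite lebesgue_unit_lt ltry.
have Gnoo n i : (@lebesgue_measure R (Gn n i) < +oo)%E.
  apply: le_lt_trans (Goo i); apply: le_measure.
  - by apply/mem_set; exact: mGn.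
  - by apply/mem_set; exact: mG.
  - by move=> t; rewrite /Gn /G /= => /andP[].
have EE : cell_dom `&` [set z | meet threshold J z] =
    ([set x : V | forall i, G i (x ord0 i)] `*` A) `*` [set y : V | forall i, C i (y ord0 i)].
  apply/seteqP; split => -[[x w] y] /=.
    move=> [Ez]; have [[/= Qx _] Yy] := Ez; move=> /(shape _ Ez)[/= h1 h2 h3].
    split; first split => // i.
      by rewrite /G /= /c lt_min h1; have /andP[-> ->] := Qx i.
    by move=> i; rewrite /C /= h3 andbT; exact: Yy.
  move=> [[h1 h2] h3].
  have Ez : cell_dom (x, w, y).
    split; first split => //= i; first by have := h1 i; rewrite /G /= /c lt_min => /and3P[-> ->].
    by move=> i /=; have := h3 i; rewrite /C /= => /andP[].
  split => //; apply/(shape _ Ez); split => //= i.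
    by have := h1 i; rewrite /G /= /c lt_min => /and3P[].
  by have := h3 i; rewrite /C /= => /andP[].
have DD n : macro_dom `&` [set z | meet threshold J (micro (eps n) z)] =
    (fun z => (z.1, T ((eps n)^-1 *: z.1) z.2)) @^-1`
      ([set x : V | forall i, Gn n i (x ord0 i)] `*` A).
  have fE (x : V) i : frac_rV ((eps n ^+ 2)^-1 *: x) ord0 i = frac (x ord0 i / eps n ^+ 2).
    by rewrite !mxE mulrC.
  apply/seteqP; split => -[x w] /=.
    move=> [Dz]; have := micro_dom (eps n) Dz => Ez /(shape _ Ez)[/= h1 h2 h3]; split => // i.
    have [/= Qx _] := Dz; have := h3 i; rewrite fE /Gn /= /c lt_min h1 => ->.
    by have /andP[-> ->] := Qx i.
  move=> [h1 h2].
  have Dz : macro_dom (x, w).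
    by split => //= i; have := h1 i; rewrite /Gn /= /c lt_min => /andP[/and3P[-> ->]].
  split => //; apply/(shape _ (micro_dom (eps n) Dz)); split => //= i.
    by have := h1 i; rewrite /Gn /= /c lt_min => /andP[/and3P[]].
  by rewrite fE; have := h1 i; rewrite /Gn /= => /andP[].
rewrite Rintegral_natr//; last exact: measurable_cell_dom.
have mGV := measurable_pi mG; have mCV := measurable_pi mC.
have lG := lebesgue_rV_lty mG Goo; have lC := lebesgue_rV_lty mC Coo.
have lGn n := lebesgue_rV_lty (mGn n) (Gnoo n).
have mV : (lambda \x P \x lambda)%E (cell_dom `&` [set z | meet threshold J z]) =
    ((\prod_(i < N) fine (@lebesgue_measure R (G i)))%:E * P A *
     (\prod_(i < N) fine (@lebesgue_measure R (C i)))%:E)%E.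
  rewrite EE [LHS]product_measure1E//; last exact: measurableX.
  by rewrite -lG -lC; congr (_ * _)%E; exact: product_measure1E.
rewrite [X in _ --> fine X]mV.
rewrite [X in X @ _ --> _](_ : _ = (fun n => (\prod_(i < N) fine (@lebesgue_measure R (Gn n i))) * fine (P A))).
  have PA : P A \is a fin_num by exact: fin_num_measure.
  rewrite -[P A]fineK// -!EFinM /= mulrAC -big_split/=.
  apply: cvgMl; apply: cvg_prod_ord => i; apply: cvg_lebesgue_frac.
    by move=> n; rewrite exprn_gt0//; have /andP[] := eps01 n.
  by rewrite -(mulr0 0); under eq_fun do rewrite expr2; exact: cvgM.
apply/funext => n; rewrite Rintegral_natr//; last 2 first.
- exact: measurable_macro_dom.
- rewrite (_ : [set _ | _] = micro (eps n) @^-1` [set z | meet threshold J z])//.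
  by rewrite -[X in measurable X]setTI; exact: measurable_micro.
have mGnV := measurable_pi (mGn n).
have nV : (lambda \x P)%E (macro_dom `&` [set z | meet threshold J (micro (eps n) z)]) =
    ((\prod_(i < N) fine (@lebesgue_measure R (Gn n i)))%:E * P A)%E.
  rewrite DD [LHS]micro_invariant; last exact: measurableX.
  by rewrite -lGn; exact: product_measure1E.
rewrite [X in fine X]nV fineM//; exact: fin_num_measure.
Qed.

End microscopic.

(** * Approximation of test functions *)

Section truncation.
Context {R : realType}.
Implicit Types M s t : R.

Definition truncation M t := Num.max (- M) (Num.min t M).

Lemma truncation_le M t : 0 <= M -> `|truncation M t| <= M.
Proof.
by move=> M0; rewrite ler_norml /truncation le_max lexx/= ge_max ge_min lexx orbT andbT; lra.
Qed.

Lemma truncation_id M t : `|t| <= M -> truncation M t = t.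
Proof. by rewrite ler_norml /truncation => /andP[t1 t2]; rewrite (min_idPl t2) (max_idPr t1). Qed.

Lemma truncation_lipschitz M s t : `|truncation M s - truncation M t| <= `|s - t|.
Proof.
rewrite ler_norml /truncation.
have := ler_norm (s - t); have := ler_norm (t - s); rewrite (distrC t s) => h1 h2.
case: (leP s M) => sM; case: (leP t M) => tM;
  repeat match goal with |- context[Num.max ?a ?b] => case: (leP a b) => ? end; apply/andP; split; lra.
Qed.

Lemma measurable_truncation d (X : measurableType d) M (f : X -> R) :
  measurable_fun setT f -> measurable_fun setT (fun x => truncation M (f x)).
Proof. by move=> mf; apply: measurable_maxr => //; exact: measurable_minr. Qed.

End truncation.

(** * Continuous functions on boxes *)

Section continuous_rV.
Context {R : realType} {N : nat}.
Local Notation V := 'rV[R]_N.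

Lemma measurable_continuous_rV (f : V -> R) : continuous f -> measurable_fun setT f.
Proof.
move=> /continuousP cf.
apply: (measurability _ (measurable_realfun.RGenOpens.measurableE R)).
move=> _ [_ [a [b ->] <-]]; rewrite setTI; apply: open_measurable_rV.
by apply: cf; exact: interval_open.
Qed.

(** Compactness makes the radii of continuity uniform, half of each radius being kept for the
    distance to y. Closeness is measured coordinatewise because that is what codes control. *)
Lemma heine_rV (K : set V) (f : V -> R) : compact K -> continuous f ->
  forall eta, 0 < eta -> exists2 delta : R, 0 < delta &
    forall x y : V, K x -> (forall i, `|x ord0 i - y ord0 i| < delta) -> `|f x - f y| <= eta.
Proof.
move=> /compact_near_coveringP cK cf eta eta0.
pose Q (delta : R) (x : V) := forall y : V, (forall i, `|x ord0 i - y ord0 i| < delta) -> `|f x - f y| <= eta.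
have H : \forall delta \near (0 : R)^'+, K `<=` Q delta.
  apply: cK => x Kx.
  have e2 : 0 < eta / 2 by rewrite divr_gt0.
  have /cvgrPdist_le /(_ _ e2) := cf x.
  rewrite -nbhs_ballE => -[rho /= rho0 xf].
  have r2 : 0 < rho / 2 by rewrite divr_gt0.
  exists (ball x (rho / 2), [set dl | dl < rho / 2]) => /=.
    split; first exact: nbhsx_ballx.
    exact: nbhs_right_lt.
  move=> [x' dl] [/= xx' dlr] y x'y.
  have f1 := xf x' _; have f2 := xf y _.
  have {}f1 : `|f x - f x'| <= eta / 2.
    by apply: f1; apply: le_ball xx'; lra.
  have {}f2 : `|f x - f y| <= eta / 2.
    apply: f2; case: xx' => _ xx'; split => // i j; rewrite ord1 -ball_normE /=.
    have := xx' ord0 j; rewrite -ball_normE /= => h1; have h2 := x'y j.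
    rewrite -(subrKA (x' ord0 j)); apply: le_lt_trans (ler_normD _ _) _; lra.
  rewrite -(subrKA (f x)) (le_trans (ler_normD _ _))// (distrC (f x')); lra.
have [delta [d0 dQ]] := filter_ex (filterI (nbhs_right_gt 0) H).
by exists delta => // x y Kx; exact: dQ.
Qed.

Lemma compact_box_rV (a b : R) : compact [set x : V | forall i, a <= x ord0 i <= b].
Proof.
rewrite (_ : [set _ | _] = [set x : V | forall i, [set` `[a, b]] (x ord0 i)]).
  by apply: (@rV_compact _ _ (fun=> [set` `[a, b]])) => i; exact: segment_compact.
by apply/seteqP; split => x /= H i; have := H i; rewrite /= in_itv.
Qed.

Lemma continuous_bounded_box (a b : R) (f : V -> R) : continuous f ->
  exists2 C : R, 0 < C & forall x : V, (forall i, a <= x ord0 i <= b) -> `|f x| <= C.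
Proof.
move=> cf.
have cI : compact (f @` [set x : V | forall i, a <= x ord0 i <= b]).
  by apply: continuous_compact; [exact: continuous_subspaceT|exact: compact_box_rV].
have [M [Mr MP]] := compact_bounded cI.
exists (`|M| + 1); first by rewrite ltr_pwDr.
move=> x xab; apply: MP; last by exists x.
by rewrite (le_lt_trans (ler_norm _))// ltrDl.
Qed.

End continuous_rV.

Section codes.
Context {R : realType} d (Z : measurableType d).
Variable B : nat -> Z -> bool.

Lemma code_le k l z z' : (k <= l)%N -> code B l z = code B l z' -> code B k z = code B k z'.
Proof. by move=> kl e; rewrite (code_take _ _ kl) e -code_take. Qed.

Lemma code_nth k j z z' : (j < k)%N -> code B k z = code B k z' -> B j z = B j z'.
Proof.
move=> jk /(congr1 (nth false ^~ j)).
by rewrite !(nth_map 0%N) ?size_iota// nth_iota.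
Qed.

Variable E : set Z.

(** Uniform continuity with respect to codes, which [step_approx] turns into uniform approximation
    by step functions. *)
Definition code_continuous (f : Z -> R) := forall eta, 0 < eta ->
  exists k, forall z z', E z -> E z' -> code B k z = code B k z' -> `|f z - f z'| <= eta.

Lemma code_continuousM (f g : Z -> R) (C : R) : 0 < C ->
  (forall z, E z -> `|f z| <= C) -> (forall z, E z -> `|g z| <= C) ->
  code_continuous f -> code_continuous g -> code_continuous (fun z => f z * g z).
Proof.
move=> C0 fC gC cf cg eta eta0.
have e0 : 0 < eta / (2 * C) by rewrite divr_gt0// mulr_gt0.
have [k kP] := cf _ e0; have [l lP] := cg _ e0.
exists (maxn k l) => z z' Ez Ez' e.
have := kP z z' Ez Ez' (code_le (leq_maxl k l) e).
have := lP z z' Ez Ez' (code_le (leq_maxr k l) e) => h1 h2.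
rewrite (_ : _ - _ = f z * (g z - g z') + (f z - f z') * g z'); last by ring.
apply: (le_trans (ler_normD _ _)); rewrite !normrM.
apply: (@le_trans _ _ (C * (eta / (2 * C)) + eta / (2 * C) * C)).
  by apply: lerD; apply: ler_pM => //; [exact: fC|exact: gC].
rewrite (_ : _ + _ = eta)//; field; lra.
Qed.

End codes.

Section approximable_theory.
Context {R : realType} dX (X : measurableType dX) dZ (Z : measurableType dZ).
Variables (nu : {measure set X -> \bar R}) (m : {measure set Z -> \bar R}).
Variables (D : set X) (mD : measurable D) (nuD : (nu D < +oo)%E).
Variables (E : set Z) (mE : measurable E) (mEoo : (m E < +oo)%E).
Variables (S : nat -> X -> Z) (mS : forall n, measurable_fun setT (S n)).
Hypothesis SE : forall n x, D x -> E (S n x).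
Variables (B : nat -> Z -> bool) (mB : forall j, measurable [set z | B j z]).

Lemma approximable0 : approximable nu m D E S B (fun=> 0).
Proof.
split; first exact: bounded_measurable_cst.
exists 0 => eta eta0; exists (fun=> 0); split.
- exact: step_cst.
- by move=> z _; rewrite subrr normr0.
- by move=> n; rewrite subrr normr0 (Rintegral_cst _ mD) mul0r ltW.
- by rewrite subrr normr0 (Rintegral_cst _ mE) mul0r ltW.
Qed.

Lemma approximableD f g : approximable nu m D E S B f -> approximable nu m D E S B g ->
  approximable nu m D E S B (fun z => f z + g z).
Proof.
move=> [bf [K fK]] [bg [L gL]].
have bfg : bounded_measurable E (fun z => f z + g z).
  have [[mf [C fC]] [mg [C' gC']]] := (bf, bg); split; first exact: measurable_funD.
  by exists (C + C') => z Ez; rewrite (le_trans (ler_normD _ _))// lerD ?fC ?gC'.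
have bB (p q : Z -> R) : bounded_measurable E p -> bounded_measurable E q ->
    bounded_measurable E (fun z => p z - q z).
  move=> [mp [C pC]] [mq [C' qC']]; split; first exact: measurable_funB.
  by exists (C + C') => z Ez; rewrite (le_trans (ler_normB _ _))// lerD ?pC ?qC'.
split => //; exists (K + L) => eta eta0; have e2 : 0 < eta / 2 by rewrite divr_gt0.
have [s [ss sK sn sm]] := fK _ e2; have [t [st tL tn tm]] := gL _ e2.
have sst : step B (fun z => s z + t z) by exact: (step_map2 (fun a b => a + b)).
have bs := step_bounded_measurable mB E ss; have bt := step_bounded_measurable mB E st.
have bst := step_bounded_measurable mB E sst.
have tri z : `|f z + g z - (s z + t z)| <= 1 * `|f z - s z| + `|g z - t z|.
  rewrite mul1r (_ : _ - _ = (f z - s z) + (g z - t z)); last by ring.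
  exact: ler_normD.
exists (fun z => s z + t z); split => //.
- move=> z Ez; apply: (le_trans (tri z)); rewrite mul1r lerD ?sK ?tL//.
- move=> n.
  have r1 := rintegrable_norm (bounded_measurable_rintegrable mD nuD
    (bounded_measurable_comp mS SE n (bB _ _ bf bs))).
  have r2 := rintegrable_norm (bounded_measurable_rintegrable mD nuD
    (bounded_measurable_comp mS SE n (bB _ _ bg bt))).
  have r3 := rintegrable_norm (bounded_measurable_rintegrable mD nuD
    (bounded_measurable_comp mS SE n (bB _ _ bfg bst))).
  apply: (@le_trans _ _ (1 * \int[nu]_(x in D) `|f (S n x) - s (S n x)| +
     \int[nu]_(x in D) `|g (S n x) - t (S n x)|)); last by have := sn n; have := tn n; lra.
  rewrite -Rintegral_comb//; apply: Rintegral_le => //; exact: rintegrable_comb.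
- have r1 := rintegrable_norm (bounded_measurable_rintegrable mE mEoo (bB _ _ bf bs)).
  have r2 := rintegrable_norm (bounded_measurable_rintegrable mE mEoo (bB _ _ bg bt)).
  have r3 := rintegrable_norm (bounded_measurable_rintegrable mE mEoo (bB _ _ bfg bst)).
  apply: (@le_trans _ _ (1 * \int[m]_(z in E) `|f z - s z| + \int[m]_(z in E) `|g z - t z|));
    last by lra.
  rewrite -Rintegral_comb//; apply: Rintegral_le => //; exact: rintegrable_comb.
Qed.

Lemma approximable_sum (n : nat) (f : 'I_n -> Z -> R) :
  (forall j, approximable nu m D E S B (f j)) ->
  approximable nu m D E S B (fun z => \sum_(j < n) f j z).
Proof.
move=> af; elim: (index_enum _) => [|j s IH].
  rewrite (_ : (fun z => _) = fun=> 0); first exact: approximable0.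
  by apply/funext => z; rewrite big_nil.
rewrite (_ : (fun z => _) = (fun z => f j z + \sum_(i <- s) f i z)).
  exact: approximableD.
by apply/funext => z; rewrite big_cons.
Qed.

End approximable_theory.

Section test_functions.
Context {R : realType} {N : nat} d (Omega : measurableType d).
Variables (P : probability Omega R) (T : 'rV[R]_N -> Omega -> Omega).
Hypothesis T_dyn : dynamical_system P T.
Local Notation V := 'rV[R]_N.
Local Notation lambda := (lebesgue_rV R N).
Local Notation W := (V * Omega * V)%type.
Variables (L : R) (L0 : 0 < L).
Variable coord_Omega : nat -> Omega -> R.
Hypothesis mcoord : forall j, measurable_fun setT (coord_Omega j).
Local Notation D := (@macro_dom R N d Omega L).
Local Notation E := (@cell_dom R N d Omega L).
Local Notation B := (@threshold R N d Omega coord_Omega).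
Local Notation coord := (@coordinate R N d Omega coord_Omega).

(* Two values of a truncated coordinate that are far apart are separated by one
   of finitely many rational thresholds, hence get different codes. *)
Lemma truncation_code_continuous h M : 0 <= M -> code_continuous B E (fun z => truncation M (coord h z)).
Proof.
move=> M0 eta eta0; pose dl := eta / 2.
have dl0 : 0 < dl by rewrite divr_gt0.
have qP (j : nat) : exists q : rat, - M + j%:R * dl < ratr q < - M + j.+1%:R * dl.
  have /rat_in_itvoo[q] : - M + j%:R * dl < - M + j.+1%:R * dl.
    by rewrite ltrD2l ltr_pM2r// ltr_nat.
  by rewrite in_itv/=; exists q.
have [q {}qP] := choice qP.
pose J := (Num.truncn (2 * M / dl)).+3.
exists (\max_(j < J) (pickle (h, q j)).+1)%N => z z' Ez Ez' e.
have sep (j : nat) : (j < J)%N -> (coord h z < ratr (q j)) = (coord h z' < ratr (q j)).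
  move=> jJ; have := code_nth (j := pickle (h, q j)) _ e.
  rewrite /threshold pickleK /=; apply.
  exact: (@leq_bigmax 'I_J (fun j => (pickle (h, q j)).+1) (Ordinal jJ)).
move: (coord h z) (coord h z') sep => a b sep {e Ez Ez'}.
wlog ab : a b sep / truncation M a <= truncation M b.
  move=> H; have [ab|/ltW ba] := leP (truncation M a) (truncation M b); first exact: H.
  by rewrite distrC; apply: H => // j jJ; rewrite sep.
rewrite leNgt; apply/negP; rewrite ler0_norm ?subr_le0// opprB => far.
pose a' := truncation M a; pose b' := truncation M b.
have := truncation_le a M0; have := truncation_le b M0; rewrite !ler_norml -/a' -/b'.
move=> /andP[b1 b2] /andP[a1 a2].
have x0 : 0 <= (a' + M) / dl by rewrite divr_ge0//; lra.
(* The grid cell after that of a'. As b' - a' > 2 dl, the rational q_j of this cell lies strictly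
   between a' and b'. *)
pose j := (Num.truncn ((a' + M) / dl)).+1.
have /andP[j1 j2] := truncn_itv x0.
have ja : a' < - M + j%:R * dl.
  by move: j2; rewrite ltr_pdivrMr// -/j; lra.
have jb : - M + j.+1%:R * dl < b'.
  move: j1; rewrite ler_pdivlMr// => j1; rewrite /j -!natr1.
  by move: far; rewrite -/a' -/b' /dl in j1 *; lra.
have jJ : (j < J)%N.
  rewrite /j /J !ltnS; apply: leq_trans (leqnSn _).
  by apply: le_truncn; rewrite ler_pM2r ?invr_gt0//; lra.
have /andP[q1 q2] := qP j; have := sep j jJ.
have aq : a < ratr (q j).
  rewrite ltNge; apply/negP => qa.
  have : Num.min (ratr (q j)) M <= a' by rewrite /a' /truncation le_max; apply/orP; right;
    rewrite le_min !ge_min qa lexx/= orbT.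
  by rewrite ge_min => /orP[]; lra.
have qb : ratr (q j) <= b.
  rewrite leNgt; apply/negP => bq.
  have : b' <= Num.max (- M) (ratr (q j)) 
    by rewrite /b' /truncation ge_max !le_max lexx/=; apply/orP; right; rewrite ge_min (ltW bq).
  by rewrite le_max => /orP[]; lra.
by rewrite aq ltNge qb.
Qed.

(** [pick] and [y] make the statement serve the macroscopic and the periodic variable alike.
    Truncation at [K] is the identity on the coordinates of [y], so codes control each of them. *)
Lemma continuous_code_continuous (K : R) (pick : 'I_N -> 'I_N + 'I_N + nat) (y : W -> V) (f : V -> R) :
  0 <= K -> (forall i z, coord (pick i) z = y z ord0 i) ->
  (forall z, E z -> forall i, `|y z ord0 i| <= K) ->
  continuous f -> code_continuous B E (fun z => f (y z)).
Proof.
move=> K0 py yK cf eta eta0.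
have [dl dl0 dlP] := heine_rV (@compact_box_rV _ _ (- K) K) cf eta0.
have d2 : 0 < dl / 2 by rewrite divr_gt0.
have [k kP] := choice (fun i => @truncation_code_continuous (pick i) K K0 _ d2).
exists (\max_(i < N) k i)%N => z z' Ez Ez' e.
apply: dlP => [i|i] /=; first by rewrite -ler_norml yK.
apply: (@le_lt_trans _ _ (dl / 2)); last by lra.
have := kP i z z' Ez Ez' (code_le (leq_bigmax i) e).
by rewrite !py !truncation_id ?yK.
Qed.

End test_functions.

(** The accounting for [approximable_product]: each of the two terms is at most eta / 2. *)
Lemma split_error {R : realFieldType} (eta A mass e : R) : 0 < A -> 0 < mass ->
  e <= eta / (2 * mass) -> A * (mass * (eta / (2 * A * mass))) + e * mass <= eta.
Proof.
move=> A0 mass0; rewrite ler_pdivlMr ?mulr_gt0// => h.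
rewrite (_ : A * _ = eta / 2); last by field; rewrite !gt_eqF.
lra.
Qed.

(** * Products of one function of each variable *)

Section test_product.
Context {R : realType} {N : nat} d (Omega : measurableType d).
Variables (P : probability Omega R) (T : 'rV[R]_N -> Omega -> Omega).
Hypothesis T_dyn : dynamical_system P T.
Local Notation V := 'rV[R]_N.
Local Notation lambda := (lebesgue_rV R N).
Local Notation W := (V * Omega * V)%type.
Variables (L : R) (L0 : 0 < L).
Variable coord_Omega : nat -> Omega -> R.
Hypothesis mcoord : forall j, measurable_fun setT (coord_Omega j).
Local Notation D := (@macro_dom R N d Omega L).
Local Notation E := (@cell_dom R N d Omega L).
Local Notation B := (@threshold R N d Omega coord_Omega).
Local Notation coord := (@coordinate R N d Omega coord_Omega).

Lemma measurable_mass : (lambda (qbox L) < +oo)%E /\ (lambda (@unit_cube R N) < +oo)%E.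
Proof.
have H (a b : R) (c1 c2 : bool) : (lambda [set x : V | forall i,
    [set` Interval (BSide c1 a) (BSide c2 b)] (x ord0 i)] < +oo)%E.
  have e : (@lebesgue_measure R [set` Interval (BSide c1 a) (BSide c2 b)] < +oo)%E.
    by rewrite lebesgue_measure_itv/= lte_fin; case: ifPn => _; rewrite ?ltry// -EFinB ltry.
  by rewrite [ltLHS](lebesgue_rV_lty (fun=> measurable_itv _) (fun=> e)) ltry.
split.
  rewrite (_ : qbox L = [set x : V | forall i, [set` `[-L, L[] (x ord0 i)]); first exact: H.
  by apply/seteqP; split => x /= Hx i; have := Hx i; rewrite /= in_itv.
rewrite (_ : unit_cube = [set x : V | forall i, [set` `[0, 1]] (x ord0 i)]); first exact: H.
by apply/seteqP; split => x /= Hx i; have := Hx i; rewrite /= in_itv.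
Qed.

Lemma macro_dom_lty : ((lambda \x P)%E D < +oo)%E.
Proof.
have [H _] := measurable_mass.
rewrite [X in (X < _)%E]product_measure1E//; last exact: measurable_qbox.
by rewrite [X in (_ * X < _)%E](@probability_setT _ _ _ P) mule1.
Qed.

Lemma cell_dom_lty : ((lambda \x P \x lambda)%E E < +oo)%E.
Proof.
have [_ H] := measurable_mass.
rewrite [X in (X < _)%E]product_measure1E//; last 2 first.
- exact: measurable_macro_dom.
- exact: measurable_unit_cube.
by apply: lte_mul_pinfty => //; rewrite ge0_fin_numE//; exact: macro_dom_lty.
Qed.

Let q1 := fine (lambda (qbox L)).
Let c1 := fine (lambda (@unit_cube R N)).

(** T preserves P, so the integral does not depend on eps: this makes the error on the stochastic
    factor uniform in n. *)
Lemma Rintegral_micro_Omega (eps : R) (h : Omega -> R) : measurable_fun setT h ->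
  (forall w, 0 <= h w) -> \int[(lambda \x P)%E]_(z in D) h (micro T eps z).1.2 = q1 * \int[P]_w h w.
Proof.
move=> mh h0; have [Hq _] := measurable_mass.
have mD := @measurable_macro_dom R N d Omega L.
have mh2 : measurable_fun D (fun z : V * Omega => (h z.2)%:E).
  by apply/measurable_EFinP/measurable_funTS; exact: measurableT_comp.
have mi z : D z -> (0 <= (h z.2)%:E)%E by rewrite lee_fin.
have e := ge0_integral_micro T_dyn (eps^-1) mD mh2 mi.
rewrite /Rintegral [X in fine X = _]e.
rewrite [X in fine X = _](ge0_integral_prod_snd lambda P (measurable_qbox L) measurableT mh h0).
have h1 : (0 <= \int[P]_w (h w)%:E)%E by apply: integral_ge0 => w _; rewrite lee_fin.
(* If [h] has an infinite integral, [fine] turns both sides into 0. *)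
have [->|hoo] := eqVneq (\int[P]_w (h w)%:E)%E +oo%E; last first.
  by rewrite fineM// ge0_fin_numE// ltey.
rewrite /= mulr0; have := measure_ge0 lambda (qbox L).
by rewrite le_eqVlt => /predU1P[<-|/gt0_muley->]//; rewrite mul0e.
Qed.

Let macro_measure : {sigma_finite_measure set (V * Omega)%type -> \bar R} :=
  HB.pack (lambda \x P)%E (Measure_isSigmaFinite.Build _ _ _ (lambda \x P)%E (sigma_finite_prod lambda P)).

Lemma Rintegral_cell_Omega (h : Omega -> R) : measurable_fun setT h ->
  (forall w, 0 <= h w) ->
  \int[(lambda \x P \x lambda)%E]_(z in E) h z.1.2 = c1 * (q1 * \int[P]_w h w).
Proof.
move=> mh h0; have [Hq Hc] := measurable_mass.
have mh2 : measurable_fun setT (fun z : V * Omega => h z.2) by exact: measurableT_comp.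
have e := ge0_integral_prod_fst macro_measure lambda (@measurable_macro_dom R N d Omega L)
  (@measurable_unit_cube R N) mh2 (fun z => h0 z.2).
have e2 := ge0_integral_prod_snd lambda P (measurable_qbox L) measurableT mh h0.
rewrite /Rintegral [X in fine X = _]e [X in fine (_ * X)%E]e2.
have h1 : (0 <= \int[P]_w (h w)%:E)%E by apply: integral_ge0 => w _; rewrite lee_fin.
have fq : lambda (qbox L) \is a fin_num by rewrite ge0_fin_numE.
have fc : lambda (@unit_cube R N) \is a fin_num by rewrite ge0_fin_numE.
have [->|hoo] := eqVneq (\int[P]_w (h w)%:E)%E +oo%E; last first.
  by rewrite !fineM ?fin_numM// ge0_fin_numE// ltey.
rewrite /= !mulr0 -(fineK fq) -(fineK fc).
have : 0 <= fine (lambda (qbox L)) by exact: fine_ge0.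
have : 0 <= fine (lambda (@unit_cube R N)) by exact: fine_ge0.
rewrite !le_eqVlt => /predU1P[<-|c0]; first by rewrite mul0e.
move=> /predU1P[<-|q0]; first by rewrite mul0e mule0.
by rewrite !gt0_muley ?lte_fin//; exact: ltry.
Qed.

(** With t the truncation of d_j at M, phi t psi is code continuous, hence uniformly close to a step
    function. Truncation fixes [g], as |g| <= M, so |g - t| <= |g - d_j|; it also makes the sup
    bound on the error independent of eta. *)
Lemma approximable_product (phi psi : V -> R) (g : Omega -> R) (M : R) (eps : nat -> R) : 0 < M ->
  continuous phi -> continuous psi -> measurable_fun setT g -> (forall w, `|g w| <= M) ->
  (forall eta, 0 < eta -> exists j, (\int[P]_w (`|g w - coord_Omega j w|)%:E <= eta%:E)%E) ->
  approximable (lambda \x P)%E (lambda \x P \x lambda)%E D E (fun n => micro T (eps n)) B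
    (fun z => phi z.1.1 * g z.1.2 * psi z.2).
Proof.
move=> M0 cphi cpsi mg gM gd.
have L00 : 0 <= L by exact: ltW.
have [C1 C10 C1P] := continuous_bounded_box (- L) L cphi.
have [C2 C20 C2P] := continuous_bounded_box 0 1 cpsi.
(* One constant for each factor and for the partial product phi t, since [code_continuousM] takes a
   common bound. *)
have [CC [CC0 CC1 CC2 CC3 CC4]] : exists CC, [/\ 0 < CC, C1 <= CC, C2 <= CC, M <= CC & C1 * M <= CC].
  have c1m : 0 < C1 * M by rewrite mulr_gt0.
  by exists (C1 + C2 + M + C1 * M); rewrite !addr_gt0//; split=> //; lra.
have phiC z : E z -> `|phi z.1.1| <= C1.
  move=> [[Qz _] _]; apply: C1P => i; have /andP[-> /ltW->]// := Qz i.
have psiC z : E z -> `|psi z.2| <= C2 by move=> [_ Yz]; exact: C2P.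
have mD := @measurable_macro_dom R N d Omega L.
have mE := @measurable_cell_dom R N d Omega L.
have DE n := @micro_dom R N d Omega T L (eps n).
have nuD := macro_dom_lty; have mEoo := cell_dom_lty.
have mB := @measurable_threshold R N d Omega coord_Omega mcoord.
have mS n := measurable_micro T_dyn (eps n).
have mphi : measurable_fun setT (fun z : W => phi z.1.1).
  by apply: (measurableT_comp (measurable_continuous_rV cphi)); exact: measurableT_comp.
have mpsi : measurable_fun setT (fun z : W => psi z.2).
  by apply: (measurableT_comp (measurable_continuous_rV cpsi)).
have mgz : measurable_fun setT (fun z : W => g z.1.2).
  by apply: (measurableT_comp mg); exact: measurableT_comp.
have prodC (x y w : R) : `|x| <= C1 -> `|y| <= M -> `|w| <= C2 -> `|x * y * w| <= C1 * M * C2.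
  by move=> h1 h2 h3; rewrite !normrM !ler_pM// mulr_ge0.
have bf : bounded_measurable E (fun z => phi z.1.1 * g z.1.2 * psi z.2).
  split; first by apply: measurable_funM => //; exact: measurable_funM.
  by exists (C1 * M * C2) => z Ez; apply: prodC; [exact: phiC|exact: gM|exact: psiC].
split => //; exists (2 * (C1 * M * C2) + 1) => eta eta0.
pose A := C1 * C2; have A0 : 0 < A by rewrite mulr_gt0.
have q10 : 0 <= q1 by exact: fine_ge0.
have c10 : 0 <= c1 by exact: fine_ge0.
(* Bounds the measures q1 of [D] and c1 q1 of [E]; the 1 makes it positive. *)
pose mass := q1 + c1 * q1 + 1.
have mass0 : 0 < mass by rewrite /mass ltr_pwDr// addr_ge0// mulr_ge0.
pose e1 := eta / (2 * A * mass); have e10 : 0 < e1 by rewrite divr_gt0// !mulr_gt0.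
pose e2 := Num.min 1 (eta / (2 * mass)).
have e20 : 0 < e2 by rewrite lt_min ltr01 divr_gt0// mulr_gt0.
have [j jP] := gd e1 e10.
pose t w := truncation M (coord_Omega j w).
have mt : measurable_fun setT t by exact: measurable_truncation.
have tM w : `|t w| <= M by apply: truncation_le; exact: ltW.
have ucc1 : code_continuous B E (fun z => phi z.1.1).
  apply: (continuous_code_continuous (K := L) (pick := fun i => inl (inl i)) (y := fun z : W => z.1.1)) => //.
  by move=> z [[Qz _] _] i; rewrite ler_norml; have /andP[-> /ltW->] := Qz i.
have ucc2 : code_continuous B E (fun z => psi z.2).
  apply: (continuous_code_continuous (K := 1) (pick := fun i => inl (inr i)) (y := fun z : W => z.2)) => //.
  by move=> z [_ Yz] i; have /andP[y0 y1] := Yz i; rewrite ger0_norm.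
have ucct : code_continuous B E (fun z => t z.1.2).
  exact: (truncation_code_continuous L coord_Omega (inr j) (ltW M0)).
have ucc : code_continuous B E (fun z => phi z.1.1 * t z.1.2 * psi z.2).
  apply: (code_continuousM (C := CC)) => //.
  - by move=> z Ez; rewrite normrM; apply: le_trans CC4; rewrite ler_pM// phiC.
  - by move=> z Ez; exact: (le_trans (psiC _ Ez)).
  - apply: (code_continuousM (C := CC)) => //.
    + by move=> z Ez; exact: (le_trans (phiC _ Ez)).
    + by move=> z Ez; exact: (le_trans (tM _)).
have [k kP] := ucc _ e20.
have [s ss sP] := step_approx kP.
have key z : E z -> `|phi z.1.1 * g z.1.2 * psi z.2 - s z| <= A * `|g z.1.2 - t z.1.2| + e2.
  move=> Ez; rewrite (_ : _ - _ = phi z.1.1 * psi z.2 * (g z.1.2 - t z.1.2) +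
    (phi z.1.1 * t z.1.2 * psi z.2 - s z)); last by ring.
  apply: (le_trans (ler_normD _ _)); apply: lerD; last exact: sP.
  by rewrite normrM ler_wpM2r// normrM ler_pM// ?phiC ?psiC.
pose h w := `|g w - t w|.
have mh : measurable_fun setT h by apply: measurableT_comp => //; exact: measurable_funB.
have h0 w : 0 <= h w by exact: normr_ge0.
have hM w : `|h w| <= 2 * M.
  by rewrite normr_id (le_trans (ler_normB _ _))// mulr_natl mulr2n lerD.
have Ih : \int[P]_w h w <= e1.
  rewrite -lee_fin Rintegral_EFin//; last first.
    apply: bounded_measurable_rintegrable => //.
      by rewrite [ltLHS](@probability_setT _ _ _ P) ltry.
    by split => //; exists (2 * M).
  apply: le_trans jP; apply: ge0_le_integral => //.
  - by move=> w _; rewrite lee_fin.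
  - by apply/measurable_EFinP.
  - by apply/measurable_EFinP; apply: measurableT_comp => //; exact: measurable_funB.
  - move=> w _; rewrite lee_fin /h /t -{1}(truncation_id (gM w)).
    exact: truncation_lipschitz.
have bh : bounded_measurable E (fun z => h z.1.2).
  split; last by exists (2 * M) => z _; exact: hM.
  by apply: (measurableT_comp mh); exact: measurableT_comp.
have bs := step_bounded_measurable mB E ss.
have bfs : bounded_measurable E (fun z => `|phi z.1.1 * g z.1.2 * psi z.2 - s z|).
  have [[mf [K1 K1P]] [ms [K2 K2P]]] := (bf, bs); split.
    by apply: measurableT_comp => //; exact: measurable_funB.
  by exists (K1 + K2) => z Ez; rewrite normr_id (le_trans (ler_normB _ _))// lerD ?K1P ?K2P.
have fin : A * (mass * e1) + e2 * mass <= eta.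
  by apply: split_error => //; rewrite /e2 ge_min lexx orbT.
have bound (y : R) (q : R) : 0 <= q -> q <= mass -> y <= A * (q * \int[P]_w h w) + e2 * q -> y <= eta.
  move=> q0 qm yb; apply: (le_trans yb); apply: (le_trans _ fin); apply: lerD.
    rewrite ler_wpM2l ?(ltW A0)// ler_pM//; exact: Rintegral_ge0.
  by rewrite ler_wpM2l// ltW.
have mD1 : fine ((lambda \x P)%E D) = q1.
  rewrite [X in fine X = _]product_measure1E//; last exact: measurable_qbox.
  by rewrite [X in (_ * X)%E](@probability_setT _ _ _ P) mule1.
have mE1 : fine ((lambda \x P \x lambda)%E E) = c1 * q1.
  rewrite [X in fine X = _]product_measure1E//; last exact: measurable_unit_cube.
  have [Hq Hc] := measurable_mass.
  rewrite fineM; last 2 first.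
  - by rewrite ge0_fin_numE//; exact: macro_dom_lty.
  - by rewrite ge0_fin_numE.
  by rewrite mD1 mulrC.
exists s; split => //.
- move=> z Ez; apply: (le_trans (ler_normB _ _)).
  have f1 : `|phi z.1.1 * g z.1.2 * psi z.2| <= C1 * M * C2 by apply: prodC; [exact: phiC|exact: gM|exact: psiC].
  have f2 : `|phi z.1.1 * t z.1.2 * psi z.2| <= C1 * M * C2 by apply: prodC; [exact: phiC|exact: tM|exact: psiC].
  have f3 := sP z Ez; have f4 : e2 <= 1 by rewrite /e2 ge_min lexx.
  have : `|s z| <= `|phi z.1.1 * t z.1.2 * psi z.2| + `|phi z.1.1 * t z.1.2 * psi z.2 - s z|.
    by rewrite -{1}(subKr (phi z.1.1 * t z.1.2 * psi z.2) (s z)) ler_normB.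
  lra.
- move=> n; apply: (bound _ q1) => //; first by rewrite /mass -addrA lerDl addr_ge0// mulr_ge0.
  rewrite -(Rintegral_micro_Omega (eps n))// -mD1.
  have r1 := bounded_measurable_rintegrable mD nuD (bounded_measurable_comp mS DE n bh).
  have r2 := bounded_measurable_rintegrable mD nuD (bounded_measurable_comp mS DE n bfs).
  have r3 := bounded_measurable_rintegrable mD nuD (bounded_measurable_cst D e2).
  rewrite -(Rintegral_cst _ mD) -Rintegral_comb//; apply: Rintegral_le => //.
    exact: rintegrable_comb.
  by move=> z Dz; apply: key; exact: DE.
- apply: (bound _ (c1 * q1)); first by rewrite mulr_ge0.
    by rewrite /mass; lra.
  rewrite -[c1 * q1 * _]mulrA -Rintegral_cell_Omega// -mE1.
  have r1 := bounded_measurable_rintegrable mE mEoo bh.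
  have r2 := bounded_measurable_rintegrable mE mEoo bfs.
  have r3 := bounded_measurable_rintegrable mE mEoo (bounded_measurable_cst E e2).
  rewrite -(Rintegral_cst _ mE) -Rintegral_comb//; apply: Rintegral_le => //.
    exact: rintegrable_comb.
Qed.

End test_product.

(** * Luxemburg norms *)

Section luxemburg_theory.
Context {R : realType} (Phi : R -> R) (young : young_function Phi).
Context d (X : measurableType d) (mu : {measure set X -> \bar R}).
Variables (D : set X) (mD : measurable D).
Local Notation modular := (modular mu D Phi).
Local Notation orlicz := (orlicz mu D Phi).
Local Notation luxemburg := (luxemburg mu D Phi).

Lemma measurable_young_norm (u : X -> R) delta : 0 < delta -> measurable_fun D u ->
  measurable_fun D (fun x => (Phi (`|u x| / delta))%:E).
Proof.
move=> d0 mu_u; apply/measurable_EFinP; apply: measurable_young => // [|x].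
  by apply: measurable_funM => //; exact: measurableT_comp.
by rewrite divr_ge0// ltW.
Qed.

Lemma young_norm_ge0 (u : X -> R) delta x : 0 < delta -> (0 <= (Phi (`|u x| / delta))%:E)%E.
Proof. by move=> d0; rewrite lee_fin (young_ge0 young)// divr_ge0// ltW. Qed.

Lemma modular_ge0 (u : X -> R) delta : 0 < delta -> (0 <= modular delta u)%E.
Proof. by move=> d0; apply: integral_ge0 => x _; exact: young_norm_ge0. Qed.

(** Convexity and Phi 0 = 0 give Phi (a t) <= a Phi t for a in [0, 1]. *)
Lemma modular_le (u : X -> R) delta delta' : measurable_fun D u -> 0 < delta ->
  delta <= delta' -> (modular delta' u <= (delta / delta')%:E * modular delta u)%E.
Proof.
move=> mu_u d0 dd; have d0' : 0 < delta' by exact: lt_le_trans dd.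
have a0 : 0 <= delta / delta' by rewrite divr_ge0// ltW.
rewrite -ge0_integralZl//; last 2 first.
- exact: measurable_young_norm.
- by move=> x _; exact: young_norm_ge0.
apply: ge0_le_integral => //.
- by move=> x _; exact: young_norm_ge0.
- exact: measurable_young_norm.
- by apply: measurable_funeM; exact: measurable_young_norm.
- move=> x _; rewrite -EFinM lee_fin (_ : `|u x| / delta' = delta / delta' * (`|u x| / delta)).
    by apply: young_scale => //; rewrite ?ler_pdivrMr ?mul1r// divr_ge0// ltW.
  by field; rewrite !gt_eqF.
Qed.

Lemma orlicz_modular_le1 u : orlicz u -> exists2 delta, 0 < delta & (modular delta u <= 1)%E.
Proof.
move=> [mu_u [delta d0 h]]; have M0 := modular_ge0 u d0.
move: M0 h (@modular_le u delta); case: (modular delta u) => [M| |]// + _ H.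
rewrite lee_fin => M0; have M1 : 0 < M + 1 by lra.
exists (delta * (M + 1)); first by rewrite mulr_gt0.
apply: (le_trans (H _ mu_u d0 _)); first by rewrite ler_pMr//; lra.
rewrite -EFinM lee_fin (_ : delta / _ * M = M / (M + 1)); last by field; rewrite !gt_eqF.
by rewrite ler_pdivrMr//; lra.
Qed.

(** The strict inequality provides an admissible delta < c, from which [modular_le] passes to c;
    whether the infimum is attained never comes up. *)
Lemma luxemburg_lt_modular u c : orlicz u -> luxemburg u < c -> 0 < c /\ (modular c u <= 1)%E.
Proof.
move=> ou /inf_lt[|delta [d0 d1] dc].
  by have [delta d0 d1] := orlicz_modular_le1 ou; exists delta.
have c0 : 0 < c by exact: lt_trans dc.
split => //; apply: (le_trans (modular_le ou.1 d0 (ltW dc))).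
apply: (@le_trans _ _ ((delta / c)%:E * 1)%E).
  by rewrite lee_wpmul2l// lee_fin divr_ge0// ltW.
by rewrite mule1 lee_fin ler_pdivrMr// mul1r ltW.
Qed.

Lemma orliczB u v : orlicz u -> orlicz v -> orlicz (u - v).
Proof.
move=> ou ov; have [delta1 d10 h1] := orlicz_modular_le1 ou.
have [delta2 d20 h2] := orlicz_modular_le1 ov.
split; first by apply: measurable_funB; [exact: ou.1|exact: ov.1].
have m1 := measurable_young_norm d10 ou.1; have m2 := measurable_young_norm d20 ov.1.
have s0 : 0 < delta1 + delta2 by exact: addr_gt0.
exists (delta1 + delta2) => //.
have muv : measurable_fun D (u - v) by apply: measurable_funB; [exact: ou.1|exact: ov.1].
apply: (@le_lt_trans _ _ (\int[mu]_(x in D)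
   ((Phi (`|u x| / delta1))%:E + (Phi (`|v x| / delta2))%:E))%E).
  apply: ge0_le_integral => //.
  - by move=> x _; exact: young_norm_ge0.
  - exact: measurable_young_norm.
  - exact: emeasurable_funD.
  move=> x _; rewrite -EFinD lee_fin.
  have p1 : 0 <= `|u x| / delta1 by rewrite divr_ge0// ltW.
  have p2 : 0 <= `|v x| / delta2 by rewrite divr_ge0// ltW.
  (* (|u| + |v|) / (delta1 + delta2) is the convex combination of |u| / delta1 and |v| / delta2 with
     weight a on the former. *)
  pose a := delta1 / (delta1 + delta2).
  have a0 : 0 <= a by rewrite divr_ge0// ltW.
  have a1 : a <= 1 by rewrite ler_pdivrMr// mul1r lerDl ltW.
  apply: (@le_trans _ _ (a * Phi (`|u x| / delta1) + (1 - a) * Phi (`|v x| / delta2))).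
    apply: le_trans (young_conv young a0 a1 p1 p2); apply: young_le => //.
      by rewrite divr_ge0// ltW.
    rewrite (_ : a * _ + _ = (`|u x| + `|v x|) / (delta1 + delta2)); last first.
      by rewrite /a; field; rewrite !gt_eqF.
    by rewrite ler_pM2r ?invr_gt0// ler_normB.
  by apply: lerD; rewrite ler_piMl ?(young_ge0 young)//; lra.
rewrite ge0_integralD//; last 2 first.
- by move=> x _; exact: young_norm_ge0.
- by move=> x _; exact: young_norm_ge0.
by apply: (@le_lt_trans _ _ (1 + 1)%E); [exact: leeD|rewrite -EFinD ltry].
Qed.

Hypothesis muD : (mu D < +oo)%E.

(** On a set of finite measure the Luxemburg norm controls the L^1 norm: integrate |u| <= c K + c
    Phi (|u| / c). The value c = eta / (K mu (D) + 1) makes the sum equal to eta. *)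
Lemma modular_integral_le eta : 0 < eta -> exists2 c, 0 < c & forall u, measurable_fun D u ->
  (modular c u <= 1 -> \int[mu]_(x in D) (`|u x|)%:E <= eta%:E)%E.
Proof.
move=> eta0; have [K K0 KP] := young_bound young ltr01.
have fD : mu D \is a fin_num by rewrite ge0_fin_numE.
have q0 : 0 <= fine (mu D) by exact: fine_ge0.
have t0 : 0 < K * fine (mu D) + 1 by rewrite ltr_wpDl// mulr_ge0// ltW.
pose c := eta / (K * fine (mu D) + 1); have c0 : 0 < c by rewrite divr_gt0.
exists c => // u mu_u u1.
apply: (@le_trans _ _ (\int[mu]_(x in D) ((c * K)%:E + c%:E * (Phi (`|u x| / c))%:E))%E).
  apply: ge0_le_integral => //.
  - by apply/measurable_EFinP; exact: measurableT_comp.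
  - apply: emeasurable_funD => //; apply: measurable_funeM; exact: measurable_young_norm.
  move=> x _; rewrite -EFinM -EFinD lee_fin -mulrDr mulrC -ler_pdivrMr//.
  by rewrite -[Phi _]mul1r; apply: KP; rewrite divr_ge0// ltW.
have cPhi0 x : (0 <= c%:E * (Phi (`|u x| / c))%:E)%E.
  by rewrite mule_ge0 ?lee_fin ?(ltW c0)// (young_ge0 young)// divr_ge0// ltW.
rewrite ge0_integralD//; last 2 first.
- by move=> x _; rewrite lee_fin mulr_ge0// ltW.
- by apply: measurable_funeM; exact: measurable_young_norm.
rewrite integral_cst// ge0_integralZl//; last 3 first.
- exact: measurable_young_norm.
- by move=> x _; exact: young_norm_ge0.
- by rewrite lee_fin ltW.
rewrite -(fineK fD) -EFinM.
apply: (@le_trans _ _ ((c * K * fine (mu D))%:E + c%:E * 1)%E).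
  by apply: leeD => //; rewrite lee_wpmul2l// lee_fin ltW.
rewrite mule1 -EFinD lee_fin (_ : _ + c = c * (K * fine (mu D) + 1)); last by ring.
by rewrite /c divfK// gt_eqF.
Qed.

(** The countable dense set becomes a sequence through its injection into the integers, indices
    outside the image receiving 0. Density is recorded in L^1, the form in which test functions are
    approximated. *)
Lemma separable_dense_sequence : separable_space orlicz luxemburg ->
  exists2 c : nat -> X -> R, forall j, measurable_fun D (c j) &
    forall g eta, orlicz g -> 0 < eta ->
      exists j, (\int[mu]_(x in D) (`|g x - c j x|)%:E <= eta%:E)%E.
Proof.
move=> [A [/countable_injP[i iinj] AL dense]].
have cP j : exists f : X -> R, measurable_fun D f /\
    forall v, A v -> i v = j -> f = v.
  have [[v [Av ij]]|no] := pselect (exists v, A v /\ i v = j).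
    exists v; split; first exact: (AL v Av).1.
    by move=> w Aw iw; apply: iinj; rewrite ?inE// ij iw.
  by exists (fun=> 0); split => // v Av ij; exfalso; apply: no; exists v.
have [c {}cP] := choice cP; exists c => [j|g eta og eta0]; first exact: (cP j).1.
have [e e0 eP] := modular_integral_le eta0.
have [v Av gv] := dense g e og e0.
exists (i v); rewrite ((cP (i v)).2 v Av erefl).
have ogv := orliczB og (AL v Av).
apply: (eP (g - v)); first exact: ogv.1.
by have [] := luxemburg_lt_modular ogv gv.
Qed.

End luxemburg_theory.

(** * Periodic extension *)

Lemma bounded_set_box {R : realType} {N : nat} (A : set 'rV[R]_N) : bounded_set A ->
  exists2 L : R, 0 < L & forall x, A x -> forall i, `|x ord0 i| <= L.
Proof.
move=> [M [Mr MP]]; exists (`|M| + 1); first by rewrite ltr_pwDr.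
move=> x Ax i; have : `|x| <= `|M| + 1.
  by apply: MP => //; rewrite (le_lt_trans (ler_norm _))// ltrDl.
apply: le_trans; rewrite [leRHS]mx_normrE; exact: (le_bigmax _ (fun ij => `|x ij.1 ij.2|) (ord0, i)).
Qed.

Section finite_unions.
Context {R : realType} d (X : measurableType d) (mu : {measure set X -> \bar R}).
Variables (f : X -> \bar R) (mf : measurable_fun setT f) (f0 : forall x, (0 <= f x)%E).

Lemma ge0_integral_setU_lty A B : measurable A -> measurable B ->
  (\int[mu]_(x in A) f x < +oo)%E -> (\int[mu]_(x in B) f x < +oo)%E ->
  (\int[mu]_(x in A `|` B) f x < +oo)%E.
Proof.
move=> mA mB IA IB; have mBA : measurable (B `\` A) by exact: measurableD.
rewrite (_ : A `|` B = A `|` (B `\` A)); last by rewrite setDE setUIr setUv setIT.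
rewrite ge0_integral_setU//; last 2 first.
- exact: measurable_funTS.
- by apply/eqP; rewrite setDE setIC -setIA setICl setI0.
apply: lte_add_pinfty => //; apply: le_lt_trans IB; apply: ge0_subset_integral => //.
exact: measurable_funTS.
Qed.

Lemma ge0_integral_bigsetU_lty (I : Type) (s : seq I) (A : I -> set X) :
  (forall i, measurable (A i)) -> (forall i, (\int[mu]_(x in A i) f x < +oo)%E) ->
  (\int[mu]_(x in \big[setU/set0]_(i <- s) A i) f x < +oo)%E.
Proof.
move=> mA IA; elim: s => [|i s IH]; first by rewrite big_nil integral_set0 ltry.
by rewrite big_cons; apply: ge0_integral_setU_lty => //; exact: bigsetU_measurable.
Qed.

End finite_unions.

Section periodic_extension.
Context {R : realType} {N : nat} d (X : measurableType d) (m1 : {measure set X -> \bar R}).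
Local Notation V := 'rV[R]_N.
Local Notation lambda := (lebesgue_rV R N).

(** The fundamental domain of the integer lattice, where fractional parts land; it differs from
    [unit_cube] by a null set. *)
Definition half_open_cube : set V := [set y | forall i, 0 <= y ord0 i < 1].

Lemma measurable_half_open_cube : measurable half_open_cube.
Proof.
rewrite (_ : half_open_cube = [set x : V | forall i, [set` `[0, 1[] (x ord0 i)]).
  by apply: (@measurable_pi _ _ (fun=> [set` `[0, 1[])) => i; exact: measurable_itv.
by apply/seteqP; split => x /= H i; have := H i; rewrite /= in_itv.
Qed.

Lemma half_open_cube_subset : half_open_cube `<=` @unit_cube R N.
Proof. by move=> y y01 i; have /andP[-> /ltW->] := y01 i. Qed.

Lemma lebesgue_cube_boundary : lambda (@unit_cube R N `\` half_open_cube) = 0%E.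
Proof.
have unit (c : bool) : lambda [set x : V | forall i, [set` Interval (BLeft 0) (BSide c 1)] (x ord0 i)] = 1%E.
  rewrite [LHS](lebesgue_rV_box (fun=> measurable_itv _)) big1// => i _.
  by rewrite [LHS]lebesgue_measure_itv/= lte_fin ltr01 oppr0 adde0.
have e1 : lambda (@unit_cube R N) = 1%E by exact: (unit false).
have e2 : lambda half_open_cube = 1%E by exact: (unit true).
rewrite [LHS]measureD; [|exact: measurable_unit_cube|exact: measurable_half_open_cube|].
  by rewrite (setIidr half_open_cube_subset) [X in (X - _)%E]e1 [X in (_ - X)%E]e2 -EFinB subrr.
by rewrite [X in (X < _)%E]e1 ltry.
Qed.

Lemma frac_rVDz (y : V) (k : 'rV[int]_N) : frac_rV (y + map_mx intr k) = frac_rV y.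
Proof. by apply/rowP => i; rewrite !mxE fracDz. Qed.

Lemma frac_rV_id (y : V) : half_open_cube y -> frac_rV y = y.
Proof. by move=> y01; apply/rowP => i; rewrite mxE frac_id. Qed.

Lemma frac_rV_cube (y : V) : half_open_cube (frac_rV y).
Proof. by move=> i; rewrite mxE frac_ge0 frac_lt1. Qed.

Lemma frac_rVE (y : V) : frac_rV y = y + map_mx intr (\row_i (- Num.floor (y ord0 i))).
Proof. by apply/rowP => i; rewrite !mxE mulrNz. Qed.

Variable h : X * V -> R.
Hypotheses (mh : measurable_fun setT h) (h0 : forall z, 0 <= h z).
Hypothesis h_per : forall x, Y_periodic (fun y => h (x, y)).
Variables (A : set X) (mA : measurable A).
Hypothesis h_cube : (\int[(m1 \x lambda)%E]_(z in A `*` half_open_cube) (h z)%:E < +oo)%E.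

Let tile (k : 'rV[int]_N) := [set y : V | half_open_cube (y + map_mx intr k)].

Let mtranslate (k : 'rV[int]_N) : measurable_fun setT (fun y : V => y + map_mx intr k).
Proof.
apply: measurable_fun_rVP => i; under eq_fun do rewrite mxE.
by apply: measurable_funD => //; exact: measurable_coord.
Qed.

Let mtile k : measurable (tile k).
Proof. by rewrite -[X in measurable X]setTI; apply: mtranslate => //; exact: measurable_half_open_cube. Qed.

Let tile_lty k : (\int[(m1 \x lambda)%E]_(z in A `*` tile k) (h z)%:E < +oo)%E.
Proof.
have mp : measurable_fun setT (fun z : X * V => z.2 + map_mx intr k).
  by apply: (measurableT_comp (mtranslate k)).
have mD : measurable (A `*` half_open_cube) by apply: measurableX => //; exact: measurable_half_open_cube.
have mhE : measurable_fun (A `*` half_open_cube) (fun z => (h z)%:E).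
  by apply/measurable_EFinP; exact: measurable_funTS.
have inv (x : X) (C : set V) : measurable C ->
    lambda ((fun y : V => y + map_mx intr k) @^-1` C) = lambda C by exact: lebesgue_rV_translate.
have hE0 z : (A `*` half_open_cube) z -> (0 <= (h z)%:E)%E by rewrite lee_fin.
have e := ge0_integral_fibre_map (phi := fun (_ : X) (y : V) => y + map_mx intr k)
  m1 mp inv mD mhE hE0.
apply: le_lt_trans h_cube; rewrite -[leRHS]e.
rewrite le_eqVlt; apply/orP; left; apply/eqP; apply: eq_integral => -[x y] _ /=.
by rewrite (h_per x k y).
Qed.

(** [K] is covered by finitely many integer translates of the cube, and on each of them the integral
    equals that on the cube by translation invariance of the measure and periodicity of [h]. *)
Lemma periodic_integral_lty (K : set V) : compact K ->
  (\int[(m1 \x lambda)%E]_(z in A `*` K) (h z)%:E < +oo)%E.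
Proof.
move=> cK; have [L L0 KL] := bounded_set_box (compact_bounded cK).
pose n := (Num.truncn L).+1.
have nL : L < n%:R by exact: truncnS_gt.
(* A digit f i between 0 and 2 n stands for the floor f i - n of y_i; k f is the opposite
   translation, bringing y back to the cube. *)
pose k (f : {ffun 'I_N -> 'I_n.*2.+1}) : 'rV[int]_N := \row_i (n%:Z - (f i)%:Z).
have mK : measurable K.
  rewrite -(setCK K); apply: measurableC; apply: open_measurable_rV.
  by apply: closed_openC; exact: (compact_closed (@norm_hausdorff _ _)).
have mhE : measurable_fun setT (fun z => (h z)%:E) by apply/measurable_EFinP.
have mT f : measurable (A `*` tile (k f)) by exact: measurableX.
apply: (@le_lt_trans _ _ (\int[(m1 \x lambda)%E]_(z in
    \big[setU/set0]_(f <- index_enum {ffun 'I_N -> 'I_n.*2.+1}) (A `*` tile (k f))) (h z)%:E)%E).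
  apply: ge0_subset_integral.
  - exact: measurableX.
  - exact: bigsetU_measurable.
  - exact: measurable_funTS.
  - by move=> z _; rewrite lee_fin.
  move=> [x y] [/= Ax Ky].
  have fi i : {m : 'I_n.*2.+1 | m%:Z = Num.floor (y ord0 i) + n%:Z}.
    have := KL y Ky i; rewrite ler_norml => /andP[y1 y2].
    have f1 : Num.floor (y ord0 i) <= n%:Z.
      by rewrite -(ler_int R) (le_trans (floor_le _))// (le_trans y2)// ltW.
    have f2 : - n%:Z <= Num.floor (y ord0 i).
      by rewrite floor_ge_int mulrNz (le_trans _ y1)// lerN2 ltW.
    have lt : (absz (Num.floor (y ord0 i) + n%:Z)%R < n.*2.+1)%N by lia.
    by exists (Ordinal lt) => /=; lia.
  rewrite -bigcup_seq; exists [ffun i => sval (fi i)]; first by rewrite /= mem_index_enum.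
  split => //=; rewrite /tile /= (_ : y + _ = frac_rV y); first exact: frac_rV_cube.
  rewrite frac_rVE; congr (_ + map_mx _ _); apply/rowP => i; rewrite !mxE ffunE.
  by case: (fi i) => m /= ->; lia.
by apply: ge0_integral_bigsetU_lty => // z; rewrite lee_fin.
Qed.

End periodic_extension.

(** * The compactness theorem *)

Section almost_everywhere_product.
Context {R : realType} d1 d2 (T1 : measurableType d1) (T2 : measurableType d2).
Variables (m1 : {measure set T1 -> \bar R}) (m2 : {sigma_finite_measure set T2 -> \bar R}).

Lemma ae_prod_fst (p : T1 -> Prop) : {ae m1, forall x, p x} ->
  {ae (m1 \x m2)%E, forall z, p z.1}.
Proof.
move=> [A [mA A0 Ap]]; exists (A `*` setT); split.
- exact: measurableX.
- by rewrite [LHS]product_measure1E// [X in (X * _)%E]A0 mul0e.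
- by move=> z /= np; split => //; exact: Ap.
Qed.

Lemma ae_prod_snd (p : T2 -> Prop) : {ae m2, forall x, p x} ->
  {ae (m1 \x m2)%E, forall z, p z.2}.
Proof.
move=> [A [mA A0 Ap]]; exists (setT `*` A); split.
- exact: measurableX.
- by rewrite [LHS]product_measure1E// [X in (_ * X)%E]A0 mule0.
- by move=> z /= np; split => //; exact: Ap.
Qed.

End almost_everywhere_product.

(** Serves to replace integrals over [Q] by integrals over the box, where the compactness result
    applies. *)
Lemma Rintegral_ae_extension {R : realType} d (X : measurableType d)
    (mu : {measure set X -> \bar R}) (D G : set X) (f g : X -> R) :
  measurable D -> measurable G -> G `<=` D ->
  measurable_fun G f -> measurable_fun setT g ->
  {ae mu, forall x, G x -> f x = g x} -> (forall x, D x -> ~ G x -> g x = 0) ->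
  \int[mu]_(x in G) f x = \int[mu]_(x in D) g x.
Proof.
move=> mD mG GD mf mg fg g0.
rewrite -{1}(setIidr GD) Rintegral_mkcondr; apply: Rintegral_ae_eq => //.
  exact/(measurable_restrictT f mG).
apply: filterS fg => x fgx Dx; rewrite patchE; case: ifPn => [|/negP].
  by rewrite inE.
by rewrite inE => /(g0 x Dx) ->.
Qed.

Section stochastic_test_functions.
Context {R : realType} {N : nat} d (Omega : measurableType d).
Variables (P : probability Omega R) (T : 'rV[R]_N -> Omega -> Omega).
Local Notation V := 'rV[R]_N.
Local Notation lambda := (lebesgue_rV R N).
Variable Phi : R -> R.

(** The order alpha = 0 of the definition: [multi_index_seq] is then empty and the derivative is [g]
    itself. *)
Lemma smooth_Omega_bounded g : smooth_Omega P T Phi g ->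
  exists2 M : R, 0 < M & {ae P, forall w, `|g w| <= M}.
Proof.
move=> [_ /(_ (fun=> 0%N))[h + [M gM]]].
have -> : multi_index_seq (fun _ : 'I_N => 0%N) = [::].
  by rewrite /multi_index_seq; elim: (enum _).
move=> /= hg; subst h; exists (`|M| + 1); first by rewrite ltr_pwDr.
by apply: filterS gM => w /le_trans; apply; rewrite (le_trans (ler_norm M))// lerDl.
Qed.

Lemma smooth_continuous (f : V -> R) : smooth f -> continuous f.
Proof. by move=> /(_ [::])[]. Qed.

Lemma smooth_compact_out (Q : set V) f x : smooth_compact Q f -> ~ Q x -> f x = 0.
Proof.
move=> [_ _ fQ] nQ; apply/eqP/negPn/negP => fx; apply: nQ; apply: fQ.
exact: subset_closure.
Qed.

Lemma Y_periodic_frac (f : V -> R) y : Y_periodic f -> f (frac_rV y) = f y.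
Proof. by move=> fper; rewrite frac_rVE fper. Qed.

Hypothesis T_dyn : dynamical_system P T.

(** Preimages of null sets under (x, w) |-> (x, T (c x) w) are null, so an a.e. bound on [Omega]
    survives composition with the flow. *)
Lemma ae_dynamical_system (c : R) (p : Omega -> Prop) : {ae P, forall w, p w} ->
  {ae (lambda \x P)%E, forall z, p (T (c *: z.1) z.2)}.
Proof.
move=> /(ae_prod_snd lambda)[A [mA A0 Ap]].
exists ((fun z => (z.1, T (c *: z.1) z.2)) @^-1` A); split.
- rewrite -[X in measurable X]setTI.
  have mS : measurable_fun setT (fun z : V * Omega => (z.1, T (c *: z.1) z.2)).
    by apply: measurable_fun_pair => //; exact: (measurable_flow T_dyn).
  exact: mS.
- by rewrite [LHS](micro_invariant T_dyn c mA).
- by move=> z /= np; apply: Ap.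
Qed.

End stochastic_test_functions.

Theorem theorem1p1 (R : realType) (N : nat) (N_gt1 : (1 < N)%N)
  (Q : set 'rV[R]_N) (Q_open : open Q) (Q_bounded : bounded_set Q)
  (d : measure_display) (Omega : measurableType d) (P : probability Omega R)
  (T : 'rV[R]_N -> Omega -> Omega) (T_dyn : dynamical_system P T)
  (Phi : R -> R) (Phi_young : young_function Phi)
  (L_separable : separable_space (orlicz P setT Phi) (luxemburg P setT Phi))
  (L_reflexive : reflexive_space (orlicz P setT Phi) (luxemburg P setT Phi))
  (Phi_Delta2 : Delta2 Phi) (Phi_conj_Delta2 : Delta2 (conjugate Phi))
  (eps : nat -> R) (eps_fundamental : fundamental_sequence eps)
  (u : nat -> 'rV[R]_N * Omega -> R) (u_bounded : bounded_sequence Q P Phi u) :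
  exists sigma : nat -> nat, {homo sigma : m n / (m < n)%N >-> (m < n)%N} /\
    exists u0 : 'rV[R]_N * Omega * 'rV[R]_N -> R,
      weak_2s_cvg Q P T Phi (eps \o sigma) (u \o sigma) u0.
Proof.
pose lambda := lebesgue_rV R N.
have POmega : (P setT < +oo)%E by rewrite [ltLHS](@probability_setT _ _ _ P) ltry.
have [coord mcoord dense] := separable_dense_sequence Phi_young measurableT POmega L_separable.
have [L' L'0 QL'] := bounded_set_box Q_bounded.
(* The 1 gives the strict inequality x_i < L of the half-open box. *)
pose L := L' + 1; have L0 : 0 < L by rewrite addr_gt0.
have QL : Q `<=` qbox L.
  by move=> x Qx i; have := QL' x Qx i; rewrite ler_norml /L => /andP[]; lra.
pose D := @macro_dom R N d Omega L; pose E := @cell_dom R N d Omega L.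
pose G : set ('rV[R]_N * Omega) := Q `*` setT.
pose H : set ('rV[R]_N * Omega * 'rV[R]_N) := Q `*` setT `*` unit_cube.
have mD : measurable D := @measurable_macro_dom R N d Omega L.
have mE : measurable E := @measurable_cell_dom R N d Omega L.
have mG : measurable G by apply: measurableX => //; exact: open_measurable_rV.
have mH : measurable H by apply: measurableX => //; exact: measurable_unit_cube.
have GD : G `<=` D by move=> z [/QL ? _]; split.
have HE : H `<=` E by move=> z [/GD ? ?]; split.
have [uL [C uC]] := u_bounded.
(* A positive constant strictly above all the norms, so that u_n / c has modular at most 1. *)
pose c := `|C| + 1; have c0 : 0 < c by rewrite /c ltr_pwDr.
have u1 n : (\int[(lambda \x P)%E]_(z in G) (Phi (`|u n z| / c))%:E <= 1)%E.
  have [] // := luxemburg_lt_modular Phi_young mG (uL n) (_ : _ < c).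
  by apply: (le_lt_trans (uC n)); rewrite (le_lt_trans (ler_norm C))// ltrDl.
pose v n : 'rV[R]_N * Omega -> R := (fun z => u n z / c) \_ G.
have mv n : measurable_fun setT (v n).
  by apply/(measurable_restrictT _ mG); apply: measurable_funM => //; exact: (uL n).1.
have v1 n : (\int[(lambda \x P)%E]_(z in D) (Phi `|v n z|)%:E <= 1)%E.
  apply: le_trans (u1 n); rewrite -[in leRHS](setIidr GD) [leRHS](integral_mkcondr _ D G).
  rewrite le_eqVlt; apply/orP; left; apply/eqP; apply: eq_integral => z _.
  rewrite /v !patchE; case: ifP => _; last by rewrite normr0 (young0 Phi_young).
  by rewrite normrM normfV (gtr0_norm c0).
have [sigma hsigma [w [mw w1 cw]]] := weak_compactness mD (macro_dom_lty P L) mE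
  (cell_dom_lty P L) (fun n => measurable_micro T_dyn (eps n))
  (fun n => @micro_dom R N d Omega T L (eps n))
  (@measurable_threshold R N d Omega coord mcoord)
  (micro_mean T_dyn (L := L) mcoord eps_fundamental) Phi_young mv v1.
exists sigma; split => //.
pose w' (z : 'rV[R]_N * Omega * 'rV[R]_N) := w (z.1, frac_rV z.2).
have mw' : measurable_fun setT w'.
  apply: (measurableT_comp mw); apply: measurable_fun_pair => //.
  exact: (measurableT_comp measurable_frac_rV).
(* The factor c undoes the normalisation v = u / c. *)
exists (fun z => c * w' z); split.
- by split => [n|]; [exact: uL|exists C => n; exact: uC].
- split => [K cK|]; last first.
    by apply: aeW => z _ k y; rewrite /w' /= frac_rVDz.
  split; first by apply: measurable_funTS; exact: measurable_funM.
  exists c => //; rewrite /modular.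
  have e z : Phi (`|c * w' z| / c) = Phi `|w' z|.
    by rewrite normrM (gtr0_norm c0) mulrAC divff ?mul1r// gt_eqF.
  under eq_integral do rewrite e.
  have mPhi : measurable_fun setT (fun z => Phi `|w' z|).
    by apply: measurable_young => //; exact: measurableT_comp.
  apply: (periodic_integral_lty (h := fun z => Phi `|w' z|)) => //.
  + by move=> z; exact: (young_ge0 Phi_young).
  + by move=> x k y; rewrite /w' /= frac_rVDz.
  have mPhiw : measurable_fun setT (fun z => (Phi `|w z|)%:E).
    by apply/measurable_EFinP; apply: measurable_young => //; exact: measurableT_comp.
  have mGc : measurable (G `*` @half_open_cube R N).
    by apply: measurableX => //; exact: measurable_half_open_cube.
  apply: le_lt_trans w1; rewrite [leLHS](eq_integral (fun z => (Phi `|w z|)%:E)).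
    apply: ge0_subset_integral => //; first exact: measurable_funTS.
    - by move=> z _; rewrite lee_fin (young_ge0 Phi_young).
    - by move=> z [/GD Dz /half_open_cube_subset Yz]; split.
  by move=> -[x y]; rewrite inE => -[_ /frac_rV_id ye]; rewrite /w' /= ye.
move=> _ [m [phi [g [psi [phiQ gs psis ->]]]]].
have [M M0 gM] : exists2 M : 'I_m -> R, (forall j, 0 < M j) &
    {ae P, forall w, forall j, `|g j w| <= M j}.
  have [M MP] := choice (fun j => let: ex_intro2 M M0 gM := smooth_Omega_bounded (gs j) in
    ex_intro (fun M => 0 < M /\ {ae P, forall w, `|g j w| <= M}) M (conj M0 gM)).
  exists M => [j|]; first by have [] := MP j.
  by apply: filter_forall => j; have [] := MP j.
have mg j : measurable_fun setT (g j) by have [[]] := gs j.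
have cphi j : continuous (phi j) by have [/smooth_continuous] := phiQ j.
have cpsi j : continuous (psi j) by have [/smooth_continuous] := psis j.
have mphi j := measurable_continuous_rV (cphi j).
have mpsi j := measurable_continuous_rV (cpsi j).
(* [t] is an everywhere bounded version of [g], as [approximable_product] requires. The c in [f0]
   compensates the division of u_n by c. *)
pose t j x := truncation (M j) (g j x).
have mt j : measurable_fun setT (t j) by exact: measurable_truncation.
pose f0 (z : 'rV[R]_N * Omega * 'rV[R]_N) :=
  \sum_(j < m) (c * phi j z.1.1) * t j z.1.2 * psi j z.2.
pose f (z : 'rV[R]_N * Omega * 'rV[R]_N) :=
  \sum_(j < m) phi j z.1.1 * g j z.1.2 * psi j z.2.
have mterm (a : 'rV[R]_N -> R) (b : Omega -> R) (e : 'rV[R]_N -> R) :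
    measurable_fun setT a -> measurable_fun setT b -> measurable_fun setT e ->
    measurable_fun setT (fun z : 'rV[R]_N * Omega * 'rV[R]_N => a z.1.1 * b z.1.2 * e z.2).
  move=> ma mb me; apply: measurable_funM; last exact: (measurableT_comp me).
  apply: measurable_funM.
    by apply: (measurableT_comp ma); exact: measurableT_comp.
  by apply: (measurableT_comp mb); exact: measurableT_comp.
have mf : measurable_fun setT f.
  by apply: measurable_sum => j; exact: mterm.
have mf0 : measurable_fun setT f0.
  apply: measurable_sum => j; apply: (mterm (fun x => c * phi j x)) => //.
  exact: measurable_funM.
have f0E z z' : z.1 = z'.1 -> (forall j, psi j z.2 = psi j z'.2) ->
    (forall j, `|g j z'.1.2| <= M j) -> f0 z = c * f z'.
  move=> e1 e2 gz; rewrite /f0 /f mulr_sumr; apply: eq_bigr => j _.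
  by rewrite e1 e2 /t truncation_id// !mulrA.
have app : approximable (lambda \x P)%E (lambda \x P \x lambda)%E D E (fun n => micro T (eps n))
    (@threshold R N d Omega coord) f0.
  apply: approximable_sum => //.
  - exact: macro_dom_lty.
  - exact: cell_dom_lty.
  - by move=> n; exact: (measurable_micro T_dyn).
  - by move=> n z; exact: micro_dom.
  - exact: measurable_threshold.
  move=> j; apply: (approximable_product T_dyn L0 mcoord (phi := fun x => c * phi j x)
    (g := t j) (psi := psi j) (M := M j)) => //.
  - by move=> x; apply: (continuous_comp (@cphi j x)); exact: mulrl_continuous.
  - by move=> x; apply: truncation_le; exact: ltW.
  move=> eta eta0; have [k kP] := dense (g j) eta (gs j).1 eta0.
  exists k; apply: le_trans kP; rewrite le_eqVlt; apply/orP; left; apply/eqP.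
  apply: ae_eq_integral => //.
  - by apply/measurable_EFinP; apply: measurableT_comp => //; exact: measurable_funB.
  - by apply/measurable_EFinP; apply: measurableT_comp => //; exact: measurable_funB.
  by apply: filterS gM => x gx _; rewrite /t truncation_id.
(* On [G], v f0 = u f a.e.: the bounds on the g_j hold along the flow by [ae_dynamical_system], and
   periodicity of the psi_j absorbs the fractional part. Outside [G], v = 0. *)
have lhs n : \int[(lambda \x P)%E]_(z in G) ((u \o sigma) n z *
      f (z.1, T (((eps \o sigma) n)^-1 *: z.1) z.2, ((eps \o sigma) n ^+ 2)^-1 *: z.1)) =
    \int[(lambda \x P)%E]_(z in D) (v (sigma n) z * f0 (micro T (eps (sigma n)) z)).
  have mT : measurable_fun setT (fun z : 'rV[R]_N * Omega => T ((eps (sigma n))^-1 *: z.1) z.2).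
    exact: (measurable_flow T_dyn).
  apply: Rintegral_ae_extension => //.
  - apply: measurable_funM; first exact: (uL (sigma n)).1.
    apply: measurable_funTS; apply: (measurableT_comp mf).
    apply: measurable_fun_pair; first exact: measurable_fun_pair.
    by apply: (measurableT_comp (measurable_scale _)).
  - by apply: measurable_funM => //; apply: (measurableT_comp mf0); exact: (measurable_micro T_dyn).
  - apply: filterS (ae_dynamical_system T_dyn (eps (sigma n))^-1 gM) => z gz Gz.
    rewrite /v patchE mem_set//.
    rewrite (f0E _ (z.1, T ((eps (sigma n))^-1 *: z.1) z.2, (eps (sigma n) ^+ 2)^-1 *: z.1)) //=.
      by rewrite mulrA divfK ?gt_eqF//.
    by move=> j; rewrite Y_periodic_frac//; have [] := psis j.
  - by move=> z _ nG; rewrite /v patchE memNset ?mul0r.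
(* On the half-open cube w' = w, and the rest of the closed cube is null. Outside [Q] the compactly
   supported phi_j vanish. *)
have rhs : \int[(lambda \x P \x lambda)%E]_(z in H) (c * w' z * f z) =
    \int[(lambda \x P \x lambda)%E]_(z in E) (w z * f0 z).
  have cube : {ae lambda, forall y, unit_cube y -> @half_open_cube R N y}.
    exists (@unit_cube R N `\` @half_open_cube R N); split.
    - by apply: measurableD; [exact: measurable_unit_cube|exact: measurable_half_open_cube].
    - exact: lebesgue_cube_boundary.
    - by move=> y /= /not_implyP.
  apply: Rintegral_ae_extension => //.
  - by apply: measurable_funTS; apply: measurable_funM => //; exact: measurable_funM.
  - exact: measurable_funM.
  - have gM' := ae_prod_fst lambda (ae_prod_snd lambda gM).
    have cube' := ae_prod_snd (lambda \x P)%E cube.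
    apply: filterS2 gM' cube' => -[z y] /= gz yc [_ /yc hy].
    by rewrite (f0E _ (z, y))// /w' /= (frac_rV_id hy) mulrCA mulrA.
  - move=> z [[_ _] Yz] nH; rewrite /f0 big1 ?mulr0// => j _.
    rewrite (smooth_compact_out (phiQ j)) ?mulr0 ?mul0r// => Qz; apply: nH.
    by split.
rewrite [X in _ --> X]rhs; under eq_fun do rewrite lhs.
exact: cw.
Qed.
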